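(* Let $\Lambda:I\to L(W)$ be a monotonically nondecreasing smooth curve with Young diagram $D$ (whose reduction is $\Delta$, with levels $\Upsilon_1,\dots,\Upsilon_d$ of sizes $r_1,\dots,r_d$). Then there exists a normal moving frame $(\{E_a(t)\}_{a\in\Delta},\{F_a(t)\}_{a\in\Delta})$ of $\Lambda(\cdot)$. Moreover, given such a normal moving frame, a moving frame $(\{\widetilde E_a(t)\}_{a\in\Delta},\{\widetilde F_a(t)\}_{a\in\Delta})$ is a normal moving frame of $\Lambda(\cdot)$ if and only if for every $1\le i\le d$ there exists a constant (independent of $t$) orthogonal $r_i\times r_i$ matrix $U_i$ such that for all $t$ $$\widetilde E_a(t)=E_a(t)U_i,\qquad \widetilde F_a(t)=F_a(t)U_i\qquad\text{for all } a\in\Upsilon_i.$$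
   Context: **Curves.** $W$ is a real $2m$-dimensional vector space with symplectic form $\omega$; $L(W)$ is the set of Lagrangian ($m$-dimensional, $\omega|_\Lambda=0$) subspaces; $\Lambda:I\to L(W)$ is a smooth curve on an interval $I$. For a smooth curve of subspaces $\Lambda(\cdot)$, $\mathfrak S(\Lambda)$ is the set of smooth curves $\ell$ in $W$ with $\ell(t)\in\Lambda(t)$ for all $t$, and the $i$th extension is $\Lambda^{(i)}(\tau)=\mathrm{span}\{\frac{d^j}{d\tau^j}\ell(\tau):\ell\in\mathfrak S(\Lambda),\,0\le j\le i\}$. Standing assumptions: $\dim\Lambda^{(i)}(t)$ is independent of $t$ for every $i$, and $\Lambda^{(p)}(t)=W$ for some integer $p$. The velocity $\dot\Lambda(t)$ is identified with the quadratic form on $\Lambda(t)$ given by $v\mapsto\omega(\ell'(t),\ell(t))$, where $\ell\in\mathfrak S(\Lambda)$, $\ell(t)=v$ (it is well defined). The curve is monotonically nondecreasing if $\dot\Lambda(t)$ is nonnegative definite for all $t$. **Diagrams.** The Young diagram $D$ of the curve is the one whose $i$th column has $\dim\Lambda^{(i)}-\dim\Lambda^{(i-1)}$ boxes ($i\ge1$, $\Lambda^{(0)}=\Lambda$); these numbers are nonincreasing in $i$. Any Young diagram $D$ is uniquely a union of $d$ rectangular diagrams $D_i$ ($r_i$ rows, $p_i$ columns), $1\le i\le d$, stacked from top to bottom, with $p_1>p_2>\dots>p_d$. The reduction $\Delta$ of $D$ is the Young diagram with $d$ rows, the $i$th of length $p_i$. Boxes of $\Delta$ are called superboxes and rows levels;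 $\Upsilon_i$ is the $i$th level. The $j$th superbox of the $i$th level corresponds to the $j$th column of $D_i$ and has size $r_i$. $a_i$ and $\sigma_i$ are the first and the last superbox of $\Upsilon_i$; the $\sigma_i$ are called special and $\mathcal S=\{\sigma_1,\dots,\sigma_d\}$; $\mathcal F_1$ is the first column of $\Delta$; $l$ and $r$ denote left and right shifts by one superbox. **Normal mappings.** A mapping $R:\Delta\times\Delta\to\{\text{real matrices}\}$ is compatible with $D$ if $R(a,b)$ has size $s_2\times s_1$ whenever $a,b$ have sizes $s_1,s_2$; it is symmetric if $R(b,a)=R(a,b)^T$. For $1\le j<i\le d$ consider the tuple of pairs $$(a_j,a_i),(a_j,r(a_i)),(r(a_j),r(a_i)),(r(a_j),r^2(a_i)),\dots,(r^{p_i-1}(a_j),r^{p_i-1}(a_i)),(r^{p_i}(a_j),r^{p_i-1}(a_i)),\dots,(r^{p_j-1}(a_j),r^{p_i-1}(a_i)).\quad(\ast)$$ (One shifts alternately the second and the first entry until the second entry is special; after that only the first entry is shifted.) A symmetric compatible mapping $R$ is quasi-normal if (1) among all $R(a,b)$ with $b$ not higher than $a$ in $\Delta$, the only possibly nonzero ones are $R(a,a)$ for $a\in\Delta$, $R(a,r(a))$ and $R(r(a),a)$ for nonspecial $a$, and $R(a,b)$ for pairs $(a,b)$ appearing in the tuples $(\ast)$, $1\le j<i\le d$; (2) $R(a,r(a))$ is antisymmetric for every nonspecial $a$. It is normal if in addition, for all $1\le j<i\le d$, the matrices corresponding to the first $p_j-p_i-1$ pairs of $(\ast)$ are zero. **Frames.**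 A frame $(\{e_\alpha\}_{\alpha\in D},\{f_\alpha\}_{\alpha\in D})$ of $W$ is Darboux if $\omega(e_\alpha,e_\beta)=\omega(f_\alpha,f_\beta)=\omega(f_\alpha,e_\beta)-\delta_{\alpha,\beta}=0$ for all $\alpha,\beta\in D$. For a superbox $a$ of size $s$ with corresponding boxes $\alpha_1,\dots,\alpha_s$ of $D$ (top to bottom), $E_a=(e_{\alpha_1},\dots,e_{\alpha_s})$, $F_a=(f_{\alpha_1},\dots,f_{\alpha_s})$, viewed as rows of vectors (so $E_aU$ makes sense for matrices $U$). A moving Darboux frame (smooth in $t$) $(\{E_a(t)\},\{F_a(t)\})$ is a normal moving frame of a monotonically nondecreasing curve $\Lambda$ with Young diagram $D$ if $\Lambda(t)=\mathrm{span}\{E_a(t)\}_{a\in\Delta}$ for all $t$ and there is a one-parameter family of normal mappings $R_t$ with $$E_a'=E_{l(a)}\ (a\in\Delta\setminus\mathcal F_1),\quad E_a'=F_a\ (a\in\mathcal F_1),$$ $$F_a'=\sum_{b\in\Delta}E_bR_t(a,b)-F_{r(a)}\ (a\in\Delta\setminus\mathcal S),\quad F_a'=\sum_{b\in\Delta}E_bR_t(a,b)\ (a\in\mathcal S).$$ *)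

(* Defs.v *)
From HB Require Import structures.
From mathcomp Require Import all_boot all_order all_algebra.
From mathcomp Require Import all_classical all_reals all_analysis.

Set Implicit Arguments.
Unset Strict Implicit.
Unset Printing Implicit Defensive.

Import Order.TTheory GRing.Theory Num.Theory.
Import numFieldNormedType.Exports.

Local Open Scope classical_set_scope.
Local Open Scope ring_scope.

Section Calculus.
Variables (R : realType) (W : vectType R).
Implicit Types (A : set R) (f : R -> W).

(* W carries its unique Hausdorff vector space topology, so that limits in W
   are limits of coordinates in a basis. *)
Local Notation basisW := (vbasis (fullv : {vspace W})).

Definition diff_quot f (i : 'I_(\dim {:W})) (t s : R) : R :=
  (s - t)^-1 * coord basisW i (f s - f t).

(* All derivatives are taken within the domain A, so that endpoints of an
   interval are allowed (one-sided derivatives there); values of f outside A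
   are irrelevant. *)
Definition derivable_within A f (t : R) : Prop :=
  forall i, cvg (diff_quot f i t @ within A t^').

Definition derive_within A f (t : R) : W :=
  \sum_i lim (diff_quot f i t @ within A t^') *: basisW`_i.

Definition derive_withinn A (n : nat) f : R -> W := iter n (derive_within A) f.

Definition smooth A f : Prop :=
  forall (n : nat) (t : R), A t -> derivable_within A (derive_withinn A n f) t.

Definition is_vspan (S : set W) (U : {vspace W}) : Prop :=
  (forall v, S v -> v \in U) /\
  (forall V : {vspace W}, (forall v, S v -> v \in V) -> (U <= V)%VS).

Definition vspan (S : set W) : {vspace W} := xget 0%VS [set U | is_vspan S U].

Lemma vspanP (S : set W) : is_vspan S (vspan S).
Proof.
apply: (xgetPex 0%VS); rewrite /=.
suff H n : forall U : {vspace W}, (forall V : {vspace W},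
    (forall v, S v -> v \in V) -> (U <= V)%VS) ->
    (\dim {:W} - \dim U <= n)%N -> exists U, is_vspan S U.
  by apply: (H _ 0%VS _ (leqnn _)) => V _; exact: sub0v.
elim: n => [|n IH] U UV dU.
  exists U; split=> // v _.
  suff -> : U = {:W}%VS by exact: memvf.
  by apply/eqP; rewrite eqEdim subvf /= -subn_eq0 -leqn0.
have [SU|/existsNP[v /not_implyP[Sv /negP vU]]] :=
  pselect (forall v, S v -> v \in U); first by exists U.
apply: (IH (U + <[v]>)%VS).
  by move=> V SV; rewrite subv_add (UV _ SV) -memvE SV.
have ltU : (\dim U < \dim (U + <[v]>)%VS)%N.
  rewrite ltn_neqAle dimvS ?addvSl // andbT.
  apply: contra vU => /eqP dE.
  have /eqP -> : U == (U + <[v]>)%VS by rewrite eqEdim addvSl -dE leqnn.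
  by rewrite memvE addvSr.
have leW : (\dim (U + <[v]>)%VS <= \dim {:W})%N by rewrite dimvS ?subvf.
rewrite -ltnS; apply: leq_trans dU.
by apply: ltn_sub2l => //; exact: leq_trans ltU leW.
Qed.

End Calculus.

Section Curves.
Variables (R : realType) (W : vectType R).
Variables (omega : {skew_symmetric W}) (I : set R).
Implicit Types (Lam : R -> {vspace W}) (l : R -> W).

(* Smoothness of a map into a Grassmannian: locally on I, the subspaces have a
   basis depending smoothly on t, i.e. the map lifts locally to a smooth map
   into the manifold of k-frames. *)
Definition smooth_subspaces Lam : Prop :=
  forall t0, I t0 -> exists J : set R, [/\ open J, J t0 &
    exists (k : nat) (X : 'I_k -> R -> W),
      (forall i, smooth (I `&` J) (X i)) /\
      (forall t, (I `&` J) t -> basis_of (Lam t) [seq X i t | i : 'I_k])].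

Definition lagrangian (m : nat) (L : {vspace W}) : Prop :=
  \dim L = m /\ (forall u v, u \in L -> v \in L -> omega u v = 0).

Definition lagrangian_curve (m : nat) Lam : Prop :=
  smooth_subspaces Lam /\ (forall t, I t -> lagrangian m (Lam t)).

Definition sections Lam : set (R -> W) :=
  [set l | smooth I l /\ (forall t, I t -> l t \in Lam t)].

Definition extension Lam (i : nat) (t : R) : {vspace W} :=
  vspan [set v | exists2 l, sections Lam l &
                 exists2 j, (j <= i)%N & v = derive_withinn I j l t].

Definition constant_dimensions Lam : Prop :=
  forall i s t, I s -> I t -> \dim (extension Lam i s) = \dim (extension Lam i t).

Definition eventually_full Lam : Prop :=
  exists p : nat, forall t, I t -> extension Lam p t = fullv.

(* The value at the vector l t of the velocity, as a quadratic form. *)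
Definition velocity l (t : R) : R := omega (derive_within I l t) (l t).

Definition nondecreasing_curve Lam : Prop :=
  forall l t, sections Lam l -> I t -> 0 <= velocity l t.

End Curves.

(* A Young diagram is the sequence of its row lengths, from top to bottom. *)
Definition is_young (D : seq nat) : bool := sorted geq D && (0 \notin D)%N.

(* Number of boxes in the ith column, for i >= 1. *)
Definition column (D : seq nat) (i : nat) : nat := count (leq i) D.

Definition curve_diagram (R : realType) (W : vectType R) (I : set R)
    (Lam : R -> {vspace W}) (D : seq nat) : Prop :=
  forall i t, I t ->
    \dim (extension I Lam i.+1 t) =
      (\dim (extension I Lam i t) + column D i.+1)%N.

Section Diagrams.
Variable D : seq nat.

(* The rectangles D_i have as widths the distinct row lengths of D (undup keeps
   them in decreasing order) and as heights their multiplicities. *)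
Definition depth : nat := size (undup D).
Definition width (i : 'I_depth) : nat := nth 0%N (undup D) i.
Definition height (i : 'I_depth) : nat := count_mem (width i) D.

(* A superbox: its level and its column, both counted from 0. *)
Definition superbox : finType := {i : 'I_depth & 'I_(width i)}.
Definition level (a : superbox) : 'I_depth := tag a.
Definition ssize (a : superbox) : nat := height (level a).
Definition sbcol (a : superbox) : nat := tagged a.
Definition sbox (i : 'I_depth) (c : 'I_(width i)) : superbox :=
  Tagged (fun i => 'I_(width i)) c.

(* A box of D: a column of some D_i together with a row of this D_i. *)
Definition box : finType := {a : superbox & 'I_(ssize a)}.
Definition bx (a : superbox) (k : 'I_(ssize a)) : box :=
  Tagged (fun a => 'I_(ssize a)) k.

Definition in_first_column (a : superbox) : bool := sbcol a == 0%N.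
Definition special (a : superbox) : bool := (sbcol a).+1 == width (level a).

(* The shifts, made total by wrapping around at the ends of the level; they are
   only used where the shifted superbox exists.  Sizes are preserved
   definitionally. *)
Definition sleft (a : superbox) : superbox := sbox (ord_pred (tagged a)).
Definition sright (a : superbox) : superbox := sbox (ordS (tagged a)).

(* The tuple of pairs attached to levels j < i of widths pj > pi; the pair
   (r^x(a_j), r^y(a_i)) is recorded as (x, y). *)
Definition pair_tuple (pj pi : nat) : seq (nat * nat) :=
  [seq (k./2, uphalf k) | k <- iota 0 (pi.*2 - 1)] ++
  [seq (k, pi.-1) | k <- iota pi (pj - pi)].

Definition pairs_of (a b : superbox) : seq (nat * nat) :=
  pair_tuple (width (level a)) (width (level b)).

Variable R : realType.

Definition compatible_mapping : Type :=
  forall a b : superbox, 'M[R]_(ssize b, ssize a).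
Implicit Type M : compatible_mapping.

Definition symmetric_mapping M : Prop := forall a b, M b a = (M a b)^T.

Definition quasi_normal M : Prop :=
  [/\ symmetric_mapping M,
      forall a b, (level a <= level b)%N -> M a b != 0 ->
        [\/ b = a,
            ~~ special a /\ b = sright a,
            ~~ special b /\ a = sright b |
            (level a < level b)%N /\ (sbcol a, sbcol b) \in pairs_of a b] &
      forall a, ~~ special a -> (M a (sright a))^T = - M a (sright a)].

Definition normal_mapping M : Prop :=
  quasi_normal M /\
  forall a b, (level a < level b)%N ->
    (sbcol a, sbcol b) \in
      take (width (level a) - width (level b) - 1) (pairs_of a b) ->
    M a b = 0.

End Diagrams.

Arguments sbox {D i} c.
Arguments bx {D a} k.

(* The row of vectors E_a(t) of a family of curves indexed by the boxes of D. *)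
Definition row_at (R : realType) (W : vectType R) (D : seq nat)
    (e : box D -> R -> W) (a : superbox D) (t : R) : 'I_(ssize a) -> W :=
  fun k => e (bx k) t.

Arguments row_at {R W D} e a t _.

Section Frames.
Variables (R : realType) (W : vectType R).
Variables (omega : {skew_symmetric W}) (I : set R) (D : seq nat).
Implicit Types e f : box D -> R -> W.

(* The product of a row of vectors with a matrix. *)
Definition vrow_mul (s n : nat) (E : 'I_s -> W) (U : 'M[R]_(s, n)) : 'I_n -> W :=
  fun k => \sum_j U j k *: E j.

Definition is_frame e f (t : R) : bool :=
  basis_of fullv ([seq e x t | x : box D] ++ [seq f x t | x : box D]).

Definition moving_frame e f : Prop :=
  [/\ forall x, smooth I (e x), forall x, smooth I (f x) &
      forall t, I t -> is_frame e f t].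

Definition darboux e f (t : R) : Prop :=
  forall x y, [/\ omega (e x t) (e y t) = 0,
                  omega (f x t) (f y t) = 0 &
                  omega (f x t) (e y t) = (x == y)%:R].

Definition structure_equations (M : compatible_mapping D R) e f (t : R) : Prop :=
  forall (a : superbox D) (k : 'I_(ssize a)),
  [/\ ~~ in_first_column a ->
        derive_within I (e (bx k)) t = row_at e (sleft a) t k,
      in_first_column a ->
        derive_within I (e (bx k)) t = row_at f a t k,
      ~~ special a ->
        derive_within I (f (bx k)) t =
          \sum_b vrow_mul (row_at e b t) (M a b) k - row_at f (sright a) t k &
      special a ->
        derive_within I (f (bx k)) t =
          \sum_b vrow_mul (row_at e b t) (M a b) k].

Definition normal_moving_frame (Lam : R -> {vspace W}) e f : Prop :=
  [/\ moving_frame e f,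
      forall t, I t -> darboux e f t,
      forall t, I t -> Lam t = <<[seq e x t | x : box D]>>%VS &
      exists M : R -> compatible_mapping D R,
        forall t, I t -> normal_mapping (M t) /\ structure_equations (M t) e f t].

End Frames.

(* Main.v *)
(* Curves in W are vectors over the differential ring of smooth functions on I.
   The structure equations express the whole frame through its entries eps_r at
   the special superboxes, one for each row r of D, of length p_r: going left
   along a level differentiates, F_a = eps_r^(p_r) for a in the first column,
   and the remaining F_a are then recovered up to a gauge E Gamma.  A frame of
   this kind can be gauged to a normal one exactly when the pairings
   omega(eps_r^(x), eps_l^(k)) vanish for x + k < 2 max(p_r, p_l), or, if
   p_r = p_l, for x + k <= 2 p_r, except that they are +-delta_rl for
   x + k = 2 p_r - 1.

   Existence: the eps_r are built by descending p.  The sections whose first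
   p - 1 derivatives are sections, and which are orthogonal to the longer rows
   already found, form a bundle with a smooth frame eta; on it
   omega(eta^(p), eta^(p-1)) is positive definite because the curve is monotone,
   and a linear differential equation turns eta into the required eps.  The
   gauge is found by eliminating the curvature along antidiagonals.

   Uniqueness: a filtration by the order in time shows that a normal frame has
   these pairings, which determine the eps_r up to a constant orthogonal matrix
   on each level, and no nonzero gauge preserves normality. *)
Require Import Defs.
From HB Require Import structures.
From mathcomp Require Import all_boot all_order all_algebra.
From mathcomp Require Import all_classical all_reals all_analysis.
From mathcomp Require Import ring lra zify.

Set Implicit Arguments.
Unset Strict Implicit.
Unset Printing Implicit Defensive.

Import Order.TTheory GRing.Theory Num.Theory.
Import numFieldNormedType.Exports.

Local Open Scope classical_set_scope.
Local Open Scope ring_scope.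

(** * Smooth functions on a set without isolated points *)

(** The ring of smooth functions is not a field: ranks and kernels make sense only at each t, and a
    global answer on a possibly noncompact [I] needs either a closed formula (the projector of a
    family of constant rank) or a linear differential equation (Kato's transport). The rest of the
    algebra holds over any commutative ring with a derivation and invertible positive integers, and
    its main tool is integration by parts.

    The bound 2 max(p_r, p_l) reflects the zero matrices in the definition of a normal mapping: they
    delay the moment at which the derivatives of a longer eps_l acquire components along a shorter
    level, so that eps_l^(k) pairs with eps_r at k = 2 p_l at the earliest.

    On a level with r rows of length p, the pairings of order 2 p - 1 fix a smooth frame up to a
    function with values in O(r). Those of order 2 p contain the first derivative of this function
    and so fix it up to a constant. This is the source both of the differential equation in the
    existence part and of the constancy of the U_i. *)

Section WithinDerivative.
Variable R : realType.
Implicit Types (A J : set R) (f g : R -> R) (t l m : R).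

Lemma within_dnbhsP A t (P : set R) :
  within A t^' P <->
  exists2 e, 0 < e & forall s, `|s - t| < e -> s != t -> A s -> P s.
Proof.
split.
  rewrite /within/= /dnbhs /within/= => /nbhs_ballP[e e0 H].
  exists e => // s ste st As; apply: H => //.
  by rewrite -ball_normE /ball_/= distrC.
move=> [e e0 H]; rewrite /within/= /dnbhs /within/=; apply/nbhs_ballP.
by exists e => // s; rewrite -ball_normE /ball_/= distrC => ts st As; exact: H.
Qed.

Lemma within_dnbhs_eq A t (f g : R -> R) (F : set_system R) :
  (forall s, s != t -> A s -> f s = g s) ->
  f @ within A t^' --> F -> g @ within A t^' --> F.
Proof.
move=> fg; apply: cvg_trans; apply: near_eq_cvg.
by apply/within_dnbhsP; exists 1 => // s _ st As; exact: fg.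
Qed.

Definition quot f t (s : R) : R := (s - t)^-1 * (f s - f t).

Definition has_der A f t l : Prop := quot f t @ within A t^' --> l.

(** No point of [A] is isolated in [A], which makes derivatives within [A] unique. *)
Definition perfect A : Prop := forall t, A t -> ProperFilter (within A t^').

Lemma has_der_ext A f g t l :
  A t -> (forall s, A s -> f s = g s) -> has_der A f t l -> has_der A g t l.
Proof.
by move=> At fg; apply: within_dnbhs_eq => s _ As; rewrite /quot !fg.
Qed.

Lemma within_setI_dnbhs A J t :
  open J -> J t -> within (A `&` J) t^' = within A t^'.
Proof.
move=> oJ Jt; rewrite eqEsubset.
have nJ : nbhs t J by apply: open_nbhs_nbhs.
split=> B /within_dnbhsP[e e0 H]; apply/within_dnbhsP; last first.
  by exists e => // s se st [As _]; exact: H.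
move/nbhs_ballP: nJ => [d d0 dJ].
exists (Num.min e d); first by rewrite lt_min e0.
move=> s; rewrite lt_min => /andP[se sd] st As; apply: H => //; split => //.
by apply: dJ; rewrite -ball_normE /ball_/= distrC.
Qed.

Lemma has_der_local A J f t l :
  open J -> J t -> has_der (A `&` J) f t l <-> has_der A f t l.
Proof. by move=> oJ Jt; rewrite /has_der within_setI_dnbhs. Qed.

Lemma perfect_setI A J : perfect A -> open J -> perfect (A `&` J).
Proof. by move=> pA oJ t [/pA] FA Jt; rewrite within_setI_dnbhs. Qed.

Lemma has_der_cst A t c : has_der A (fun=> c) t 0.
Proof.
apply: (@cvg_trans _ ((fun=> 0 : R) @ within A t^')); last exact: cvg_cst.
by apply: near_eq_cvg; apply: nearW => s; rewrite /quot subrr mulr0.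
Qed.

Lemma has_der_add A f g t l m :
  has_der A f t l -> has_der A g t m -> has_der A (f \+ g) t (l + m).
Proof.
move=> fl gm; apply: within_dnbhs_eq (cvgD fl gm) => s _ _.
by rewrite fctE /quot/=; ring.
Qed.

Lemma has_der_opp A f t l : has_der A f t l -> has_der A (fun s => - f s) t (- l).
Proof.
move=> fl; apply: within_dnbhs_eq (cvgN fl) => s _ _.
by rewrite fctE /quot/=; ring.
Qed.

Lemma cvg_id_dnbhs A t : id @ within A t^' --> t.
Proof.
move=> B /nbhs_ballP[d d0 dB].
apply/within_dnbhsP; exists d => // s sd _ _.
by apply: dB; rewrite -ball_normE /ball_/= distrC.
Qed.

Lemma has_der_cvg A f t l : has_der A f t l -> f @ within A t^' --> f t.
Proof.
move=> fl.
have h : (fun s => f t + (s - t) * quot f t s) @ within A t^' --> f t + (t - t) * l.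
  apply: cvgD; first exact: cvg_cst.
  by apply: cvgM => //; apply: cvgB; [exact: cvg_id_dnbhs|exact: cvg_cst].
rewrite subrr mul0r addr0 in h; apply: within_dnbhs_eq h => s st _.
by rewrite /quot mulrA divff ?mul1r ?subr_eq0// addrC subrK.
Qed.

Lemma has_der_mul A f g t l m :
  has_der A f t l -> has_der A g t m ->
  has_der A (fun s => f s * g s) t (l * g t + f t * m).
Proof.
move=> fl gm.
have h : (fun s => quot f t s * g s + f t * quot g t s) @ within A t^'
     --> l * g t + f t * m.
  apply: cvgD; apply: cvgM => //; [exact: has_der_cvg gm|exact: cvg_cst].
apply: within_dnbhs_eq h => s _ _.
by rewrite /quot/=; ring.
Qed.

Lemma has_der_inv A f t l : A t -> (forall s, A s -> f s != 0) ->
  has_der A f t l -> has_der A (fun s => (f s)^-1) t (- (l / f t ^+ 2)).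
Proof.
move=> At f0 fl.
have h : (fun s => - (quot f t s * ((f s)^-1 * (f t)^-1))) @ within A t^'
     --> - (l * ((f t)^-1 * (f t)^-1)).
  apply: cvgN; apply: cvgM => //; apply: cvgM; last exact: cvg_cst.
  by apply: cvgV; [exact: f0|exact: has_der_cvg fl].
rewrite -invfM -expr2 in h.
apply: within_dnbhs_eq h => s st As; rewrite /quot; field.
by rewrite !f0 ?subr_eq0.
Qed.

(** The mean value theorem takes [is_derive] at interior points; the ends of an interval are then
    handled by continuity. *)
Lemma has_der_is_derive A f t l : A° t -> has_der A f t l -> is_derive t 1 f l.
Proof.
move=> At fl.
have h : (fun h : R => h^-1 *: (f (h *: 1 + t) - f t)) @ 0^' --> l.
  move=> B /fl /within_dnbhsP[e e0 H].
  move/nbhs_ballP: At => [d d0 dA].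
  rewrite /= nbhs_simpl /dnbhs /within/=; apply/nbhs_ballP.
  exists (Num.min e d); first by rewrite /= lt_min e0.
  move=> h; rewrite -ball_normE /ball_/= sub0r normrN lt_min => /andP[he hd] h0.
  rewrite /preimage/= /GRing.scale/= mulr1.
  have : B (quot f t (h + t)).
    apply: H; rewrite ?addrK//; first by rewrite -subr_eq0 addrK.
    by apply: dA; rewrite -ball_normE /ball_/= opprD addrC subrK normrN.
  by rewrite /quot addrK.
apply: DeriveDef; first by apply/cvg_ex; exists l; exact: h.
exact: cvg_lim h.
Qed.

End WithinDerivative.

Section SmoothScalar.
Variable R : realType.
Implicit Types (A J : set R) (f g : R -> R) (t l m : R) (n : nat).

(** The value 0 off [A] makes [der A f] depend only on the values of [f] on [A], so that [der_ext]
    is an equality of functions. *)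
Definition der A f t : R := if `[< A t >] then lim (quot f t @ within A t^') else 0.

Lemma derP A f t l : perfect A -> A t -> has_der A f t l -> der A f t = l.
Proof.
move=> pA At fl; rewrite /der; case: asboolP => // _.
by have FF := pA _ At; apply: cvg_lim fl; exact: Rhausdorff.
Qed.

Lemma der_out A f t : ~ A t -> der A f t = 0.
Proof. by rewrite /der; case: asboolP. Qed.

Definition diff_on A f : Prop := forall t, A t -> exists l, has_der A f t l.

Lemma diff_onP A f : perfect A -> diff_on A f ->
  forall t, A t -> has_der A f t (der A f t).
Proof. by move=> pA df t At; have [l fl] := df _ At; rewrite (derP pA At fl). Qed.

(** Offset by one from the usual classes: [Cn A 0] already asks for differentiability, so [Cn A n]
    gives n + 1 derivatives and continuity comes for free at every stage. *)
Fixpoint Cn A n f : Prop :=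
  diff_on A f /\ if n is n'.+1 then Cn A n' (der A f) else True.

Definition smooth_on A f : Prop := forall n, Cn A n f.

Lemma Cn_diff A n f : Cn A n f -> diff_on A f.
Proof. by case: n => [|n] []. Qed.

Lemma der_ext A f g : (forall s, A s -> f s = g s) -> der A f = der A g.
Proof.
move=> fg; apply/funext => t; rewrite /der; case: asboolP => // At.
congr (lim _); apply/seteqP; split=> B /within_dnbhsP[e e0 H];
  apply/within_dnbhsP; exists e => // s se st As; have := H s se st As;
  by rewrite /preimage/= /quot !fg.
Qed.

Lemma Cn_ext A n f g : (forall s, A s -> f s = g s) -> Cn A n f -> Cn A n g.
Proof.
move=> fg; have h : diff_on A f -> diff_on A g.
  by move=> df t At; have [l fl] := df t At; exists l; apply: has_der_ext fl.
by case: n => [|n] /= [/h ? ?]; split => //; rewrite -(der_ext fg).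
Qed.

Lemma CnW A n f : Cn A n.+1 f -> Cn A n f.
Proof. by elim: n f => [|n IH] f [df]; [move=> _; split|move=> /IH; split]. Qed.

Lemma smooth_on_der A f : smooth_on A f -> smooth_on A (der A f).
Proof. by move=> sf n; case: (sf n.+1). Qed.

Section Perfect.
Variables (A : set R) (pA : perfect A).

Lemma Cn_cst n c : Cn A n (fun=> c).
Proof.
elim: n c => [|n IH] c; split => //.
- by move=> t At; exists 0; exact: has_der_cst.
- by move=> t At; exists 0; exact: has_der_cst.
apply: Cn_ext (IH 0) => t At; symmetry; apply: derP => //; exact: has_der_cst.
Qed.

Lemma Cn_add n f g : Cn A n f -> Cn A n g -> Cn A n (fun s => f s + g s).
Proof.
elim: n f g => [|n IH] f g [df Cf] [dg Cg].
  split=> // t At; have [l fl] := df t At; have [m gm] := dg t At.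
  by exists (l + m); exact: has_der_add.
split.
  move=> t At; have [l fl] := df t At; have [m gm] := dg t At.
  by exists (l + m); exact: has_der_add.
apply: Cn_ext (IH _ _ Cf Cg) => t At; symmetry; apply: derP => //.
by apply: has_der_add; exact: diff_onP.
Qed.

Lemma Cn_opp n f : Cn A n f -> Cn A n (fun s => - f s).
Proof.
elim: n f => [|n IH] f [df Cf].
  split=> // t At; have [l fl] := df t At.
  by exists (- l); exact: has_der_opp.
split.
  by move=> t At; have [l fl] := df t At; exists (- l); exact: has_der_opp.
apply: Cn_ext (IH _ Cf) => t At; symmetry; apply: derP => //.
by apply: has_der_opp; exact: diff_onP.
Qed.

Lemma Cn_mul n f g : Cn A n f -> Cn A n g -> Cn A n (fun s => f s * g s).
Proof.
elim: n f g => [|n IH] f g Cf Cg; have df := Cn_diff Cf; have dg := Cn_diff Cg.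
  split=> // t At; have [l fl] := df t At; have [m gm] := dg t At.
  by exists (l * g t + f t * m); exact: has_der_mul.
split.
  move=> t At; have [l fl] := df t At; have [m gm] := dg t At.
  by exists (l * g t + f t * m); exact: has_der_mul.
have [[_ Cf'] [_ Cg']] := (Cf, Cg).
apply: Cn_ext (Cn_add (IH _ _ Cf' (CnW Cg)) (IH _ _ (CnW Cf) Cg')) => t At.
by symmetry; apply: derP => //; apply: has_der_mul; exact: diff_onP.
Qed.

Lemma Cn_inv n f : (forall t, A t -> f t != 0) ->
  Cn A n f -> Cn A n (fun s => (f s)^-1).
Proof.
move=> f0; elim: n => [|n IH] Cf; have df := Cn_diff Cf.
  split=> // t At; have [l fl] := df t At.
  by exists (- (l / f t ^+ 2)); exact: has_der_inv.
split.
  move=> t At; have [l fl] := df t At.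
  by exists (- (l / f t ^+ 2)); exact: has_der_inv.
have Ci := IH (CnW Cf); case: Cf => _ Cf'.
apply: Cn_ext (Cn_opp (Cn_mul Cf' (Cn_mul Ci Ci))) => t At.
symmetry; apply: derP => //; rewrite -invfM -expr2.
by apply: has_der_inv => //; exact: diff_onP.
Qed.

End Perfect.

(** Through this lemma the local bases of a smooth curve of subspaces yield a globally smooth
    projector. *)
Lemma Cn_local A f n : (forall t, A t -> exists J, [/\ open J, J t & Cn (A `&` J) n f]) ->
  perfect A -> Cn A n f.
Proof.
move=> H pA; elim: n f H => [|n IH] f H.
  split => // t At; have [J [oJ Jt [df _]]] := H t At.
  have [l fl] := df t (conj At Jt).
  by exists l; exact: (has_der_local A f l oJ Jt).1.
split.
  move=> t At; have [J [oJ Jt [df _]]] := H t At.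
  have [l fl] := df t (conj At Jt).
  by exists l; exact: (has_der_local A f l oJ Jt).1.
apply: IH => t At; have [J [oJ Jt [df Cf]]] := H t At.
exists J; split => //; apply: Cn_ext Cf => s [As Js].
symmetry; apply: derP => //; apply: (has_der_local A f _ oJ Js).1.
by apply: diff_onP => //; exact: perfect_setI.
Qed.

End SmoothScalar.

(** * The differential ring of smooth functions *)

Record perfect_dom (R : realType) := PerfectDom {
  pdom :> set R;
  pdom_nonempty : pdom !=set0;
  pdom_perfect : perfect pdom }.

(** Extension by 0 off the domain turns agreement on the domain into equality ([smooth_fun_eq]).
    Nonemptiness of the domain gives 1 != 0 in the ring, and perfectness makes the derivative an
    operation on it. *)
Record smooth_fun (R : realType) (A : perfect_dom R) := SmoothFun {
  smfun :> R -> R;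
  smooth_smfun : smooth_on (pdom A) smfun;
  smfun_out : forall t, ~ pdom A t -> smfun t = 0 }.

HB.instance Definition _ R A := gen_eqMixin (@smooth_fun R A).
HB.instance Definition _ R A := gen_choiceMixin (@smooth_fun R A).

Section SmoothRing.
Variables (R : realType) (P : perfect_dom R).
Local Notation A := (pdom P).
Local Notation C := (smooth_fun P).
Implicit Types f g h : C.

Lemma smooth_fun_eq f g : (forall t, A t -> f t = g t) -> f = g.
Proof.
case: f g => [f sf f0] [g sg g0] /= fg.
have e : f = g.
  by apply/funext => t; have [/fg//|nAt] := pselect (A t); rewrite f0 ?g0.
by move: sg g0 {fg}; rewrite -e => sg g0; congr SmoothFun; exact: Prop_irrelevance.
Qed.

Definition restr0 (f : R -> R) (t : R) : R := if `[< A t >] then f t else 0.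

Lemma restr0E (f : R -> R) t : A t -> restr0 f t = f t.
Proof. by rewrite /restr0; case: asboolP. Qed.

Lemma smooth_restr0 (f : R -> R) : smooth_on A f -> smooth_on A (restr0 f).
Proof. by move=> sf n; apply: (@Cn_ext _ _ _ f) => // t At; rewrite restr0E. Qed.

Lemma restr0_out (f : R -> R) t : ~ A t -> restr0 f t = 0.
Proof. by rewrite /restr0; case: asboolP. Qed.

Definition mk_smooth (f : R -> R) (sf : smooth_on A f) : C :=
  SmoothFun (smooth_restr0 sf) (@restr0_out f).

Lemma mk_smoothE (f : R -> R) (sf : smooth_on A f) t : A t -> mk_smooth sf t = f t.
Proof. exact: restr0E. Qed.

Let pA : perfect A := @pdom_perfect R P.

Definition sm_cst (c : R) : C := mk_smooth (fun n => Cn_cst pA n c).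
Definition sm_add f g : C :=
  mk_smooth (fun n => Cn_add pA (smooth_smfun f n) (smooth_smfun g n)).
Definition sm_opp f : C := mk_smooth (fun n => Cn_opp pA (smooth_smfun f n)).
Definition sm_mul f g : C :=
  mk_smooth (fun n => Cn_mul pA (smooth_smfun f n) (smooth_smfun g n)).

Definition sm_unit : {pred C} := fun f => `[< forall t, A t -> f t != 0 >].
Definition sm_inv f : C :=
  if pselect (forall t, A t -> f t != 0) is left f0 then
    mk_smooth (fun n => Cn_inv pA f0 (smooth_smfun f n)) else f.

Ltac pw := move=> *; apply: smooth_fun_eq => t At; rewrite !mk_smoothE//.

Fact sm_addA : associative sm_add. Proof. by pw; rewrite addrA. Qed.
Fact sm_addC : commutative sm_add. Proof. by pw; rewrite addrC. Qed.
Fact sm_add0 : left_id (sm_cst 0) sm_add. Proof. by pw; rewrite add0r. Qed.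
Fact sm_addN : left_inverse (sm_cst 0) sm_opp sm_add.
Proof. by pw; rewrite addNr. Qed.

HB.instance Definition _ := GRing.isZmodule.Build C sm_addA sm_addC sm_add0 sm_addN.

Fact sm_mulA : associative sm_mul. Proof. by pw; rewrite mulrA. Qed.
Fact sm_mulC : commutative sm_mul. Proof. by pw; rewrite mulrC. Qed.
Fact sm_mul1 : left_id (sm_cst 1) sm_mul. Proof. by pw; rewrite mul1r. Qed.
Fact sm_mulD : left_distributive sm_mul sm_add. Proof. by pw; rewrite mulrDl. Qed.
Fact sm_nz : sm_cst 1 != 0 :> C.
Proof.
apply/eqP => e; have [t At] := pdom_nonempty P.
have : sm_cst 1 t = sm_cst 0 t by rewrite e.
by rewrite !mk_smoothE// => /eqP; rewrite oner_eq0.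
Qed.

HB.instance Definition _ := GRing.Zmodule_isComNzRing.Build C
  sm_mulA sm_mulC sm_mul1 sm_mulD sm_nz.

Lemma smD f g t : A t -> (f + g) t = f t + g t. Proof. exact: mk_smoothE. Qed.
Lemma smN f t : A t -> (- f) t = - f t. Proof. exact: mk_smoothE. Qed.
Lemma smM f g t : A t -> (f * g) t = f t * g t. Proof. exact: mk_smoothE. Qed.
Lemma sm0 t : A t -> (0 : C) t = 0. Proof. exact: mk_smoothE. Qed.
Lemma sm1 t : A t -> (1 : C) t = 1. Proof. exact: mk_smoothE. Qed.
Lemma smc c t : A t -> sm_cst c t = c. Proof. exact: mk_smoothE. Qed.

Fact sm_mulV : {in sm_unit, left_inverse 1 sm_inv *%R}.
Proof.
move=> f /asboolP f0; apply: smooth_fun_eq => t At; rewrite smM// sm1//.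
by rewrite /sm_inv; case: pselect => // f0'; rewrite mk_smoothE// mulVf ?f0.
Qed.

Fact sm_unitP f g : g * f = 1 -> sm_unit f.
Proof.
move=> gf; apply/asboolP => t At; have : (g * f) t = (1 : C) t by rewrite gf.
rewrite smM// sm1// => e; apply/eqP => f0; move: e; rewrite f0 mulr0 => /eqP.
by rewrite eq_sym oner_eq0.
Qed.

Fact sm_inv_out : {in [predC sm_unit], sm_inv =1 id}.
Proof.
move=> f; rewrite inE /= /sm_inv => /negP nf; case: pselect => // f0.
by case: nf; apply/asboolP.
Qed.

HB.instance Definition _ := GRing.ComNzRing_hasMulInverse.Build C
  sm_mulV sm_unitP sm_inv_out.

Lemma sm_unitE f : (forall t, A t -> f t != 0) -> f \is a GRing.unit.
Proof. by move=> f0; apply/asboolP. Qed.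

Definition sm_der f : C :=
  SmoothFun (smooth_on_der (@smooth_smfun _ _ f)) (@der_out _ _ f).

Lemma sm_derP f t : A t -> has_der A f t (sm_der f t).
Proof. by move=> At; apply: diff_onP => //; exact: Cn_diff (smooth_smfun f 0). Qed.

Lemma sm_derE f t l : A t -> has_der A f t l -> sm_der f t = l.
Proof. by move=> At fl; exact: derP. Qed.

Fact sm_der_additive : zmod_morphism sm_der.
Proof.
move=> f g; apply: smooth_fun_eq => t At; rewrite smD// smN//.
apply: sm_derE => //; apply: (has_der_ext At (f := fun s => f s + - g s)).
  by move=> s As; rewrite smD// smN.
by apply: has_der_add; [|apply: has_der_opp]; exact: sm_derP.
Qed.
HB.instance Definition _ := GRing.isZmodMorphism.Build C C sm_der sm_der_additive.

Lemma sm_derM f g : sm_der (f * g) = sm_der f * g + f * sm_der g.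
Proof.
apply: smooth_fun_eq => t At; rewrite smD// !smM//.
apply: sm_derE => //; apply: (has_der_ext At (f := fun s => f s * g s)).
  by move=> s As; rewrite smM.
by apply: has_der_mul; exact: sm_derP.
Qed.

Lemma sm_der_cst c : sm_der (sm_cst c) = 0.
Proof.
apply: smooth_fun_eq => t At; rewrite sm0//; apply: sm_derE => //.
by apply: (has_der_ext At (f := fun=> c)); [move=> s As; rewrite smc|exact: has_der_cst].
Qed.

Fact sm_cst_additive : zmod_morphism sm_cst.
Proof. by move=> a b; apply: smooth_fun_eq => t At; rewrite smD// smN// !smc. Qed.
Fact sm_cst_monoid : monoid_morphism sm_cst.
Proof. by split=> [|a b] //; apply: smooth_fun_eq => t At; rewrite smM// !smc. Qed.
HB.instance Definition _ := GRing.isZmodMorphism.Build R C sm_cst sm_cst_additive.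
HB.instance Definition _ := GRing.isMonoidMorphism.Build R C sm_cst sm_cst_monoid.

(* Off A every element of the ring vanishes, so that the evaluation is made a
   ring morphism at every t by moving t into A. *)
Definition sm_pt (t : R) : R := if pselect (A t) is left _ then t else xget 0 A.

Lemma sm_ptP t : A (sm_pt t).
Proof. by rewrite /sm_pt; case: pselect => // _; apply: xgetPex; exact: pdom_nonempty. Qed.

Definition sm_ev (t : R) f : R := f (sm_pt t).

Lemma sm_evE t f : A t -> sm_ev t f = f t.
Proof. by rewrite /sm_ev /sm_pt; case: pselect. Qed.

Fact sm_ev_additive t : zmod_morphism (sm_ev t).
Proof. by move=> f g; rewrite /sm_ev; have := sm_ptP t => At; rewrite smD// smN. Qed.
Fact sm_ev_monoid t : monoid_morphism (sm_ev t).
Proof.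
by split=> [|f g]; rewrite /sm_ev; have := sm_ptP t => At; rewrite ?smM ?sm1.
Qed.
HB.instance Definition _ t :=
  GRing.isZmodMorphism.Build C R (sm_ev t) (sm_ev_additive t).
HB.instance Definition _ t :=
  GRing.isMonoidMorphism.Build C R (sm_ev t) (sm_ev_monoid t).

Lemma sm_ev_eq f g : (forall t, A t -> sm_ev t f = sm_ev t g) -> f = g.
Proof. by move=> fg; apply: smooth_fun_eq => t At; rewrite -!sm_evE// fg. Qed.

Lemma sm_ev_cst t c : sm_ev t (sm_cst c) = c.
Proof. by rewrite /sm_ev smc//; exact: sm_ptP. Qed.

Lemma sm_ev_unit f : (forall t, A t -> sm_ev t f != 0) -> f \is a GRing.unit.
Proof. by move=> f0; apply: sm_unitE => t At; rewrite -sm_evE// f0. Qed.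

End SmoothRing.

Arguments sm_ev : simpl never.
Arguments sm_der : simpl never.
Arguments sm_cst : simpl never.

(** * Linear differential equations *)

Section ContinuousOn.
Variable R : realType.
Implicit Types (A : set R) (f g F G : R -> R) (t s a b x y : R).

Definition cont_on A f : Prop := forall t, A t -> forall e, 0 < e ->
  exists2 d, 0 < d & forall s, A s -> `|s - t| < d -> `|f s - f t| < e.

Lemma diff_cont_on A f : diff_on A f -> cont_on A f.
Proof.
move=> df t At e e0; have [l fl] := df t At.
have /cvgrPdist_lt/(_ e e0)/within_dnbhsP[d d0 H] := has_der_cvg fl.
exists d => // s As sd; have [->|st] := eqVneq s t; first by rewrite subrr normr0.
by rewrite distrC; exact: H.
Qed.

Lemma cont_on_cst A c : cont_on A (fun=> c).
Proof. by move=> t At e e0; exists 1 => // s _ _; rewrite subrr normr0. Qed.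

Lemma cont_on_within A f t : cont_on A f -> A t -> f @ within A t^' --> f t.
Proof.
move=> cf At; apply/cvgrPdist_lt => e e0.
apply/within_dnbhsP; have [d d0 H] := cf t At e e0.
by exists d => // s sd _ As; rewrite distrC; exact: H.
Qed.

Lemma cont_onP A f : (forall t, A t -> f @ within A t^' --> f t) -> cont_on A f.
Proof.
move=> cf t At e e0.
have /cvgrPdist_lt/(_ e e0)/within_dnbhsP[d d0 H] := cf t At.
exists d => // s As sd; have [->|st] := eqVneq s t; first by rewrite subrr normr0.
by rewrite distrC; exact: H.
Qed.

Lemma cont_on_add A f g : cont_on A f -> cont_on A g -> cont_on A (fun s => f s + g s).
Proof. by move=> cf cg; apply: cont_onP => t At; apply: cvgD; exact: cont_on_within. Qed.

Lemma cont_on_mul A f g : cont_on A f -> cont_on A g -> cont_on A (fun s => f s * g s).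
Proof. by move=> cf cg; apply: cont_onP => t At; apply: cvgM; exact: cont_on_within. Qed.

Lemma cont_on_sum A n (f : 'I_n -> R -> R) :
  (forall i, cont_on A (f i)) -> cont_on A (fun s => \sum_i f i s).
Proof.
move=> cf; elim: n f cf => [|n IH] f cf.
  by under eq_fun do rewrite big_ord0; exact: cont_on_cst.
under eq_fun do rewrite big_ord_recl.
by apply: cont_on_add => //; apply: IH.
Qed.

(** Retraction of the line onto [a, b]. Composition with it makes a function that is continuous on
    an interval continuous everywhere, as needed for integration and for the extreme value
    theorem. *)
Definition clamp a b t := Num.max a (Num.min b t).

Lemma clamp_id a b t : a <= t <= b -> clamp a b t = t.
Proof. by move=> /andP[ta tb]; rewrite /clamp min_r// max_r. Qed.

Lemma clamp_itv a b t : a <= b -> a <= clamp a b t <= b.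
Proof. by move=> ab; rewrite /clamp le_max lexx /= ge_max ab ge_min lexx. Qed.

Lemma clamp_lip a b s t : `|clamp a b s - clamp a b t| <= `|s - t|.
Proof.
rewrite ler_norml /clamp.
by case: (ler0P (s - t)) => ?; case: (leP b s) => ?; case: (leP b t) => ?;
  do ?case: (leP a _) => ?; lra.
Qed.

Lemma clamp_cont A f a b : is_interval A -> A a -> A b -> a <= b -> cont_on A f ->
  continuous (f \o clamp a b).
Proof.
move=> iA Aa Ab ab cf t; apply/cvgrPdist_lt => e e0.
have [d d0 H] := cf (clamp a b t) (iA _ _ Aa Ab _ (clamp_itv t ab)) e e0.
apply/nbhs_ballP; exists d => // s; rewrite /ball/= distrC => st.
rewrite distrC; apply: H; first exact: (iA _ _ Aa Ab _ (clamp_itv s ab)).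
exact: le_lt_trans (clamp_lip _ _ _ _) st.
Qed.

Lemma cont_on_segment A f a b : is_interval A -> A a -> A b -> a <= b ->
  cont_on A f -> {within `[a, b], continuous f}.
Proof.
move=> iA Aa Ab ab cf.
apply: (@subspace_eq_continuous _ _ _ (f \o clamp a b)).
  by move=> t; rewrite inE/= in_itv/= => tab; rewrite /from_subspace/= clamp_id.
by apply: continuous_subspaceT; exact: clamp_cont cf.
Qed.

Lemma cont_on_bounded A f a b : is_interval A -> A a -> A b -> a <= b ->
  cont_on A f -> exists2 M, 0 <= M & forall t, a <= t <= b -> `|f t| <= M.
Proof.
move=> iA Aa Ab ab cf; have cs := cont_on_segment iA Aa Ab ab cf.
have [c _ Hc] := EVT_max ab cs; have [d _ Hd] := EVT_min ab cs.
exists (`|f c| + `|f d|); first exact: addr_ge0.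
move=> t tab; have t' : t \in `[a, b]%R by rewrite in_itv.
have /= := Hc _ t'; have /= := Hd _ t' => h1 h2.
have := ler_norm (f c); have := ler_norm (- f d); rewrite normrN => h3 h4.
have := normr_ge0 (f c); have := normr_ge0 (f d) => h5 h6.
rewrite ler_norml; lra.
Qed.

Lemma cont_on_bounded_fin A (T : finType) (f : T -> R -> R) a b :
  is_interval A -> A a -> A b -> a <= b -> (forall i, cont_on A (f i)) ->
  exists2 M, 0 <= M & forall i t, a <= t <= b -> `|f i t| <= M.
Proof.
move=> iA Aa Ab ab cf.
have /choice[M HM] : forall i, exists M, 0 <= M /\ forall t, a <= t <= b -> `|f i t| <= M.
  by move=> i; have [M M0 H] := cont_on_bounded iA Aa Ab ab (cf i); exists M.
exists (\sum_i M i); first by apply: sumr_ge0 => i _; have [] := HM i.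
move=> i t tab; apply: le_trans ((HM i).2 _ tab) _.
by rewrite (bigD1 i)//= lerDl; apply: sumr_ge0 => j _; have [] := HM j.
Qed.

End ContinuousOn.

Section Interval.
Variables (R : realType) (I : set R).
Hypothesis I_itv : is_interval I.
Implicit Types (f g F G : R -> R) (t s a b x y : R).

Lemma itv_inner x y z : I x -> I y -> x < z < y -> I° z.
Proof.
move=> Ix Iy /andP[xz zy]; apply/nbhs_ballP.
exists (Num.min (z - x) (y - z)); first by rewrite /= lt_min !subr_gt0 xz.
move=> s; rewrite -ball_normE /ball_/= lt_min => /andP[].
rewrite ltr_norml => /andP[h1 h2]; rewrite ltr_norml => /andP[h3 h4].
by apply: (I_itv Ix Iy); lra.
Qed.

(** Nonempty interior provides a point w != t of [I]; by convexity the points between t and w, and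
    among them some within e / 2 of t, also lie in [I]. *)
Lemma itv_perfect : I° !=set0 -> perfect I.
Proof.
move=> I_nd t It; apply: Build_ProperFilter => /within_dnbhsP[e e0 H].
have [z /nbhs_ballP[d d0 dI]] := I_nd.
have Iz' w : `|z - w| < d -> I w.
  by move=> zw; apply: dI; rewrite -ball_normE.
have [w Iw wt] : exists2 w, I w & w != t.
  have [zt|zt] := eqVneq z t; last by exists z => //; apply: Iz'; rewrite subrr normr0.
  exists (z + d / 2); last by rewrite -zt -subr_eq0 addrAC subrr add0r; move: d0 => /=; lra.
  by apply: Iz'; rewrite opprD addNKr normrN ger0_norm; move: d0 => /=; lra.
have [wlt|wgt|wt'] := ltgtP w t; last by rewrite wt' eqxx in wt.
- have h1 : t - e / 2 <= Num.max w (t - e / 2) by rewrite ?le_max ?ge_min lexx ?orbT.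
  have h2 : w <= Num.max w (t - e / 2) by rewrite ?le_max ?ge_min lexx ?orbT.
  have h3 : Num.max w (t - e / 2) < t by rewrite gt_max wlt; lra.
  apply: (H (Num.max w (t - e / 2))); last by apply: (I_itv Iw It); lra.
    by rewrite ltr_norml; lra.
  by rewrite lt_eqF.
- have h1 : Num.min w (t + e / 2) <= t + e / 2 by rewrite ?le_max ?ge_min lexx ?orbT.
  have h2 : Num.min w (t + e / 2) <= w by rewrite ?le_max ?ge_min lexx ?orbT.
  have h3 : t < Num.min w (t + e / 2) by rewrite lt_min wgt; lra.
  apply: (H (Num.min w (t + e / 2))); last by apply: (I_itv It Iw); lra.
    by rewrite ltr_norml; lra.
  by rewrite gt_eqF.
Qed.

Lemma mvt_homo h h' x y : I x -> I y -> x <= y ->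
  (forall t, I t -> has_der I h t (h' t)) ->
  (forall t, x <= t <= y -> 0 <= h' t) -> h x <= h y.
Proof.
move=> Ix Iy xy dh h0.
have [||c cxy e] := @MVT_segment R h h' x y xy.
- move=> t; rewrite in_itv/= => txy; apply: has_der_is_derive.
    exact: itv_inner txy.
  apply: dh; apply: (I_itv Ix Iy); case/andP: txy => *; lra.
- apply: (cont_on_segment I_itv Ix Iy xy); apply: diff_cont_on => t It.
  by exists (h' t); exact: dh.
rewrite -subr_ge0 e mulr_ge0 ?subr_ge0//; apply: h0.
by move: cxy; rewrite in_itv.
Qed.

(** Both [G + F] and [G - F] are nondecreasing. Used with [G] zero for constancy and with [G] an
    exponential in the Picard estimate. *)
Lemma mvt_compare F F' G G' x y : I x -> I y -> x <= y ->
  (forall t, I t -> has_der I F t (F' t)) -> (forall t, I t -> has_der I G t (G' t)) ->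
  (forall t, x <= t <= y -> `|F' t| <= G' t) -> `|F y - F x| <= G y - G x.
Proof.
move=> Ix Iy xy dF dG FG.
have h1 := @mvt_homo (fun t => G t + F t) (fun t => G' t + F' t) x y Ix Iy xy.
have h2 := @mvt_homo (fun t => G t + - F t) (fun t => G' t + - F' t) x y Ix Iy xy.
rewrite ler_norml; apply/andP; split.
  have : G x + F x <= G y + F y; last lra.
  apply: h1.
  - by move=> t It; apply: has_der_add; [exact: dG|exact: dF].
  - by move=> t /FG; rewrite ler_norml => /andP[]; lra.
have : G x + - F x <= G y + - F y; last lra.
apply: h2.
- by move=> t It; apply: has_der_add; [exact: dG|apply: has_der_opp; exact: dF].
- by move=> t /FG; rewrite ler_norml => /andP[]; lra.
Qed.

Lemma has_der0_cst F x y : I x -> I y -> (forall t, I t -> has_der I F t 0) -> F x = F y.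
Proof.
move=> Ix Iy dF; wlog xy : x y Ix Iy / x <= y.
  by move=> H; case: (leP x y) => [|/ltW] /H -> //.
have h0 (t : R) : x <= t <= y -> `|0 : R| <= (0 : R) by rewrite normr0.
have := @mvt_compare F (fun=> 0) (fun=> 0) (fun=> 0) x y Ix Iy xy dF
  (fun t _ => has_der_cst I t 0) h0.
by rewrite subrr normr_le0 subr_eq0 => /eqP.
Qed.

(** A compact segment of [I] through t and t0 that is a neighbourhood of t relative to [I]; when t
    is an end of [I] it is also an end of the segment. Estimates on compact segments then suffice
    for local statements at t, whatever the shape of [I]. *)
Lemma rel_nbhs t t0 : I t -> I t0 -> exists a b, [/\ I a, I b, a <= t <= b,
  a <= t0 <= b & exists2 e, 0 < e & forall s, I s -> `|s - t| < e -> a <= s <= b].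
Proof.
move=> It It0.
have [a [Ia at1 [e e0 He]]] : exists a, [/\ I a, a <= t &
    exists2 e, 0 < e & forall s, I s -> `|s - t| < e -> a <= s].
  have [[a Ia at1]|na] := pselect (exists2 a, I a & a < t).
    exists a; split => //; first exact: ltW.
    by exists (t - a); [rewrite subr_gt0|move=> s _; rewrite ltr_norml; lra].
  exists t; split => //; exists 1 => // s Is _; rewrite leNgt; apply/negP => st.
  by apply: na; exists s.
have [b [Ib bt1 [d d0 Hd]]] : exists b, [/\ I b, t <= b &
    exists2 e, 0 < e & forall s, I s -> `|s - t| < e -> s <= b].
  have [[b Ib bt1]|nb] := pselect (exists2 b, I b & t < b).
    exists b; split => //; first exact: ltW.
    by exists (b - t); [rewrite subr_gt0|move=> s _; rewrite ltr_norml; lra].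
  exists t; split => //; exists 1 => // s Is _; rewrite leNgt; apply/negP => st.
  by apply: nb; exists s.
exists (Num.min a t0), (Num.max b t0); split.
- by case: leP.
- by case: leP.
- by rewrite ge_min at1 le_max bt1.
- by rewrite ge_min lexx orbT le_max lexx orbT.
exists (Num.min e d); first by rewrite lt_min e0.
move=> s Is; rewrite lt_min => /andP[se sd].
by rewrite ge_min le_max (He _ Is se) (Hd _ Is sd).
Qed.

End Interval.

(** * Antiderivatives on an interval *)

Section Antiderivative.
Variables (R : realType) (I : set R).
Hypothesis I_itv : is_interval I.
Implicit Types (f g F G : R -> R) (t s a b x y : R).

Lemma has_der_sub (A B : set R) f t l : A `<=` B -> has_der B f t l -> has_der A f t l.
Proof.
move=> AB H C /H /within_dnbhsP[d d0 HC]; apply/within_dnbhsP; exists d => //.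
by move=> s sd st /AB; exact: HC.
Qed.

Lemma has_der_near A F G t l e : 0 < e -> A t ->
  (forall s, A s -> `|s - t| < e -> F s = G s) -> has_der A F t l -> has_der A G t l.
Proof.
move=> e0 At FG H B /H /within_dnbhsP[d d0 HB].
apply/within_dnbhsP; exists (Num.min d e); first by rewrite lt_min d0.
move=> s; rewrite lt_min => /andP[sd se] st As.
rewrite /quot/= -FG// -FG//; first exact: HB.
by rewrite subrr normr0.
Qed.

Lemma is_derive_has_der A f t l : is_derive t 1 f l -> has_der A f t l.
Proof.
move=> [df fl] B; rewrite -fl => /df.
rewrite /= nbhs_simpl /dnbhs /within/= => /nbhs_ballP[d d0 H].
apply/within_dnbhsP; exists d => // s sd st As.
have := H (s - t); rewrite -ball_normE /ball_/= sub0r normrN sd subr_eq0 st.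
rewrite /quot /GRing.scale/= mulr1 subrK; exact.
Qed.

Lemma antiderivative_segment f a b : I a -> I b -> a <= b -> cont_on I f ->
  exists G, forall s, a <= s <= b -> has_der setT G s (f s).
Proof.
move=> Ia Ib ab cf; pose g := f \o clamp a b.
have cg : continuous g := clamp_cont I_itv Ia Ib ab cf.
(* Starting the integral at a - 1 makes a itself an interior point, so the derivative is two-sided
   on all of [a, b]. *)
exists (fun x => (\int[lebesgue_measure]_(t in `[a - 1, x]) g t)%R) => s sab.
have [] := @continuous_FTC1_closed R g (a - 1) s (s + 1) _ _ _ (cg s).
- by rewrite ltrDl.
- apply: continuous_compact_integrable; first exact: segment_compact.
  exact: continuous_subspaceT.
- by case/andP: sab => *; lra.
move=> /derivableP dG eG; apply: is_derive_has_der.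
by move: dG; rewrite -derive1E eG /g/= clamp_id.
Qed.

(** An antiderivative is chosen for each segment from t0 to t, and only its increment is kept.
    Increments agree on overlapping segments because two antiderivatives differ by a constant, so
    they glue to one function on [I]. *)
Lemma antiderivative f t0 : I t0 -> cont_on I f ->
  exists2 F, F t0 = 0 & forall t, I t -> has_der I F t (f t).
Proof.
move=> It0 cf.
have /choice[G HG] (t : R) : exists G, I t ->
    forall s, Num.min t0 t <= s <= Num.max t0 t -> has_der setT G s (f s).
  have [It|nIt] := pselect (I t); last by exists f.
  have [] := @antiderivative_segment f (Num.min t0 t) (Num.max t0 t) _ _ _ cf.
  - by case: leP.
  - by case: leP.
  - by rewrite ge_min !le_max lexx.
  by move=> G H; exists G.
exists (fun t => G t t - G t t0); first by rewrite subrr.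
move=> t It; have [a [b [Ia Ib tab t0ab [e e0 He]]]] := rel_nbhs It It0.
have [F HF] := antiderivative_segment Ia Ib (le_trans (andP tab).1 (andP tab).2) cf.
have key s : I s -> a <= s <= b -> F s - F t0 = G s s - G s t0.
  move=> Is sab; pose J := `[Num.min t0 s, Num.max t0 s]%classic : set R.
  have JE x : J x <-> Num.min t0 s <= x <= Num.max t0 s by rewrite /J /= in_itv.
  have iJ : is_interval J.
    by move=> x y /JE ? /JE ? z ?; apply/JE; lra.
  have /= := @has_der0_cst _ J iJ (fun x => F x + - G s x) s t0 _ _ _.
  move=> e1; have : F s - G s s = F t0 - G s t0; last lra.
  apply: e1.
  - by apply/JE; rewrite ge_min le_max lexx !orbT.
  - by apply/JE; rewrite ge_min le_max lexx.
  move=> x /JE xJ; rewrite -(subrr (f x)); apply: has_der_add.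
    apply: (has_der_sub (@subsetT _ _)); apply: HF.
    by move: xJ sab t0ab; case: (leP t0 s) => *; lra.
  by apply: has_der_opp; apply: (has_der_sub (@subsetT _ _)); exact: HG.
apply: (has_der_near e0 It (F := fun s => F s + - F t0)).
  by move=> s Is st; apply: key => //; exact: He.
rewrite -[f t]addr0 -[X in _ + X]oppr0; apply: has_der_add.
  by apply: (has_der_sub (@subsetT _ _)); exact: HF.
by apply: has_der_opp; exact: has_der_cst.
Qed.

End Antiderivative.

Section GeometricLimit.
Variable R : realType.
Local Notation q k := (2^-1 ^+ k : R).

Lemma half_exp_ge0 k : 0 <= q k. Proof. by rewrite exprn_ge0. Qed.

(** The tail of the geometric series from k on is 2 B / 2^k, so the intervals of this radius around
    [x k] are nested; the limit is the supremum of their lower ends. *)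
Lemma geometric_limit (x : nat -> R) (B : R) :
  (forall k, `|x k.+1 - x k| <= B * q k) ->
  exists l, forall k, `|l - x k| <= 2 * B * q k.
Proof.
move=> H.
have lo k : x k - 2 * B * q k <= x k.+1 - 2 * B * q k.+1.
  have := H k; rewrite ler_norml exprS => /andP[]; set c := q k => *; lra.
have hi k : x k.+1 + 2 * B * q k.+1 <= x k + 2 * B * q k.
  have := H k; rewrite ler_norml exprS => /andP[]; set c := q k => *; lra.
have B0 k : 0 <= B * q k by apply: le_trans (H k).
have lo2 k m : x k - 2 * B * q k <= x (k + m)%N - 2 * B * q (k + m)%N.
  by elim: m => [|m IH]; rewrite ?addn0// addnS; apply: le_trans IH (lo _).
have hi2 k m : x (k + m)%N + 2 * B * q (k + m)%N <= x k + 2 * B * q k.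
  by elim: m => [|m IH]; rewrite ?addn0// addnS; apply: le_trans (hi _) IH.
have lohi k m : x k - 2 * B * q k <= x m + 2 * B * q m.
  have := lo2 k m; have := hi2 m k; rewrite (addnC m k).
  by have := B0 (k + m)%N; set c := q (k + m)%N; lra.
pose S := [set x k - 2 * B * q k | k in [set: nat]].
have S0 : S !=set0 by exists (x 0 - 2 * B * q 0), 0%N.
have ubS m : ubound S (x m + 2 * B * q m) by move=> _ [k _ <-].
exists (sup S) => k.
have h1 : x k - 2 * B * q k <= sup S.
  by apply: ub_le_sup; [exists (x 0 + 2 * B * q 0); exact: ubS|exists k].
have h2 : sup S <= x k + 2 * B * q k by apply: ge_sup.
by rewrite ler_norml; lra.
Qed.

Lemma half_exp_small (B e : R) : 0 < e -> exists k, B * q k < e.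
Proof.
move=> e0; have [B0|B0] := leP B 0.
  by exists 0%N; rewrite expr0 mulr1; exact: le_lt_trans e0.
have /cvgrPdist_lt/(_ (e / B)) : (fun k => q k) @ \oo --> (0 : R).
  by apply: cvg_expr; rewrite ger0_norm//; lra.
rewrite divr_gt0// => /(_ isT)[k _ /(_ k (leqnn k))/=].
rewrite sub0r normrN ger0_norm ?half_exp_ge0// ltr_pdivlMr// => h.
by exists k; rewrite mulrC.
Qed.

Lemma half_exp_unique (x : nat -> R) (B C l m : R) :
  (forall k, `|l - x k| <= B * q k) -> (forall k, `|m - x k| <= C * q k) -> l = m.
Proof.
move=> Hl Hm; apply/eqP; rewrite -subr_eq0 -normr_le0 leNgt; apply/negP => e0.
have [k] := half_exp_small (B + C) e0.
have := Hl k; have := Hm k; have := ler_normB (l - x k) (m - x k).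
by rewrite opprB addrA subrK; set c := q k; rewrite mulrDl; lra.
Qed.

End GeometricLimit.

(** * Picard iteration for linear systems *)

Section LinearODE.
Variables (R : realType) (I : set R).
Hypothesis I_itv : is_interval I.
Variables (n : nat) (A : 'I_n -> 'I_n -> R -> R).
Hypothesis cA : forall i j, cont_on I (A i j).
Local Notation q k := (2^-1 ^+ k : R).

Let rhs (u : 'I_n -> R -> R) (i : 'I_n) (t : R) : R := \sum_j A i j t * u j t.

Let rhs_cont u i : (forall j, cont_on I (u j)) -> cont_on I (rhs u i).
Proof. by move=> cu; apply: cont_on_sum => j; exact: cont_on_mul. Qed.

Lemma has_der_expl (B : set R) (c a t0 t : R) :
  has_der B (fun s => c * expR (a * (s - t0))) t (c * a * expR (a * (t - t0))).
Proof.
apply: is_derive_has_der.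
have h : is_derive t (1 : R) (fun s : R => a * (s - t0)) a.
  have -> : (fun s : R => a * (s - t0)) = (fun s => a *: s + cst (- (a * t0)) s).
    by apply/funext => s; rewrite mulrBr.
  by apply: is_derive_eq; rewrite subr0 /GRing.scale/= mulr1.
have h2 : is_derive t (1 : R) (fun s : R => expR (a * (s - t0))) (a * expR (a * (t - t0))).
  have := @is_derive1_comp R expR (fun s => a * (s - t0)) t _ _ (is_derive_expR _) h.
  by rewrite mulrC.
have := @is_deriveZ R R R _ c t 1 _ h2.
by rewrite /GRing.scale/= mulrA.
Qed.

Section Picard.
Variables (t0 : R) (It0 : I t0) (u0 : 'I_n -> R) (J : (R -> R) -> R -> R).
Hypothesis J0 : forall f, cont_on I f -> J f t0 = 0.
Hypothesis JD : forall f, cont_on I f -> forall t, I t -> has_der I (J f) t (f t).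

Fixpoint picard (k : nat) : 'I_n -> R -> R :=
  if k is k'.+1 then fun i t => u0 i + J (rhs (picard k') i) t else fun i _ => u0 i.

Let u := picard.

Let cu k i : cont_on I (u k i).
Proof.
elim: k i => [|k IH] i /=; first exact: cont_on_cst.
apply: cont_on_add; first exact: cont_on_cst.
apply: diff_cont_on => t It; eexists; apply: JD => //; exact: rhs_cont.
Qed.

Let du k i t : I t -> has_der I (u k.+1 i) t (rhs (u k) i t).
Proof.
move=> It; rewrite -[rhs _ _ _]add0r; apply: has_der_add; first exact: has_der_cst.
by apply: JD => //; exact: rhs_cont.
Qed.

Let uk0 k i : u k i t0 = u0 i.
Proof. by case: k => //= k; rewrite J0 ?addr0//; exact: rhs_cont. Qed.

Section Bounds.
Variables (a b K : R).
Hypotheses (Ia : I a) (Ib : I b) (at0 : a <= t0 <= b) (K0 : 0 <= K).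
Hypothesis AK : forall t, a <= t <= b -> forall (v : 'I_n -> R -> R) (c : R),
  (forall j, `|v j t| <= c) -> 0 <= c -> forall i, `|rhs v i t| <= K * c.

Let lam := 2 * K + 1.

(* The weight exp(lam |t - t0|) makes the Picard operator a contraction on the
   whole of [a, b], whatever its length. *)
Let wt (t : R) := expR (lam * `|t - t0|).

(** The factor 1/2 comes from [lam] being at least 2 K: then K c wt is at most (c / 2) lam wt, which
    up to sign is the derivative of (c / 2) wt on either side of t0, and [mvt_compare] applies on
    each side. *)
Lemma weighted_bound (F : R -> R) (F' : R -> R) (c : R) : 0 <= c -> F t0 = 0 ->
  (forall t, I t -> has_der I F t (F' t)) ->
  (forall t, a <= t <= b -> `|F' t| <= K * (c * wt t)) ->
  forall t, a <= t <= b -> `|F t| <= c / 2 * wt t.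
Proof.
move=> c0 F0 dF FK t tab.
have It : I t := I_itv Ia Ib tab.
have [tt0|tt0] := leP t0 t.
  have := @mvt_compare _ I I_itv F F' (fun s => c / 2 * expR (lam * (s - t0)))
    (fun s => c / 2 * lam * expR (lam * (s - t0))) t0 t It0 It tt0 dF
    (fun s _ => @has_der_expl I (c / 2) lam t0 s).
  rewrite F0 subr0 subrr mulr0 expR0 => H.
  rewrite /wt (@ger0_norm _ (t - t0)) ?subr_ge0//; apply: le_trans (H _) _; last by lra.
  move=> s st; have sab : a <= s <= b by move: at0; lra.
  have := FK s sab; rewrite /wt (@ger0_norm _ (s - t0)) ?subr_ge0; last by lra.
  have := expR_gt0 (lam * (s - t0)); set E := expR _ => E0.
  by move=> /le_trans; apply; have := mulr_ge0 c0 (ltW E0); rewrite /lam; nra.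
have := @mvt_compare _ I I_itv F F' (fun s => - (c / 2) * expR (- lam * (s - t0)))
    (fun s => - (c / 2) * - lam * expR (- lam * (s - t0))) t t0 It It0 (ltW tt0) dF
    (fun s _ => @has_der_expl I (- (c / 2)) (- lam) t0 s).
rewrite F0 sub0r subrr mulr0 expR0 normrN => H.
have e s : s <= t0 -> wt s = expR (- lam * (s - t0)).
  by move=> st; rewrite /wt ler0_norm ?subr_le0// mulrN mulNr.
rewrite e ?(ltW tt0)//; apply: le_trans (H _) _; last by lra.
move=> s st; have sab : a <= s <= b by move: at0; lra.
have := FK s sab; rewrite e; last by lra.
have := expR_gt0 (- lam * (s - t0)); set E := expR _ => E0.
by move=> /le_trans; apply; have := mulr_ge0 c0 (ltW E0); rewrite /lam; nra.
Qed.

Lemma picard_step : exists2 B, 0 <= B &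
  forall k i t, a <= t <= b -> `|u k.+1 i t - u k i t| <= B * q k.
Proof.
have ab : a <= b by move: at0; lra.
have [C C0 HC] := @cont_on_bounded_fin R I _ (fun i t => u 1 i t + -1 * u 0 i t) a b
  I_itv Ia Ib ab (fun i => cont_on_add (@cu 1 i) (cont_on_mul (cont_on_cst (-1)) (@cu 0 i))).
have l0 : 0 <= lam by rewrite /lam; move: K0; lra.
have wt1 t : 1 <= wt t by rewrite -expR0 ler_expR mulr_ge0.
have step k i t : a <= t <= b -> `|u k.+1 i t - u k i t| <= C * q k * wt t.
  elim: k i t => [|k IH] i t tab.
    rewrite expr0 mulr1; apply: le_trans (_ : _ <= C) _.
      by have := HC i t tab; rewrite mulN1r.
    by rewrite ler_peMr.
  have -> : C * q k.+1 = C * q k / 2 by rewrite exprSr mulrA.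
  apply: (@weighted_bound (fun t => u k.+2 i t + - u k.+1 i t)
     (fun t => rhs (u k.+1) i t + - rhs (u k) i t)) => //.
  - by rewrite mulr_ge0// half_exp_ge0.
  - by rewrite !uk0 subrr.
  - by move=> s Is; apply: has_der_add; [exact: du|apply: has_der_opp; exact: du].
  move=> s sab.
  have -> : rhs (u k.+1) i s + - rhs (u k) i s = rhs (fun j t => u k.+1 j t - u k j t) i s.
    by rewrite /rhs -sumrB; apply: eq_bigr => j _; rewrite mulrBr.
  apply: AK => //; first by move=> j; exact: IH.
  by rewrite mulr_ge0 ?expR_ge0// mulr_ge0// half_exp_ge0.
exists (C * expR (lam * (b - a))); first by rewrite mulr_ge0 ?expR_ge0.
move=> k i t tab; apply: le_trans (step k i t tab) _.
rewrite mulrAC ler_wpM2r ?half_exp_ge0// ler_wpM2l// ler_expR ler_wpM2l//.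
by rewrite ler_norml; move: at0; lra.
Qed.

End Bounds.

Let kbound a b : I a -> I b -> a <= b -> exists2 K, 0 <= K &
  forall t, a <= t <= b -> forall (v : 'I_n -> R -> R) (c : R),
  (forall j, `|v j t| <= c) -> 0 <= c -> forall i, `|rhs v i t| <= K * c.
Proof.
move=> Ia Ib ab.
have [M M0 HM] := @cont_on_bounded_fin R I ('I_n * 'I_n)%type (fun ij => A ij.1 ij.2) a b
  I_itv Ia Ib ab (fun ij => cA ij.1 ij.2).
exists (n%:R * M); first by rewrite mulr_ge0.
move=> t tab v c vc c0 i; apply: le_trans (ler_norm_sum _ _ _) _.
apply: le_trans (_ : _ <= \sum_(j < n) M * c) _.
  by apply: ler_sum => j _; rewrite normrM ler_pM//; exact: (HM (i, j)).
by rewrite sumr_const card_ord -mulrA mulr_natl.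
Qed.

Lemma picard_limit : exists w : 'I_n -> R -> R,
  (forall i, w i t0 = u0 i) /\ forall t i, I t -> has_der I (w i) t (rhs w i t).
Proof.
have /choice[w0 Hw0] (p : 'I_n * R) : exists l, I p.2 ->
    exists B, forall k, `|l - u k p.1 p.2| <= B * q k.
  case: p => i t /=; have [It|] := pselect (I t); last by exists 0.
  have [a [b [Ia Ib tab t0ab _]]] := rel_nbhs It It0.
  have [K K0 HK] := kbound Ia Ib (le_trans (andP tab).1 (andP tab).2).
  have [B B0 HB] := picard_step Ia Ib t0ab K0 HK.
  have [l Hl] := geometric_limit (fun k => HB k i t tab).
  by exists l => _; exists (2 * B).
pose w i t := w0 (i, t).
(* The limit was chosen with a bound depending on the point; by uniqueness of the limit it also
   satisfies the bound that is uniform on a segment. *)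
have unif a b : I a -> I b -> a <= t0 <= b -> exists2 B, 0 <= B &
    forall k i t, a <= t <= b -> `|w i t - u k i t| <= B * q k.
  move=> Ia Ib t0ab.
  have [K K0 HK] := kbound Ia Ib (le_trans (andP t0ab).1 (andP t0ab).2).
  have [B B0 HB] := picard_step Ia Ib t0ab K0 HK.
  exists (2 * B); first by rewrite mulr_ge0.
  move=> k i t tab; have [l Hl] := geometric_limit (fun k => HB k i t tab).
  have [C HC] := Hw0 (i, t) (I_itv Ia Ib tab).
  by rewrite /w (half_exp_unique HC Hl); exact: Hl.
have cw i : cont_on I (w i).
  move=> t It e e0.
  have [a [b [Ia Ib tab t0ab [d d0 Hd]]]] := rel_nbhs It It0.
  have [B B0 HB] := unif a b Ia Ib t0ab.
  have e3 : 0 < e / 3 by lra.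
  have [k Hk] := half_exp_small B e3.
  have [d' d'0 Hd'] := @cu k i t It _ e3.
  exists (Num.min d d'); first by rewrite lt_min d0.
  move=> s Is; rewrite lt_min => /andP[sd sd'].
  have := HB k i t tab; have := HB k i s (Hd s Is sd); have := Hd' s Is sd'.
  rewrite ltr_norml !ler_norml ltr_norml; lra.
pose v i t := u0 i + J (rhs w i) t.
have dv i t : I t -> has_der I (v i) t (rhs w i t).
  move=> It; rewrite -[rhs _ _ _]add0r; apply: has_der_add; first exact: has_der_cst.
  by apply: JD => //; exact: rhs_cont.
(* [w] is a fixed point of the Picard operator: both [w] and its image [v] are within a multiple of
   2^-k of [u k.+1], the latter by the contraction estimate. *)
have wv i t : I t -> v i t = w i t.
  move=> It.
  have [a [b [Ia Ib tab t0ab _]]] := rel_nbhs It It0.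
  have [B B0 HB] := unif a b Ia Ib t0ab.
  have [K K0 HK] := kbound Ia Ib (le_trans (andP tab).1 (andP tab).2).
  pose lam := 2 * K + 1.
  have l0 : 0 <= lam by rewrite /lam; lra.
  have wt1 s : 1 <= expR (lam * `|s - t0|) by rewrite -expR0 ler_expR mulr_ge0.
  apply: (@half_exp_unique _ (fun k => u k.+1 i t) (B / 2 * expR (lam * `|t - t0|)) B); last first.
    move=> k; apply: le_trans (HB k.+1 i t tab) _.
    rewrite ler_wpM2l// exprS; have := half_exp_ge0 R k; set c := q k; lra.
  move=> k; rewrite mulrAC.
  have -> : B / 2 * q k = B * q k / 2 by ring.
  apply: (@weighted_bound a b K Ia Ib t0ab (fun t => v i t + - u k.+1 i t)
     (fun t => rhs w i t + - rhs (u k) i t)) => //.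
  - by rewrite mulr_ge0// half_exp_ge0.
  - by rewrite uk0 /v J0 ?addr0 ?subrr//; exact: rhs_cont.
  - by move=> s Is; apply: has_der_add; [exact: dv|apply: has_der_opp; exact: du].
  move=> s sab.
  have -> : rhs w i s + - rhs (u k) i s = rhs (fun j t => w j t - u k j t) i s.
    by rewrite /rhs -sumrB; apply: eq_bigr => j _; rewrite mulrBr.
  apply: HK => //.
    move=> j; apply: le_trans (HB k j s sab) _.
    by rewrite ler_peMr// mulr_ge0// half_exp_ge0.
  by rewrite mulr_ge0 ?expR_ge0// mulr_ge0// half_exp_ge0.
exists w; split=> [i|t i It]; first by rewrite -wv// /v J0 ?addr0//; exact: rhs_cont.
by apply: has_der_ext (dv i t It) => // s Is; exact: wv.
Qed.

End Picard.

Theorem linear_ode (t0 : R) (u0 : 'I_n -> R) : I t0 -> exists w : 'I_n -> R -> R,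
  (forall i, w i t0 = u0 i) /\
  forall t i, I t -> has_der I (w i) t (\sum_j A i j t * w j t).
Proof.
move=> It0.
have /choice[J HJ] (f : R -> R) : exists F : R -> R, cont_on I f ->
    F t0 = 0 /\ forall t, I t -> has_der I F t (f t).
  have [cf|] := pselect (cont_on I f); last by exists f.
  by have [F F0 dF] := antiderivative I_itv It0 cf; exists F.
apply: (@picard_limit t0 It0 u0 J) => f cf; first by have [] := HJ f cf.
by have [] := HJ f cf.
Qed.

End LinearODE.

(** * Smooth families of subspaces *)

(** The derivative of V Q U when U' = K U, V' = - V K and K Q = Q' + Q K, as in Kato's transport. *)
Lemma conj_commutator (A : pzRingType) n (V U Q Q' K : 'M[A]_n) :
  - (V *m (Q' + Q *m K) *m U) + V *m Q' *m U + V *m Q *m (K *m U) = 0.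
Proof. by rewrite mulmxDr mulmxDl !mulmxA opprD -addrA addrACA !addNr addr0. Qed.

Section RealMatrix.
Variable R : realType.

Lemma mulmx_tr_eq0 m n (A : 'M[R]_(m, n)) : A *m A^T = 0 -> A = 0.
Proof.
move=> A0; apply/matrixP => i j; rewrite mxE.
have := congr1 (fun B : 'M[R]_m => B i i) A0; rewrite !mxE => /eqP.
rewrite psumr_eq0 => [/allP/(_ j)|k _]; last by rewrite mxE -expr2 sqr_ge0.
by rewrite mem_index_enum => /(_ isT); rewrite mxE -expr2 sqrf_eq0 => /eqP.
Qed.

Lemma gram_unit m n (A : 'M[R]_(m, n)) : row_free A -> A *m A^T \in unitmx.
Proof.
move=> fA; rewrite -row_free_unit -kermx_eq0; apply/eqP.
set K := kermx _; have : K *m (A *m A^T) = 0 by exact: mulmx_ker.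
move=> K0; have : (K *m A) *m (K *m A)^T = 0.
  by rewrite trmx_mul mulmxA -(mulmxA K) K0 mul0mx.
by move/mulmx_tr_eq0 => KA; apply: (row_free_inj fA); rewrite KA mul0mx.
Qed.

(** The selection of rows is a finite function, so that sums over all selections can be formed. *)
Lemma exists_rowsub_free m n (A : 'M[R]_(m, n)) q : \rank A = q ->
  exists f : {ffun 'I_q -> 'I_m}, row_free (rowsub f A).
Proof.
move=> <-; exists [ffun i => maxrankfun A i].
rewrite (_ : rowsub _ A = rowsub (maxrankfun A) A) ?maxrowsub_free//.
by apply/matrixP => i j; rewrite !mxE ffunE.
Qed.

Lemma exists_kernel m n (A : 'M[R]_(m, n)) r : r = (m - \rank A)%N ->
  exists K : 'M[R]_(r, m), row_free K /\ K *m A = 0.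
Proof.
move=> ->; rewrite -mxrank_ker; exists (row_base (kermx A)).
split; first exact: row_base_free.
by apply/sub_kermxP; rewrite eq_row_base.
Qed.

(** Equal row spaces give P Q = P and Q P = Q; transposing the second gives P Q = Q. This uniqueness
    is what makes local projectors agree on overlaps. *)
Lemma sym_idem_unique n (P Q : 'M[R]_n) : P^T = P -> Q^T = Q ->
  P *m P = P -> Q *m Q = Q -> (P :=: Q)%MS -> P = Q.
Proof.
move=> Pt Qt PP QQ PQ.
have e1 : P *m Q = P.
  have /submxP[C PE] : (P <= Q)%MS by rewrite PQ.
  by rewrite {1}PE -mulmxA QQ -PE.
have e2 : Q *m P = Q.
  have /submxP[C QE] : (Q <= P)%MS by rewrite PQ.
  by rewrite {1}QE -mulmxA PP -QE.
by have := congr1 trmx e2; rewrite trmx_mul Pt Qt e1.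
Qed.

End RealMatrix.

Lemma Cn_sum (R : realType) (A : set R) k n (f : 'I_n -> R -> R) : perfect A ->
  (forall i, Cn A k (f i)) -> Cn A k (fun s => \sum_i f i s).
Proof.
move=> pA; elim: n f => [|n IH] f cf.
  by under eq_fun do rewrite big_ord0; exact: Cn_cst.
by under eq_fun do rewrite big_ord_recl; apply: Cn_add => //; apply: IH.
Qed.

(** * Matrices of smooth functions and constant rank *)

Section SmoothMatrix.
Variables (R : realType) (P : perfect_dom R).
Local Notation A := (pdom P).
Local Notation C := (smooth_fun P).
Local Notation D := (@sm_der R P).
Local Notation "M ^@ t" := (map_mx (@sm_ev R P t) M) (at level 8).
Local Notation cst := (map_mx (@sm_cst R P)).

Lemma ev_mx_eq m n (M N : 'M[C]_(m, n)) : (forall t, A t -> M^@t = N^@t) -> M = N.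
Proof.
move=> MN; apply/matrixP => i j; apply: sm_ev_eq => t At.
by have := congr1 (fun B : 'M[R]_(m, n) => B i j) (MN t At); rewrite !mxE.
Qed.

Lemma ev_cst_mx m n (M : 'M[R]_(m, n)) t : (cst M)^@t = M.
Proof. by apply/matrixP => i j; rewrite !mxE sm_ev_cst. Qed.

Lemma der_mulmx m n p (M : 'M[C]_(m, n)) (N : 'M[C]_(n, p)) :
  map_mx D (M *m N) = map_mx D M *m N + M *m map_mx D N.
Proof.
apply/matrixP => i j; rewrite !mxE raddf_sum -big_split; apply: eq_bigr => k _ /=.
by rewrite !mxE sm_derM.
Qed.

Lemma der_cst_mx m n (M : 'M[R]_(m, n)) : map_mx D (cst M) = 0.
Proof. by apply/matrixP => i j; rewrite !mxE sm_der_cst. Qed.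

Lemma der_trmx m n (M : 'M[C]_(m, n)) : map_mx D M^T = (map_mx D M)^T.
Proof. by apply/matrixP => i j; rewrite !mxE. Qed.

Section ConstantRank.
Variables (m n q : nat) (M : 'M[C]_(m, n)).
Hypothesis rM : forall t, A t -> \rank (M^@t) = q.

Let N (f : {ffun 'I_q -> 'I_m}) := rowsub f M.
Let G f := N f *m (N f)^T.
Let d f := \det (G f).
Let den := \sum_f d f ^+ 2.
Let num := \sum_f d f *: ((N f)^T *m \adj (G f) *m N f).

(** At each t some q rows are independent, so one of the squared Gram determinants is positive. *)
Let den_unit : den \is a GRing.unit.
Proof.
apply: sm_ev_unit => t At; rewrite /den rmorph_sum/=.
have [f ff] := exists_rowsub_free (rM At).
rewrite psumr_neq0; last by move=> g _; rewrite rmorphXn/= sqr_ge0.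
apply/hasP; exists f; rewrite ?mem_index_enum//= rmorphXn/= exprn_even_gt0//=.
have := gram_unit ff; rewrite unitmxE unitfE.
by rewrite /d -det_map_mx /G map_mxM -map_trmx /N map_mxsub.
Qed.

(** Term by term and pointwise: where [d f] vanishes both sides do; elsewhere the rows selected by f
    span the row space of [M], on which N^T adj(G) N acts as the scalar det G. *)
Let M_num : M *m num = den *: M.
Proof.
rewrite /num mulmx_sumr /den scaler_suml; apply: eq_bigr => f _.
apply: ev_mx_eq => t At; rewrite -scalemxAr expr2 -scalerA !map_mxZ/=.
have [-> |dft] := eqVneq (sm_ev t (d f)) 0; first by rewrite !scale0r.
congr (_ *: _); rewrite !map_mxM/= -map_trmx map_mx_adj.
have NE : (N f)^@t = rowsub f (M^@t) by rewrite /N map_mxsub.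
have Gt : (G f)^@t = (N f)^@t *m ((N f)^@t)^T by rewrite /G map_mxM -map_trmx.
have Gu : (G f)^@t \in unitmx.
  by rewrite unitmxE unitfE -/(d f) det_map_mx.
have fN : row_free ((N f)^@t).
  rewrite -kermx_eq0; apply/eqP; apply: (can_inj (mulmxK Gu)).
  by rewrite mul0mx Gt mulmxA mulmx_ker mul0mx.
have NM : ((N f)^@t <= M^@t)%MS by rewrite NE rowsub_sub.
have MN : (M^@t <= (N f)^@t)%MS.
  have := mxrank_leqif_sup NM => /geq_leqif <-.
  by rewrite (rM At); move/eqP: fN => ->.
have [B MB] := submxP MN.
rewrite {1}MB !mulmxA -(mulmxA B) -Gt -(mulmxA B) mul_mx_adj mul_mx_scalar -scalemxAl -MB.
by rewrite det_map_mx.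
Qed.

(* Every Gram matrix of q rows of M gives det * (the orthogonal projector onto
   the row space), or det = 0; averaging with weights det gives a formula for
   the projector which is smooth without any local choice of rows. *)
Lemma constant_rank_projector : exists Q : 'M[C]_n,
  [/\ Q^T = Q, Q *m Q = Q, M *m Q = M & exists B, Q = B *m M].
Proof.
pose Q := den^-1 *: num.
have MQ : M *m Q = M by rewrite /Q -scalemxAr M_num scalerA mulVr ?scale1r.
have [B QB] : exists B, Q = B *m M.
  exists (den^-1 *: \sum_f d f *: ((N f)^T *m \adj (G f) *m rowsub f 1%:M)).
  rewrite -scalemxAl mulmx_suml; congr (_ *: _); apply: eq_bigr => f _.
  by rewrite -scalemxAl -(mulmxA _ (rowsub f 1%:M)) mul_rowsub_mx mul1mx.
exists Q; split => //; last by exists B.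
  rewrite /Q linearZ/= linear_sum/=; congr (_ *: _); apply: eq_bigr => f _.
  have Gs : (G f)^T = G f by rewrite /G trmx_mul trmxK.
  by rewrite linearZ/= 2!trmx_mul trmxK trmx_adj Gs mulmxA.
by rewrite {1}QB -mulmxA MQ -QB.
Qed.

End ConstantRank.
End SmoothMatrix.

Definition itv_set (R : realType) (I : set R) (I_itv : is_interval I)
  (I_nd : I° !=set0) : perfect_dom R :=
  PerfectDom (let: ex_intro z Iz := I_nd in ex_intro I z (interior_subset Iz))
             (itv_perfect I_itv I_nd).

Section SmoothInterval.
Variables (R : realType) (I : set R) (I_itv : is_interval I) (I_nd : I° !=set0).
Local Notation P := (itv_set I_itv I_nd).
Local Notation C := (smooth_fun P).
Local Notation D := (@sm_der R P).
Local Notation "M ^@ t" := (map_mx (@sm_ev R P t) M) (at level 8).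
Local Notation cst := (map_mx (@sm_cst R P)).

Lemma der0_cst (f : C) t : I t -> D f = 0 -> f = sm_cst P (sm_ev t f).
Proof.
move=> It f0; apply: sm_ev_eq => s Is; rewrite sm_ev_cst !sm_evE//.
apply: (has_der0_cst I_itv) => // x Ix.
by have := @sm_derP R P f x Ix; rewrite f0 sm0.
Qed.

Lemma der0_cst_mx m n (M : 'M[C]_(m, n)) t : I t -> map_mx D M = 0 -> M = cst (M^@t).
Proof.
move=> It M0; apply/matrixP => i j; rewrite !mxE; apply: der0_cst => //.
by have := congr1 (fun B : 'M[C]_(m, n) => B i j) M0; rewrite !mxE.
Qed.

Lemma smooth_ode n (A : 'M[C]_n) (w0 : 'I_n -> R) t0 : I t0 ->
  exists w : 'cV[C]_n, map_mx D w = A *m w /\ forall i, sm_ev t0 (w i 0) = w0 i.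
Proof.
move=> It0.
have cA i j : cont_on I (A i j).
  by apply: diff_cont_on; exact: Cn_diff (smooth_smfun (A i j) 0).
have [w [wt0 dw]] := linear_ode I_itv cA w0 It0.
(* Bootstrap: the derivative of a solution is a combination of the solutions with smooth
   coefficients. *)
have sw i : smooth_on I (w i).
  move=> k; elim: k i => [|k IH] i; split => //.
  - by move=> t It; eexists; exact: dw.
  - by move=> t It; eexists; exact: dw.
  apply: (@Cn_ext _ _ _ (fun t => \sum_j A i j t * w j t)).
    by move=> t It; rewrite (derP (itv_perfect I_itv I_nd) It (dw t i It)).
  apply: (@Cn_sum _ _ _ _ (fun j t => A i j t * w j t)).
    exact: itv_perfect.
  by move=> j; apply: Cn_mul => //; [exact: itv_perfect|exact: smooth_smfun].
exists (\col_i mk_smooth (sw i : smooth_on (pdom P) (w i))); split.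
  apply/matrixP => i j; rewrite !mxE; apply: smooth_fun_eq => t It.
  rewrite (@sm_derE _ P _ _ (\sum_j A i j t * w j t))//.
    rewrite -sm_evE// rmorph_sum; apply: eq_bigr => k _ /=.
    by rewrite rmorphM/= !sm_evE// !mxE mk_smoothE.
  by apply: has_der_ext (dw t i It) => // s Is; rewrite mk_smoothE.
by move=> i; rewrite mxE sm_evE// mk_smoothE.
Qed.

(** Invertibility comes from the adjoint equation V' = - A^T V: the product V^T U has derivative 0
    and equals 1 at t0. *)
Lemma fundamental_matrix n (A : 'M[C]_n) t0 : I t0 ->
  exists U : 'M[C]_n, [/\ U \in unitmx, map_mx D U = A *m U & U^@t0 = 1%:M].
Proof.
have ex (B : 'M[C]_n) : I t0 -> exists U : 'M[C]_n, map_mx D U = B *m U /\ U^@t0 = 1%:M.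
  move=> It0.
  have /choice[w Hw] (j : 'I_n) := smooth_ode B (fun i => (i == j)%:R) It0.
  exists (\matrix_(i, j) w j i 0); split; apply/matrixP => i j.
    have := congr1 (fun M : 'cV[C]_n => M i 0) (Hw j).1; rewrite !mxE => ->.
    by apply: eq_bigr => k _; rewrite mxE.
  by rewrite !mxE (Hw j).2.
move=> It0; have [U [dU U1]] := ex A It0.
have [V [dV V1]] := ex (- A^T) It0.
exists U; split => //.
have VU : V^T *m U = 1%:M.
  rewrite (@der0_cst_mx _ _ (V^T *m U) t0)//; last first.
    rewrite der_mulmx der_trmx dV dU trmx_mul linearN/= trmxK mulmxN mulNmx.
    by rewrite mulmxA addNr.
  by rewrite map_mxM -map_trmx V1 U1 trmx1 mulmx1 map_mx1.
by case/mulmx1_unit: VU.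
Qed.

(* Kato's transport: U' = [Q', Q] U intertwines the projectors Q(t0) and Q(t),
   because Q Q' Q = 0. *)
Lemma kato n (Q : 'M[C]_n) t0 : I t0 -> Q *m Q = Q ->
  exists U V : 'M[C]_n, [/\ U *m V = 1%:M, V *m U = 1%:M & Q = U *m cst (Q^@t0) *m V].
Proof.
move=> It0 QQ; pose Q' := map_mx D Q.
have dQ : Q' = Q' *m Q + Q *m Q' by rewrite {1}/Q' -{1}QQ der_mulmx.
have QQ'Q : Q *m Q' *m Q = 0.
  have := congr1 (fun M => Q *m M *m Q) dQ.
  rewrite mulmxDr mulmxDl !mulmxA QQ -!mulmxA QQ !mulmxA.
  by move/eqP; rewrite -subr_eq0 opprD addrA subrr sub0r oppr_eq0 => /eqP.
pose K := Q' *m Q - Q *m Q'.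
have key : Q' + Q *m K = K *m Q.
  rewrite /K mulmxBr mulmxBl !mulmxA QQ'Q sub0r subr0 -(mulmxA Q') QQ.
  by rewrite {1}dQ addrK.
have [U [Uu dU U1]] := fundamental_matrix K It0.
pose V := invmx U.
have UV : U *m V = 1%:M by rewrite mulmxV.
have VU : V *m U = 1%:M by rewrite mulVmx.
have dV : map_mx D V = - (V *m K).
  have : map_mx D (V *m U) = 0.
    by rewrite VU; apply/matrixP => i j; rewrite !mxE -(rmorph_nat (sm_cst P)) sm_der_cst.
  rewrite der_mulmx dU => e; apply: (can_inj (mulmxK Uu)).
  by rewrite mulNmx -mulmxA; apply/eqP; rewrite -addr_eq0 e.
exists U, V; split => //.
have cQ : V *m Q *m U = cst (Q^@t0).
  rewrite (@der0_cst_mx _ _ (V *m Q *m U) t0)//; last first.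
    rewrite !der_mulmx dV dU -/Q' mulNmx mulmxDl mulNmx -(mulmxA V K) -key.
    exact: conj_commutator.
  congr (map_mx _ _); rewrite !map_mxM/= U1 mulmx1; have := congr1 (map_mx (sm_ev t0)) VU;
    rewrite map_mxM U1 mulmx1 map_mx1 => ->; exact: mul1mx.
by rewrite -cQ !mulmxA UV mul1mx -mulmxA UV mulmx1.
Qed.

(** With Q the projector on the row space of [M] and Q = U Q(t0) V from [kato], a constant basis [K]
    of the kernel at t0 is transported: M (K U^T)^T = M U Q(t0) K^T = 0. This gives one frame of the
    kernel over all of [I]. *)
Lemma smooth_kernel m n r (M : 'M[C]_(m, n)) :
  (forall t, I t -> (r + \rank (M^@t))%N = n) ->
  exists H : 'M[C]_(r, n), M *m H^T = 0 /\ forall t, I t -> row_free (H^@t).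
Proof.
move=> rM; have [t0 It0] := pdom_nonempty P.
have rM' t : pdom P t -> \rank (M^@t) = (n - r)%N by move=> /rM; lia.
have [Q [Qt QQ MQ [B QB]]] := constant_rank_projector rM'.
have [U [V [UV VU QE]]] := kato It0 QQ.
have rQ : \rank (Q^@t0) = (n - r)%N.
  rewrite -(rM' _ It0); apply/eqP; rewrite eqn_leq; apply/andP; split.
    by rewrite QB map_mxM mxrankM_maxr.
  by rewrite -{1}MQ map_mxM mxrankM_maxr.
have [K [fK KQ]] : exists K : 'M[R]_(r, n), row_free K /\ K *m (Q^@t0)^T = 0.
  by apply: exists_kernel; rewrite mxrank_tr rQ; have := rM _ It0; lia.
exists (cst K *m U^T); split.
  rewrite -MQ QE trmx_mul trmxK -!mulmxA (mulmxA V) VU mul1mx.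
  rewrite (_ : cst (Q^@t0) *m (cst K)^T = 0) ?mulmx0//.
  by rewrite map_trmx -map_mxM -[X in X *m _]trmxK -trmx_mul KQ trmx0 map_mx0.
move=> t It; rewrite map_mxM ev_cst_mx /row_free mxrankMfree//.
rewrite row_free_unit; suff : U^@t \in unitmx by rewrite -map_trmx unitmx_tr.
by have := congr1 (map_mx (sm_ev t)) UV; rewrite map_mxM map_mx1 => /mulmx1_unit[].
Qed.

Lemma smooth_frame n m (Q : 'M[C]_n) : Q *m Q = Q ->
  (forall t, I t -> \rank (Q^@t) = m) ->
  exists X : 'M[C]_(m, n), forall t, I t -> row_free (X^@t) /\ (X^@t :=: Q^@t)%MS.
Proof.
move=> QQ rQ; have [t0 It0] := pdom_nonempty P.
have [U [V [UV VU QE]]] := kato It0 QQ.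
have rQ0 := rQ _ It0; set Q0 := Q^@t0 in QE rQ0.
have [F [fF FQ]] : exists F : 'M[R]_(m, n), row_free F /\ (F :=: Q0)%MS.
  rewrite -rQ0; exists (row_base Q0); split; [exact: row_base_free|exact: eq_row_base].
exists (cst F *m V) => t It.
have evUV := congr1 (map_mx (sm_ev t)) UV; rewrite map_mxM map_mx1 in evUV.
have [Uu Vu] := mulmx1_unit evUV.
rewrite map_mxM ev_cst_mx; split.
  by rewrite /row_free mxrankMfree ?row_free_unit.
rewrite QE !map_mxM/= ev_cst_mx -mulmxA.
apply: eqmx_trans (_ : (_ :=: Q0 *m V^@t)%MS) _; first exact: eqmxMr.
by apply: eqmx_sym; apply: eqmxMfull; rewrite row_full_unit.
Qed.

End SmoothInterval.

(** * Frames in a differential symplectic module *)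

(** The interface between analysis and algebra. Nondegeneracy of the form is expressed separately,
    as completeness of a frame; [dsN] provides the divisions by 2 and by row lengths. *)
Record diff_symplectic (K : comUnitRingType) (V : lmodType K) := DiffSymplectic {
  dsK : {additive K -> K};
  dsV : {additive V -> V};
  dsw : V -> V -> K;
  dsKM : forall a b, dsK (a * b) = dsK a * b + a * dsK b;
  dsVZ : forall a v, dsV (a *: v) = dsK a *: v + a *: dsV v;
  dswD : forall u v w, dsw (u + v) w = dsw u w + dsw v w;
  dswZ : forall a u v, dsw (a *: u) v = a * dsw u v;
  dswC : forall u v, dsw u v = - dsw v u;
  dswd : forall u v, dsK (dsw u v) = dsw (dsV u) v + dsw u (dsV v);
  dsN : forall n, (n.+1%:R : K) \is a GRing.unit }.

Arguments dsK : simpl never.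
Arguments dsV : simpl never.
Arguments dsw : simpl never.

Section DiffSymplecticTheory.
Variables (K : comUnitRingType) (V : lmodType K) (S : diff_symplectic V).
Local Notation D := (dsK S).
Local Notation d := (dsV S).
Local Notation w := (dsw S).
Local Notation "v ^[ k ]" := (iter k d v) (at level 2, format "v ^[ k ]").
Implicit Types (u v : V) (a b c : K) (k x y N : nat).

Lemma ds2 : (2%:R : K) \is a GRing.unit.
Proof. exact: (dsN S 1). Qed.

Lemma dswDr u v1 v2 : w u (v1 + v2) = w u v1 + w u v2.
Proof. by rewrite dswC dswD opprD -!(dswC _ u). Qed.
Lemma dswZr a u v : w u (a *: v) = a * w u v.
Proof. by rewrite dswC dswZ -mulrN -dswC. Qed.
Lemma dsw0l v : w 0 v = 0. Proof. by rewrite -(scale0r 0) dswZ mul0r. Qed.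
Lemma dsw0r v : w v 0 = 0. Proof. by rewrite dswC dsw0l oppr0. Qed.
Lemma dswNl u v : w (- u) v = - w u v.
Proof. by rewrite -scaleN1r dswZ mulN1r. Qed.
Lemma dswNr u v : w u (- v) = - w u v.
Proof. by rewrite dswC dswNl -dswC. Qed.
Lemma dswBl u1 u2 v : w (u1 - u2) v = w u1 v - w u2 v.
Proof. by rewrite dswD dswNl. Qed.
Lemma dswBr u v1 v2 : w u (v1 - v2) = w u v1 - w u v2.
Proof. by rewrite dswDr dswNr. Qed.
Lemma dsw_suml (T : Type) (s : seq T) (P : pred T) (F : T -> V) v :
  w (\sum_(i <- s | P i) F i) v = \sum_(i <- s | P i) w (F i) v.
Proof. by apply: (big_morph (w^~ v)); [move=> *; exact: dswD|exact: dsw0l]. Qed.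
Lemma dsw_sumr (T : Type) (s : seq T) (P : pred T) (F : T -> V) v :
  w v (\sum_(i <- s | P i) F i) = \sum_(i <- s | P i) w v (F i).
Proof. by apply: (big_morph (w v)); [move=> *; exact: dswDr|exact: dsw0r]. Qed.

Lemma dsK1 : D 1 = 0.
Proof.
have := dsKM S 1 1; rewrite !mul1r mulr1 => /eqP.
by rewrite -subr_eq0 opprD addrA subrr sub0r oppr_eq0 => /eqP.
Qed.

Lemma dsK_nat n : D n%:R = 0.
Proof. by rewrite raddfMn dsK1 mul0rn. Qed.

Lemma dsK_sign n : D ((-1) ^+ n) = 0.
Proof. by rewrite -signr_odd; case: odd; rewrite ?expr1 ?raddfN/= ?dsK1 ?oppr0. Qed.

Lemma eq_opp_0 a : a = - a -> a = 0.
Proof.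
move=> /eqP; rewrite -subr_eq0 opprK -mulr2n -mulr_natl => /eqP e.
by apply: (can_inj (mulKr ds2)); rewrite mulr0.
Qed.

Lemma dsw_shift u v : w (d u) v = D (w u v) - w u (d v).
Proof. by rewrite dswd addrK. Qed.

(** Integration by parts: moving one derivative from the second entry to the first costs the
    derivative of a pairing of lower total order, which vanishes. *)
Lemma dsw_move_vanish u v N : (forall k, (k < N)%N -> w u v^[k] = 0) ->
  forall x k, (x + k < N)%N -> w u^[x] v^[k] = 0.
Proof.
move=> H; elim=> [|x IH] k xk; first exact: H.
by rewrite iterS dsw_shift -iterS !IH ?raddf0 ?addr0//; lia.
Qed.

Lemma dsw_move_const u v N c : D c = 0 ->
  (forall x k, (x + k = N)%N -> w u^[x] v^[k] = (-1) ^+ x * c) ->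
  forall x k, (x + k = N.+1)%N -> w u^[x] v^[k] = (-1) ^+ x * w u v^[N.+1].
Proof.
move=> Dc H; elim=> [|x IH] k xk; first by rewrite mul1r -xk.
rewrite iterS dsw_shift -iterS H; last by lia.
rewrite dsKM dsK_sign Dc mul0r mulr0 addr0 sub0r IH; last by lia.
by rewrite exprS mulN1r mulNr.
Qed.

(** Vanishing spreads from the m by n rectangle to orders x + k < m + n - 1 with x < m: a derivative
    beyond the n-th in the second entry is exchanged for one in the first, and the order bound keeps
    x + 1 < m. *)
Lemma dsw_move_block u v (m n : nat) : (0 < n)%N ->
  (forall x k, (x < m)%N -> (k < n)%N -> w u^[x] v^[k] = 0) ->
  forall x k, (x < m)%N -> (x + k < m + n - 1)%N -> w u^[x] v^[k] = 0.
Proof.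
move=> n0 H x k; elim: k x => [|k IH] x xa xk.
  exact: H.
have [kb|kb] := ltnP k.+1 n; first exact: H.
have := dswd S u^[x] v^[k]; rewrite IH ?raddf0//; last by lia.
move/esym/eqP; rewrite addrC addr_eq0 => /eqP ->.
by rewrite -iterS IH ?oppr0//; lia.
Qed.

Section Table.
Variables (T : finType) (p : T -> nat) (eps : T -> V).

(* The pairings that characterise the superboxes sigma_i of a normal frame:
   eps r is an entry of E_a for a special superbox a at the end of a row of
   length p r. *)
Definition pairing_table (r l : T) : Prop :=
  [/\ p r != p l -> forall x k, (x + k < 2 * maxn (p r) (p l))%N ->
        w (eps r)^[x] (eps l)^[k] = 0,
      p r = p l -> forall x k, (x + k <= 2 * p r)%N -> (x + k).+1 != (2 * p r)%N ->
        w (eps r)^[x] (eps l)^[k] = 0 &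
      p r = p l -> forall x k, (x + k).+1 = (2 * p r)%N ->
        w (eps r)^[x] (eps l)^[k] = (-1) ^+ (p r + x) * (r == l)%:R].

Lemma pairing_table_lt r l : (p r < p l)%N ->
  (forall k, (k < 2 * p l)%N -> w (eps r) (eps l)^[k] = 0) ->
  pairing_table r l /\ pairing_table l r.
Proof.
move=> rl H; have H' := dsw_move_vanish H.
split; split; try by move=> e; lia.
  by move=> _ x k xk; apply: H'; lia.
by move=> _ x k xk; rewrite dswC H' ?oppr0//; lia.
Qed.

(** One pairing determines each of the antidiagonals 2 p - 1 and 2 p, since below them everything
    vanishes and on the first of them the values are constant; the two chosen ones are those that
    Darboux conditions and explicit constructions provide. *)
Lemma pairing_table_eq r l : p r = p l -> (0 < p r)%N ->
  (forall x k, (x < p r)%N -> (k < p r)%N -> w (eps r)^[x] (eps l)^[k] = 0) ->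
  w (eps r)^[p r] (eps l)^[(p r).-1] = (r == l)%:R ->
  w (eps r)^[p r] (eps l)^[p r] = 0 ->
  pairing_table r l.
Proof.
move=> rl p0 H0 H1 H2;
have L1 x k : (x + k < (2 * p r).-1)%N -> w (eps r)^[x] (eps l)^[k] = 0.
  move=> xk; apply: (@dsw_move_vanish _ _ (2 * p r).-1) => // k' k'p.
  by apply: (dsw_move_block p0 H0 (x := 0)) => //; lia.
have L2 x k : (x + k = (2 * p r).-1)%N ->
    w (eps r)^[x] (eps l)^[k] = (-1) ^+ x * ((-1) ^+ p r * (r == l)%:R).
  have e : (2 * p r).-1 = ((2 * p r).-2).+1 by lia.
  have M := @dsw_move_const (eps r) (eps l) (2 * p r).-2 0 (raddf0 _).
  have {}M x' k' : (x' + k' = (2 * p r).-1)%N ->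
      w (eps r)^[x'] (eps l)^[k'] = (-1) ^+ x' * w (eps r) (eps l)^[(2 * p r).-1].
    move=> xk'; rewrite e; apply: M; last by lia.
    by move=> x'' k'' ?; rewrite mulr0 L1//; lia.
  move=> xk; rewrite M// -H1 M; last by lia.
  by rewrite [(-1) ^+ p r * _]mulrA -expr2 sqrr_sign mul1r.
have L3 x k : (x + k = 2 * p r)%N -> w (eps r)^[x] (eps l)^[k] = 0.
  have e : (2 * p r)%N = ((2 * p r).-1).+1 by lia.
  have M := @dsw_move_const (eps r) (eps l) (2 * p r).-1 _ _ L2.
  have {}M x' k' : (x' + k' = 2 * p r)%N ->
      w (eps r)^[x'] (eps l)^[k'] = (-1) ^+ x' * w (eps r) (eps l)^[2 * p r].
    by move=> xk'; rewrite e; apply: M; [rewrite dsKM dsK_sign dsK_nat mul0r mulr0 addr0|lia].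
  move=> xk; rewrite M//; have : w (eps r)^[p r] (eps l)^[p r] = 0 by [].
  rewrite M; last by lia.
  move/(congr1 (fun z => (-1) ^+ p r * z)); rewrite mulrA -expr2 sqrr_sign mul1r mulr0 => ->.
  by rewrite mulr0.
split => [/eqP//|_ x k xk1 xk2|_ x k xk].
  have [/L3//|xk] := eqVneq (x + k)%N (2 * p r)%N.
  by apply: L1; lia.
by rewrite L2; [rewrite exprD mulrA (mulrC (_ ^+ x))|lia].
Qed.

End Table.

Section Frames.
Variables (T : finType) (p : T -> nat).
Implicit Types (e f : T -> nat -> V) (G : T -> nat -> T -> nat -> K).

Definition darboux_pairings e f : Prop :=
  forall r x l y, (x < p r)%N -> (y < p l)%N ->
  [/\ w (e r x) (e l y) = 0, w (f r x) (f l y) = 0 &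
      w (f r x) (e l y) = ((r == l) && (x == y))%:R].

Definition e_equations e f : Prop :=
  forall r x, (x < p r)%N -> d (e r x) = if x is x'.+1 then e r x' else f r 0%N.

(** Over a ring this orthogonality form of spanning is all that nondegeneracy has to supply: vectors
    are compared through their pairings with the frame. *)
Definition complete_frame e f : Prop :=
  forall v, (forall r x, (x < p r)%N -> w v (e r x) = 0 /\ w v (f r x) = 0) -> v = 0.

(** The coefficient of [e l y] in the derivative of [f r x], read off by pairing with [f l y]; these
    are the entries of the matrices R(a, b) of the structure equations. *)
Definition curvature f (r : T) (x : nat) (l : T) (y : nat) : K := w (f l y) (d (f r x)).

(** Normality entry by entry, for l not longer than r. The pairs of the tuple attached to two levels
    are (x, x), (x, x + 1) and, past the end of the shorter level, (x, p l - 1); the first two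
    clauses kill everything else. The pair in position k of the tuple (from 0) has coordinate sum k,
    so the third clause kills its first p r - p l - 1 pairs. The last clause is the antisymmetry of
    R(a, r(a)). *)
Definition normal_curvature f : Prop :=
  [/\ forall r x l y, (x < p r)%N -> (y < p l)%N -> (p l <= p r)%N -> (x.+1 < y)%N ->
        curvature f r x l y = 0,
      forall r x l y, (x < p r)%N -> (y < p l)%N -> (p l < p r)%N -> (y < x)%N ->
        (y.+1 < p l)%N -> curvature f r x l y = 0,
      forall r x l y, (x < p r)%N -> (y < p l)%N -> (p l < p r)%N ->
        (x + y + 1 < p r - p l)%N -> curvature f r x l y = 0 &
      forall r l x, p r = p l -> (x.+1 < p r)%N ->
        curvature f r x l x.+1 = - curvature f l x r x.+1].

Definition ecomb e (c : T -> nat -> K) : V := \sum_l \sum_(y < p l) c l y *: e l y.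

Lemma w_ecombl e (c : T -> nat -> K) v : w (ecomb e c) v = \sum_l \sum_(y < p l) c l y * w (e l y) v.
Proof.
rewrite dsw_suml; apply: eq_bigr => l _; rewrite dsw_suml.
by apply: eq_bigr => y _; rewrite dswZ.
Qed.

Lemma sum_delta (g : T -> nat -> K) (F : T -> nat -> K) r x :
  (x < p r)%N -> (forall l y, (y < p l)%N -> F l y = ((l == r) && (y == x))%:R) ->
  \sum_l \sum_(y < p l) g l y * F l y = g r x.
Proof.
move=> xr HF; rewrite (bigD1 r)//= (bigD1 (Ordinal xr))//= HF// !eqxx mulr1.
rewrite big1 ?addr0 => [|y yx]; last first.
  by rewrite HF// eqxx/=; move: yx; rewrite -val_eqE/= => /negPf->; rewrite mulr0.
rewrite big1 ?addr0// => l lr; rewrite big1// => y _.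
by rewrite HF// (negPf lr) mulr0.
Qed.

Lemma ecomb_dual e (g : T -> nat -> V) (c : T -> nat -> K) l y :
  (forall r x, (x < p r)%N -> w (g l y) (e r x) = ((l == r) && (y == x))%:R) ->
  (y < p l)%N -> w (ecomb e c) (g l y) = - c l y.
Proof.
move=> ge yl; rewrite w_ecombl.
rewrite -(@sum_delta c (fun r x => ((r == l) && (x == y))%:R) l y yl)// -sumrN.
apply: eq_bigr => r _; rewrite -sumrN; apply: eq_bigr => x _.
by rewrite dswC ge// mulrN eq_sym (eq_sym y).
Qed.

Lemma ecomb_vanish e (c : T -> nat -> K) v :
  (forall r x, (x < p r)%N -> w (e r x) v = 0) -> w (ecomb e c) v = 0.
Proof.
move=> ev; rewrite w_ecombl big1// => r _; rewrite big1// => x _.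
by rewrite ev ?mulr0.
Qed.

Section Darboux.
Variables (e f : T -> nat -> V).
Hypothesis ef : darboux_pairings e f.

Lemma ecomb_e (c : T -> nat -> K) l y : (y < p l)%N -> w (ecomb e c) (e l y) = 0.
Proof. by move=> yl; apply: ecomb_vanish => r x xr; have [] := ef xr yl. Qed.

Lemma ecomb_f (c : T -> nat -> K) l y : (y < p l)%N -> w (ecomb e c) (f l y) = - c l y.
Proof. by move=> yl; apply: ecomb_dual => // r x xr; have [] := ef yl xr. Qed.

Hypothesis eq_e : e_equations e f.

(** Differentiating the constant pairing of e with f: the components of F' along F are dictated by
    the equations for E'. *)
Lemma w_e_df l y r x : (y < p l)%N -> (x < p r)%N ->
  w (e l y) (d (f r x)) = if y is y'.+1 then ((r == l) && (x == y'))%:R else 0.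
Proof.
move=> yl xr; have [_ ff fe] := ef xr yl.
have h : D (w (e l y) (f r x)) = 0 by rewrite dswC fe raddfN/= dsK_nat oppr0.
move: (dswd S (e l y) (f r x)); rewrite h eq_e// => /esym/eqP.
rewrite addrC addr_eq0 => /eqP ->; case: y yl ff fe h => [|y] yl ff fe h.
  by rewrite dswC opprK; have [_ -> _] := ef xr yl.
by rewrite -dswC; have [_ _ ->] := ef xr (ltnW yl).
Qed.

Lemma curvature_sym r x l y : (x < p r)%N -> (y < p l)%N ->
  curvature f r x l y = curvature f l y r x.
Proof.
move=> xr yl; rewrite /curvature [RHS]dswC.
have [_ ff _] := ef yl xr; have := dswd S (f l y) (f r x).
by rewrite ff raddf0 => /esym/eqP; rewrite addrC addr_eq0 => /eqP.
Qed.

(* Out of range the vector f r p_r stands for 0. *)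
Lemma f_equation : complete_frame e f -> forall r x, (x < p r)%N ->
  d (f r x) = ecomb e (curvature f r x) - (if (x.+1 < p r)%N then f r x.+1 else 0).
Proof.
move=> cf r x xr; apply/eqP; rewrite -subr_eq0; apply/eqP; apply: cf => l y yl.
rewrite !dswBl ecomb_e// ecomb_f//; split.
  rewrite dswC w_e_df// sub0r opprK; case: ifP => [x1|x1].
    have [_ _ ->] := ef x1 yl; case: y yl => [|y] yl.
      by rewrite eq_sym andbF oppr0 add0r.
    by rewrite eqSS; apply/eqP; rewrite addrC subr_eq0.
  rewrite dsw0l addr0; case: y yl => [|y] yl; first by rewrite oppr0.
  case: eqP => [rl|]; last by rewrite oppr0.
  by case: eqP => [xy|]; rewrite /= ?oppr0//; move: x1; rewrite xy rl yl.
rewrite dswC -/(curvature f r x l y) opprB opprK addrC.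
case: ifP => x1; last by rewrite dsw0l add0r addrN.
by have [_ -> _] := ef x1 yl; rewrite add0r addrN.
Qed.

(** Symmetry keeps the new f isotropic, and vanishing in column 0 keeps [f r 0], which is the
    derivative of [e r 0]. Vanishing past the end of a row lets [gauge_curvature] hold without case
    distinctions there. *)
Definition gauge_function G : Prop :=
  [/\ forall r x l y, G r x l y = G l y r x, forall r l y, G r 0%N l y = 0 &
      forall r x l y, (p r <= x)%N -> G r x l y = 0].

Definition gauge G r x : V := f r x + ecomb e (G r x).

Section Gauge.
Variable G : T -> nat -> T -> nat -> K.
Hypothesis GG : gauge_function G.

Lemma gauge0 r : gauge G r 0 = f r 0%N.
Proof.
have [_ G0 _] := GG; rewrite /gauge /ecomb big1 ?addr0// => l _.
by rewrite big1// => y _; rewrite G0 scale0r.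
Qed.

Lemma gauge_darboux : darboux_pairings e (gauge G).
Proof.
move=> r x l y xr yl; have [ee ff fe] := ef xr yl; have [Gs _ _] := GG.
split => //; rewrite /gauge !dswD ?ecomb_e ?addr0// !dswDr ff add0r.
rewrite ecomb_f// [w (f r x) _]dswC ecomb_f// opprK.
rewrite dswC w_ecombl big1 ?oppr0 ?addr0.
  by rewrite Gs addrN.
move=> s _; rewrite big1// => z _; rewrite dswC ecomb_e//.
by rewrite oppr0 mulr0.
Qed.

Lemma gauge_e_equations : e_equations e (gauge G).
Proof. by move=> r x xr; rewrite eq_e//; case: x xr => // xr; rewrite gauge0. Qed.

(** The term D G differentiates the coefficients, G at (x, y + 1) comes from E' being the left
    neighbour, and G at (x + 1, y) from the correction of [f l y] meeting the component of F' along
    the right neighbour. *)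
Lemma gauge_curvature r x l y : (x < p r)%N -> (y < p l)%N ->
  curvature (gauge G) r x l y =
  curvature f r x l y + D (G r x l y) + G r x.+1 l y + G r x l y.+1.
Proof.
move=> xr yl; have [Gs G0 Gout] := GG.
rewrite /curvature {2}/gauge raddfD/= dswDr.
have de : d (ecomb e (G r x)) = ecomb e (fun l y => D (G r x l y)) +
    ecomb e (fun l y => G r x l y.+1).
  rewrite /ecomb raddf_sum/= -big_split; apply: eq_bigr => s _ /=.
  rewrite raddf_sum/=; under eq_bigr do rewrite dsVZ.
  rewrite big_split/=; congr (_ + _).
  have Gr0 : G r x s 0 = 0 by rewrite Gs G0.
  have Grp : G r x s (p s) = 0 by rewrite Gs Gout.
  case: (p s) (@eq_e s) Grp => [|q] ee Grp; first by rewrite !big_ord0.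
  rewrite big_ord_recl big_ord_recr/= Gr0 Grp !scale0r add0r addr0.
  by apply: eq_bigr => z _; rewrite ee// /bump/= ltnS.
have gd := gauge_darboux.
have wg (c : T -> nat -> K) : w (ecomb e c) (gauge G l y) = - c l y.
  rewrite /gauge dswDr ecomb_f// dswC w_ecombl big1 ?oppr0 ?addr0// => s _.
  by rewrite big1// => z _; rewrite dswC ecomb_e// oppr0 mulr0.
have wg' (c : T -> nat -> K) : w (gauge G l y) (ecomb e c) = c l y.
  by rewrite dswC wg opprK.
rewrite de dswDr !wg' /gauge dswD.
have -> : w (ecomb e (G l y)) (d (f r x)) = G r x.+1 l y.
  rewrite w_ecombl; have [xr1|xr1] := ltnP x.+1 (p r).
    rewrite (@sum_delta (G l y) (fun s z => w (e s z) (d (f r x))) r x.+1 xr1).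
      by rewrite Gs.
    move=> s z zs; rewrite w_e_df//; case: z zs => [|z] zs; first by rewrite andbF.
    by rewrite eqSS eq_sym (eq_sym z).
  rewrite Gout// big1// => s _; rewrite big1// => z _; rewrite w_e_df//.
  case: (nat_of_ord z) (ltn_ord z) => [|z'] zs; first by rewrite mulr0.
  case: eqP => [rs|]; last by rewrite mulr0.
  case: eqP => [xz|]; last by rewrite mulr0.
  by move: xr1; rewrite xz rs leqNgt zs.
rewrite -!addrA; congr (_ + _); rewrite addrC -addrA; congr (_ + _); exact: addrC.
Qed.

End Gauge.
End Darboux.
End Frames.
End DiffSymplecticTheory.

(** * From the pairing table to a normal frame *)

Section FrameOfTable.
Variables (K : comUnitRingType) (V : lmodType K) (S : diff_symplectic V).
Local Notation D := (dsK S).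
Local Notation d := (dsV S).
Local Notation w := (dsw S).
Local Notation "v ^[ k ]" := (iter k d v) (at level 2, format "v ^[ k ]").
Variables (T : finType) (p : T -> nat).
Hypothesis p0 : forall r, (0 < p r)%N.
Implicit Types (r l s : T) (x y z : nat) (v : V).

Definition eframe (eps : T -> V) r x : V := (eps r)^[(p r).-1 - x].

Variable eps : T -> V.
Hypothesis tab : forall r l, pairing_table S p eps r l.

Local Notation e := (eframe eps).
(** The F that would result if all matrices R were zero: each is minus the derivative of its left
    neighbour. It is dual to the e only modulo lower columns. *)
Let Phi r x : V := (-1) ^+ x *: (eps r)^[p r + x].
(** The absolute difference of the two lengths, by truncated subtraction. *)
Let dst r l := ((p r - p l) + (p l - p r))%N.

Let ee r x l y : (x < p r)%N -> (y < p l)%N -> w (e r x) (e l y) = 0.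
Proof.
move=> xr yl; have [H1 H2 _] := tab r l; rewrite /eframe.
have [rl|rl] := eqVneq (p r) (p l); first by apply: H2 => //; lia.
by apply: H1 => //; lia.
Qed.

Let de r x : (x < p r)%N -> d (e r x) = if x is x'.+1 then e r x' else Phi r 0.
Proof.
move=> xr; rewrite /eframe -iterS; case: x xr => [|x] xr.
  by rewrite /Phi expr0 scale1r subn0 addn0 prednK.
by rewrite -subSn ?subSS; last by lia.
Qed.

Let dPhi r x : d (Phi r x) = - Phi r x.+1.
Proof. by rewrite /Phi dsVZ dsK_sign scale0r add0r exprS mulN1r scaleNr opprK addnS. Qed.

Let Phi_e0 r x l y : (y < p l)%N -> (x < dst r l + y)%N -> w (Phi r x) (e l y) = 0.
Proof.
rewrite /dst => yl xy; have [H1 H2 _] := tab r l; rewrite /Phi /eframe dswZ.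
have [rl|rl] := eqVneq (p r) (p l); first by rewrite H2 ?mulr0//; lia.
by rewrite H1 ?mulr0//; lia.
Qed.

Let Phi_e r x l : (x < p l)%N -> w (Phi r x) (e l x) = (r == l)%:R.
Proof.
move=> xl; have [H1 H2 H3] := tab r l; rewrite /Phi /eframe dswZ.
have [rl|rl] := eqVneq (p r) (p l).
  rewrite H3//; last by have := p0 l; lia.
  by rewrite mulrA -exprD -signr_odd !oddD; case: (odd x); case: (odd (p r)); rewrite /= mul1r.
by rewrite H1 ?mulr0//; [rewrite (_ : (r == l) = false)//; apply/eqP => rl'; rewrite rl' eqxx in rl|lia].
Qed.

(* The weight filtration responsible for the vanishing of the first matrices
   of a normal mapping. *)
Inductive weight_class r x : V -> Prop :=
| weight0 : weight_class r x 0
| weightD u v : weight_class r x u -> weight_class r x v -> weight_class r x (u + v)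
| weightZ a v : weight_class r x v -> weight_class r x (a *: v)
| weightE s z : (z < p s)%N -> (dst r s <= x + z)%N -> weight_class r x (e s z)
| weightF s y : (dst r s + y <= x)%N -> weight_class r x (Phi s y).

Let weightN r x v : weight_class r x v -> weight_class r x (- v).
Proof. by move=> ?; rewrite -scaleN1r; exact: weightZ. Qed.

Let weight_sub r x l y v : (dst r l + y <= x)%N -> weight_class l y v -> weight_class r x v.
Proof.
move=> h; elim=> [|u u' _ IH _ IH'|a u _ IH|s z zs hz|s z hz].
- exact: weight0.
- exact: weightD.
- exact: weightZ.
- by apply: weightE => //; move: h hz; rewrite /dst; lia.
- by apply: weightF => //; move: h hz; rewrite /dst; lia.
Qed.

Let weight_d r x v : weight_class r x v -> weight_class r x.+1 (d v).
Proof.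
have sub u : weight_class r x u -> weight_class r x.+1 u.
  by apply: weight_sub; rewrite /dst; lia.
elim=> [|u u' _ IH _ IH'|a u H IH|s z zs hz|s z hz].
- by rewrite raddf0; exact: weight0.
- by rewrite raddfD; exact: weightD.
- by rewrite dsVZ; apply: weightD; apply: weightZ => //; exact: sub.
- rewrite de//; case: z zs hz => [|z] zs hz.
    by apply: weightF; move: hz; rewrite /dst; lia.
  by apply: weightE; [exact: ltnW|move: hz; rewrite /dst; lia].
- by rewrite dPhi; apply: weightN; apply: weightF; move: hz; rewrite /dst; lia.
Qed.

(** Together with [weight_d] this makes the curvature of a frame of these weights vanish for x + y +
    1 < dst, the third clause of normality. *)
Let weight_w r x l y u v : weight_class r x u -> weight_class l y v ->
  (x + y < dst r l)%N -> w u v = 0.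
Proof.
move=> Hu Hv xy; elim: Hu => [|u1 u2 _ IH _ IH'|a u' _ IH|s z zs hz|s z hz].
- exact: dsw0l.
- by rewrite dswD IH IH' addr0.
- by rewrite dswZ IH mulr0.
- elim: Hv => [|u1 u2 _ IH _ IH'|a u' _ IH|s' z' zs' hz'|s' z' hz'].
  + exact: dsw0r.
  + by rewrite dswDr IH IH' addr0.
  + by rewrite dswZr IH mulr0.
  + exact: ee.
  + by rewrite dswC Phi_e0 ?oppr0//; move: xy hz hz'; rewrite /dst; lia.
- elim: Hv => [|u1 u2 _ IH _ IH'|a u' _ IH|s' z' zs' hz'|s' z' hz'].
  + exact: dsw0r.
  + by rewrite dswDr IH IH' addr0.
  + by rewrite dswZr IH mulr0.
  + by rewrite Phi_e0//; move: xy hz hz'; rewrite /dst; lia.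
  + rewrite /Phi dswZ dswZr; have [H1 _ _] := tab s s'.
    by rewrite H1 ?mulr0//; move: xy hz hz'; rewrite /dst; lia.
Qed.

Let weight_ecomb r x (g : T -> nat -> V) (c : T -> nat -> K) :
  (forall l y, (y < p l)%N -> weight_class r x (c l y *: g l y)) ->
  weight_class r x (ecomb p g c).
Proof.
move=> H; rewrite /ecomb; elim/big_ind: _ => [|u v Hu Hv|l _]; [exact: weight0|exact: weightD|].
elim/big_ind: _ => [|u v Hu Hv|y _]; [exact: weight0|exact: weightD|exact: H].
Qed.

(** Induction on the column: [Phi r x] pairs correctly with the e in columns y >= x, and its
    pairings with earlier columns are removed by subtracting dual vectors already found. A
    subtraction occurs only where dst r l + y <= x, which preserves the weight. *)
Let dual_vector x r : exists v, [/\ weight_class r x v,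
  forall l y, (y < p l)%N -> w v (e l y) = ((r == l) && (x == y))%:R &
  x = 0%N -> v = Phi r 0].
Proof.
elim/ltn_ind: x r => x IH r.
have /choice[g Hg] (ly : T * nat) : exists v, (ly.2 < x)%N ->
    weight_class ly.1 ly.2 v /\
    forall l y, (y < p l)%N -> w v (e l y) = ((ly.1 == l) && (ly.2 == y))%:R.
  case: ly => l y /=; have [yx|] := ltnP y x; last by exists 0.
  by have [v [H1 H2 _]] := IH y yx l; exists v.
pose c l y := if (y < x)%N then w (Phi r x) (e l y) else 0.
exists (Phi r x - ecomb p (fun l y => g (l, y)) c); split.
- apply: weightD; first by apply: weightF; rewrite /dst; lia.
  apply: weightN; apply: weight_ecomb => l y yl; rewrite /c; case: ifP => yx; last first.
    by rewrite scale0r; exact: weight0.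
  have [xd|xd] := ltnP x (dst r l + y).
    by rewrite Phi_e0// scale0r; exact: weight0.
  by apply: weightZ; apply: weight_sub xd _; have [] := Hg (l, y) yx.
- move=> l y yl; rewrite dswBl w_ecombl.
  have [yx|yx] := ltnP y x.
    rewrite -[X in _ - X = _](_ : c l y = _).
      by rewrite /c yx subrr (_ : x == y = false) ?andbF//; lia.
    rewrite -(@sum_delta _ _ p c (fun r x => ((r == l) && (x == y))%:R) l y yl)//.
    apply: eq_bigr => s _; apply: eq_bigr => z _; rewrite /c.
    case: ifP => zx; last by rewrite !mul0r.
    by have [_ ->] := Hg (s, nat_of_ord z) zx.
  rewrite big1 ?subr0 => [|s _].
    have [->|nxy] := eqVneq x y; first by rewrite Phi_e// andbT.
    by rewrite andbF Phi_e0//; lia.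
  rewrite big1// => z _; rewrite /c; case: ifP => zx; last by rewrite mul0r.
  have [_ ->//] := Hg (s, nat_of_ord z) zx.
  by rewrite (_ : (_ == y) = false) ?andbF ?mulr0//=; lia.
- move=> x00; rewrite /ecomb big1 ?subr0 ?x00// => l _.
  by rewrite big1// => y _; rewrite /c x00 ltn0 scale0r.
Qed.

Let isotropic_frame : exists f : T -> nat -> V, [/\ darboux_pairings S p e f,
  e_equations S p e f & forall r x, weight_class r x (f r x)].
Proof.
have /choice[g0 Hg] (rx : T * nat) := dual_vector rx.2 rx.1.
pose g r x := g0 (r, x).
have gw r x : weight_class r x (g r x) by have [] := Hg (r, x).
have ge r x l y : (y < p l)%N -> w (g r x) (e l y) = ((r == l) && (x == y))%:R.
  by have [_ H _] := Hg (r, x); exact: H.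
have g00 r : g r 0%N = Phi r 0 by have [_ _ H] := Hg (r, 0%N); exact: H.
(* Each of two vectors removes half of their mutual pairing, except that [f r 0] must remain
   [Phi r 0], so its partner removes all of it. *)
pose kap (x y : nat) : K := if x == 0%N then 0 else if y == 0%N then 1 else 2^-1.
pose c r x l y := kap x y * w (g r x) (g l y).
pose f r x := g r x + ecomb p e (c r x).
have f0 r : f r 0%N = Phi r 0.
  rewrite /f g00 /ecomb big1 ?addr0// => l _; rewrite big1// => y _.
  by rewrite /c /kap eqxx mul0r scale0r.
exists f; split.
- move=> r x l y xr yl.
  have ge' : w (ecomb p e (c r x)) (e l y) = 0.
    by apply: ecomb_vanish => s z zs; exact: ee.
  split; first exact: ee; last by rewrite /f dswD ge' addr0 ge.
  have ef1 r' x' c' : (x' < p r')%N -> w (ecomb p e c') (g r' x') = - c' r' x'.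
    by move=> xr'; apply: ecomb_dual => // s z zs; exact: ge.
  have eE : w (ecomb p e (c r x)) (ecomb p e (c l y)) = 0.
    apply: ecomb_vanish => s z zs; rewrite dswC ecomb_vanish ?oppr0// => s' z' zs'.
    exact: ee.
  rewrite /f dswD !dswDr ef1// eE addr0 [w (g r x) (ecomb _ _ _)]dswC ef1// opprK.
  rewrite /c [w (g l y) _]dswC /kap.
  have [->|x0] := eqVneq x 0%N; have [->|y0] := eqVneq y 0%N; rewrite ?eqxx.
  + rewrite !mul0r !addr0 subr0 !g00 /Phi !expr0 !scale1r !addn0.
    have [H1 H2 _] := tab r l; have [rl|rl] := eqVneq (p r) (p l).
      by apply: H2 => //; lia.
    by apply: H1 => //; lia.
  + by rewrite mul0r subr0 mul1r addrN.
  + by rewrite mul0r addr0 mul1r subrr.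
  + set a := w _ _; rewrite mulrN -addrA -opprD -mulrDl.
    suff -> : 2^-1 + 2^-1 = 1 :> K by rewrite mul1r subrr.
    by rewrite -mulr2n -[_ *+ 2]mulr_natl mulrV//; exact: ds2 S.
- by move=> r x xr; rewrite de//; case: x xr => // xr; rewrite f0.
move=> r x; apply: weightD => //; apply: weight_ecomb => l y yl.
have [h|h] := ltnP (x + y) (dst r l); last by apply: weightZ; exact: weightE.
by rewrite /c (weight_w (gw r x) (gw l y) h) mulr0 scale0r; exact: weight0.
Qed.

Section Elimination.
Implicit Type X : T -> nat -> T -> nat -> K.

(* Along the antidiagonal of positions (x, y) with x + y constant, a gauge
   function changes the curvature at (x, y) by its values at (x + 1, y) and
   (x, y + 1).  [elim_left] is the solution that cancels X starting from the
   end x = 0. *)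
Fixpoint elim_left X r l x y : K :=
  if x is x'.+1 then
    if [&& x'.+1 < p r, 0 < y & y < p l]%N then - X r x' l y - elim_left X r l x' y.+1
    else 0
  else 0.

(** Decides from which end of the antidiagonal a position is eliminated, the two weights summing to
    1. The switch sits where normality allows nonzero entries: between the two allowed diagonals for
    different lengths, and on the diagonal, shared equally, for equal lengths, which leaves an
    antisymmetric entry. *)
Definition elim_side r l x y : K :=
  if (p l < p r)%N then (x < y)%:R else if (p r < p l)%N then (x <= y)%:R else
  if (x < y)%N then 1 else if x == y then 2^-1 else 0.

Definition elim_gauge X r x l y : K :=
  elim_side r l x y * elim_left X r l x y + elim_side l r y x * elim_left X l r y x.

Lemma elim_left_step X r l x y : (x.+1 < p r)%N -> (0 < y)%N -> (y < p l)%N ->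
  elim_left X r l x.+1 y + elim_left X r l x y.+1 = - X r x l y.
Proof. by move=> h1 h2 h3 /=; rewrite h1 h2 h3 subrK. Qed.

Let elim_left_out X r l x y : (p r <= x)%N || (p l <= y)%N || (y == 0)%N ->
  elim_left X r l x y = 0.
Proof. by case: x => //= x; case: ifP => // /and3P[h1 h2 h3]; lia. Qed.

Let elim_left_local X X' m : (forall r x l y, (x + y < m)%N -> X r x l y = X' r x l y) ->
  forall x y r l, (x + y <= m)%N -> elim_left X r l x y = elim_left X' r l x y.
Proof.
move=> XX'; elim=> [//|x IH] y r l xy /=; case: ifP => // _.
by rewrite XX' ?IH//; lia.
Qed.

Let elim_left_vanish X (b : T -> T -> nat) :
  (forall r x l y, (x + y + 1 < b r l)%N -> X r x l y = 0) ->
  forall x y r l, (x + y < b r l)%N -> elim_left X r l x y = 0.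
Proof.
move=> X0; elim=> [//|x IH] y r l xy /=; case: ifP => // _.
by rewrite X0 ?IH ?subr0 ?oppr0//; lia.
Qed.

Lemma elim_gauge_function X : gauge_function p (elim_gauge X).
Proof.
split=> [r x l y|r l y|r x l y px]; rewrite /elim_gauge.
- exact: addrC.
- by rewrite /= mulr0 add0r elim_left_out ?mulr0// orbT.
- by rewrite !elim_left_out ?mulr0 ?addr0 ?px ?orbT.
Qed.

(* The gauge function also enters the curvature through its derivative, which
   has lower order, so that the elimination is a fixed point problem solved by
   finitely many iterations. *)
Lemma elim_fixpoint X : exists G, G = elim_gauge (fun r x l y => X r x l y + D (G r x l y)) /\
  forall b : T -> T -> nat, (forall r l, b r l = b l r) ->
  (forall r x l y, (x + y + 1 < b r l)%N -> X r x l y = 0) ->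
  forall r x l y, (x + y < b r l)%N -> G r x l y = 0.
Proof.
pose step G := elim_gauge (fun r x l y => X r x l y + D (G r x l y)).
pose G n := iter n step (fun _ _ _ _ => 0).
have Gstep n r x l y : (x + y <= n)%N -> G n r x l y = G n.+1 r x l y.
  elim: n r x l y => [|n IH] r x l y xy.
    have -> : x = 0%N by lia. have -> : y = 0%N by lia.
    by rewrite /= /step /elim_gauge /= !mulr0 addr0.
  rewrite /= /step /elim_gauge; congr (_ * _ + _ * _).
    apply: elim_left_local xy => r' x' l' y' xy'; congr (_ + D _).
    by apply: IH; rewrite -ltnS.
  rewrite addnC in xy; apply: elim_left_local xy => r' x' l' y' xy'; congr (_ + D _).
  by apply: IH; rewrite -ltnS.
(* The n-th iterate is already stationary where x + y <= n, and N bounds x + y within the rows. *)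
pose N := (2 * \sum_r p r)%N.
have pN r : (p r <= \sum_r p r)%N by rewrite (bigD1 r)//= leq_addr.
have G_out n r x l y : (p r <= x)%N || (p l <= y)%N -> G n r x l y = 0.
  case: n => // n pxy; rewrite /= /step /elim_gauge !elim_left_out ?mulr0 ?addr0//;
    by case/orP: pxy => ->; rewrite ?orbT.
exists (G N); split.
  apply/funext => r; apply/funext => x; apply/funext => l; apply/funext => y.
  have [pxy|] := boolP ((p r <= x)%N || (p l <= y)%N).
    by rewrite G_out// -/(step (G N) r x l y) -[step _]/(G N.+1) G_out.
  by move=> pxy; apply: Gstep; have := pN r; have := pN l; rewrite /N; lia.
move=> b bs X0; elim: N => [//|n IH] r x l y xy.
have H r' x' l' y' : (x' + y' + 1 < b r' l')%N -> X r' x' l' y' + D (G n r' x' l' y') = 0.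
  by move=> h; rewrite X0// IH ?raddf0 ?addr0//; lia.
rewrite /= /step /elim_gauge (elim_left_vanish H)// (elim_left_vanish H).
  by rewrite !mulr0 addr0.
by rewrite bs addnC.
Qed.

End Elimination.

Theorem frame_of_table : exists f : T -> nat -> V, [/\ darboux_pairings S p e f,
  e_equations S p e f & normal_curvature S p f].
Proof.
have [f0 [ef0 eq0 wf0]] := isotropic_frame.
have [G [GE Gvanish]] := elim_fixpoint (curvature S f0).
pose X r x l y := curvature S f0 r x l y + D (G r x l y).
have GX r x l y : G r x l y = elim_gauge X r x l y by rewrite {1}GE.
have Gf : gauge_function p G by rewrite GE; exact: elim_gauge_function.
pose f := gauge p e f0 G.
have ef : darboux_pairings S p e f := gauge_darboux ef0 Gf.
have eqf : e_equations S p e f := gauge_e_equations eq0 Gf.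
have cE r x l y : (x < p r)%N -> (y < p l)%N ->
    curvature S f r x l y = X r x l y + G r x.+1 l y + G r x l y.+1.
  by move=> xr yl; rewrite (gauge_curvature ef0 eq0 Gf).
have Xs r x l y : (x < p r)%N -> (y < p l)%N -> X r x l y = X l y r x.
  move=> xr yl; rewrite /X (curvature_sym ef0)//.
  by have [-> _ _] := Gf.
(* The initial curvature vanishes low on the antidiagonals by weight, and the elimination preserves
   this, so the gauge does not spoil the weights of f. *)
have G0 r x l y : (x + y < dst r l)%N -> G r x l y = 0.
  apply: (Gvanish dst) => [r' l'|r' x' l' y' h]; first by rewrite /dst addnC.
  rewrite /curvature dswC (weight_w (weight_d (wf0 r' x')) (wf0 l' y')) ?oppr0//.
  by lia.
have wf r x : weight_class r x (f r x).
  apply: weightD => //; apply: weight_ecomb => l y yl.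
  have [h|h] := ltnP (x + y) (dst r l); last by apply: weightZ; exact: weightE.
  by rewrite G0// scale0r; exact: weight0.
exists f; split => //; split.
- move=> r x l y xr yl lr xy; rewrite cE// !GX /elim_gauge /elim_side.
  have -> : (x.+1 < y)%N by []; have -> : (x < y.+1)%N by lia.
  have -> : (y < x.+1)%N = false by lia.
  have -> : (y <= x.+1)%N = false by lia.
  have -> : (y.+1 <= x)%N = false by lia.
  have -> : (y == x.+1) = false by lia.
  have -> : (y.+1 < x)%N = false by lia.
  have -> : (y.+1 == x) = false by lia.
  have -> : (p r < p l)%N = false by lia.
  have E : elim_left X r l x.+1 y + elim_left X r l x y.+1 = - X r x l y.
    by apply: elim_left_step; lia.
  by case: ifP => _; rewrite /= ?mulr1n ?mulr0n !mul0r !addr0 !mul1r -addrA E addrN.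
- move=> r x l y xr yl lr xy yl1; rewrite cE// !GX /elim_gauge /elim_side lr.
  have -> : (x.+1 < y)%N = false by lia.
  have -> : (x < y.+1)%N = false by lia.
  have -> : (p r < p l)%N = false by lia.
  have -> : (y <= x.+1)%N by lia.
  have -> : (y.+1 <= x)%N by lia.
  have E : elim_left X l r y.+1 x + elim_left X l r y x.+1 = - X l y r x.
    by apply: elim_left_step; lia.
  by rewrite !mul0r !add0r !mul1r -addrA addrC [_ + elim_left _ _ _ _ _]addrC E Xs// addNr.
- move=> r x l y xr yl lr xy; rewrite /curvature dswC.
  rewrite (weight_w (weight_d (wf r x)) (wf l y)) ?oppr0//.
  by rewrite /dst; lia.
- have half : 2^-1 + 2^-1 = 1 :> K.
    by rewrite -mulr2n -[_ *+ 2]mulr_natl mulrV//; exact: ds2 S.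
  (* The curvature left at (x, x + 1) is half the difference of the two eliminations meeting at (x +
     1, x + 1), hence antisymmetric in r and l. *)
  have key r l x : p r = p l -> (x.+1 < p r)%N -> curvature S f r x l x.+1 =
      2^-1 * (elim_left X l r x.+1 x.+1 - elim_left X r l x.+1 x.+1).
    move=> rl xr; have xl : (x.+1 < p l)%N by rewrite -rl.
    rewrite cE//; last exact: ltnW.
    rewrite !GX /elim_gauge /elim_side rl !ltnn !eqxx.
    have -> : (x < x.+2)%N by lia.
    have -> : (x.+2 < x)%N = false by lia.
    have -> : (x.+2 == x) = false by lia.
    have E : elim_left X r l x.+1 x.+1 + elim_left X r l x x.+2 = - X r x l x.+1.
      by apply: elim_left_step.
    move/eqP: E; rewrite -addr_eq0 addrC => /eqP E.
    rewrite mul1r mul0r addr0.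
    have -> : X r x l x.+1 = - elim_left X r l x.+1 x.+1 - elim_left X r l x x.+2.
      by apply/eqP; rewrite -opprD -addr_eq0 E.
    move: (elim_left X r l x.+1 x.+1) (elim_left X l r x.+1 x.+1) (elim_left X r l x x.+2).
    move=> a1 a2 a3; have ha : a1 = 2^-1 * a1 + 2^-1 * a1 by rewrite -mulrDl half mul1r.
    rewrite {1}ha; move: (2^-1 : K) => h; ring.
  move=> r l x rl xr; rewrite !key//; first by rewrite -mulrN opprB.
  by rewrite -rl.
Qed.

End FrameOfTable.

(** * Uniqueness of normal frames *)

Section SymbolCalculus.
Variables (K : comUnitRingType) (V : lmodType K) (S : diff_symplectic V).
Local Notation D := (dsK S).
Local Notation d := (dsV S).
Local Notation w := (dsw S).
Local Notation "v ^[ k ]" := (iter k d v) (at level 2, format "v ^[ k ]").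
Variables (X : finType) (P : pred X) (eta : X -> V) (q : nat).
Hypothesis q0 : (0 < q)%N.
Hypothesis eta0 : forall k l x y, P k -> P l -> (x + y < (2 * q).-1)%N ->
  w (eta k)^[x] (eta l)^[y] = 0.

Inductive jet_below (n : nat) : V -> Prop :=
| jet_below0 : jet_below n 0
| jet_belowD u v : jet_below n u -> jet_below n v -> jet_below n (u + v)
| jet_belowZ a v : jet_below n v -> jet_below n (a *: v)
| jet_belowE k y : P k -> (y < n)%N -> jet_below n (eta k)^[y].

Let jet_below_sum n (b : X -> K) y : (y < n)%N ->
  jet_below n (\sum_(k | P k) b k *: (eta k)^[y]).
Proof.
move=> yn; elim/big_ind: _ => [|u v Hu Hv|k Pk]; [exact: jet_below0|exact: jet_belowD|].
by apply: jet_belowZ; exact: jet_belowE.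
Qed.

Let jet_below_d n v : jet_below n v -> jet_below n.+1 (d v).
Proof.
have sub u : jet_below n u -> jet_below n.+1 u.
  elim=> [|u1 u2 _ IH _ IH'|a u' _ IH|k y Pk yn]; [exact: jet_below0|exact: jet_belowD|exact: jet_belowZ|].
  by apply: jet_belowE => //; exact: ltnW.
elim=> [|u1 u2 _ IH _ IH'|a u' H IH|k y Pk yn].
- by rewrite raddf0; exact: jet_below0.
- by rewrite raddfD; exact: jet_belowD.
- by rewrite dsVZ; apply: jet_belowD; apply: jet_belowZ => //; exact: sub.
- by rewrite -iterS; apply: jet_belowE.
Qed.

Let jet_below_w n v l y : jet_below n v -> P l -> (n + y < 2 * q)%N -> w v (eta l)^[y] = 0.
Proof.
move=> Hv Pl ny; elim: Hv => [|u1 u2 _ IH _ IH'|a u' H IH|k y' Pk yn].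
- exact: dsw0l.
- by rewrite dswD IH IH' addr0.
- by rewrite dswZ IH mulr0.
- by apply: eta0 => //; lia.
Qed.

Let jet_below_ww m n u v : jet_below m u -> jet_below n v -> (m + n < 2 * q)%N -> w u v = 0.
Proof.
move=> Hu Hv; elim: Hv => [|u1 u2 _ IH _ IH'|a u' H IH|k y' Pk yn] mn.
- exact: dsw0r.
- by rewrite dswDr IH// IH'// addr0.
- by rewrite dswZr IH// mulr0.
- by apply: jet_below_w Hu Pk _; lia.
Qed.

(** The first two terms of the Leibniz formula; the remainder has order too low to contribute to the
    two pairings below. *)
Lemma jet_leading (b : X -> K) x : exists2 z, jet_below x.-1 z &
  (\sum_(k | P k) b k *: eta k)^[x] = \sum_(k | P k) b k *: (eta k)^[x]
    + (\sum_(k | P k) D (b k) *: (eta k)^[x.-1]) *+ x + z.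
Proof.
elim: x => [|x [z Hz IH]].
  by exists 0; [exact: jet_below0|rewrite mulr0n !addr0].
exists ((\sum_(k | P k) D (D (b k)) *: (eta k)^[x.-1]) *+ x + d z).
  apply: jet_belowD.
    case: x {z Hz IH} => [|x]; first by rewrite mulr0n; exact: jet_below0.
    by rewrite -scaler_nat; apply: jet_belowZ; exact: jet_below_sum.
  case: x Hz {IH} => [|x] Hz; last exact: jet_below_d Hz.
  suff -> : z = 0 by rewrite raddf0; exact: jet_below0.
  by elim: Hz => [//|u1 u2 _ -> _ ->|a u' _ ->|//]; rewrite ?addr0 ?scaler0.
rewrite iterS IH !raddfD/= raddfMn/= !raddf_sum/=.
have dsum (c : X -> K) y : \sum_(k | P k) d (c k *: (eta k)^[y]) =
    \sum_(k | P k) D (c k) *: (eta k)^[y] + \sum_(k | P k) c k *: (eta k)^[y.+1].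
  by rewrite -big_split; apply: eq_bigr => k _; rewrite dsVZ iterS.
rewrite !dsum.
have hx : (\sum_(k | P k) D (b k) *: (eta k)^[x.-1.+1]) *+ x =
    (\sum_(k | P k) D (b k) *: (eta k)^[x]) *+ x by case: x {z Hz IH}.
rewrite mulrnDl hx mulrS (addrC (\sum_(k | P k) D (b k) *: _)) -!addrA.
by congr (_ + (_ + _)); rewrite addrCA.
Qed.

Local Notation lin b := (\sum_(k | P k) b k *: eta k).

(** In total order 2 q - 1 the coefficients behave as constants, because every term in which one of
    them is differentiated has vanishing pairing. *)
Lemma lead_pairing (b c : X -> K) :
  w (lin b)^[q] (lin c)^[q.-1] =
  \sum_(k | P k) \sum_(l | P l) b k * c l * w (eta k)^[q] (eta l)^[q.-1].
Proof.
have [z Hz ->] := jet_leading b q; have [z' Hz' ->] := jet_leading c q.-1.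
have H1 : jet_below q ((\sum_(k | P k) D (b k) *: (eta k)^[q.-1]) *+ q + z).
  apply: jet_belowD.
    by rewrite -scaler_nat; apply: jet_belowZ; apply: jet_below_sum; lia.
  elim: Hz => [|u v _ ? _ ?|a v _ ?|k y Pk yq]; [exact: jet_below0|exact: jet_belowD|exact: jet_belowZ|].
  by apply: jet_belowE => //; lia.
have H2 : jet_below q.-1 ((\sum_(k | P k) D (c k) *: (eta k)^[q.-1.-1]) *+ q.-1 + z').
  apply: jet_belowD.
    have [->|q1] := posnP q.-1; first by rewrite mulr0n; exact: jet_below0.
    by rewrite -scaler_nat; apply: jet_belowZ; apply: jet_below_sum; lia.
  elim: Hz' => [|u v _ ? _ ?|a v _ ?|k y Pk yq]; [exact: jet_below0|exact: jet_belowD|exact: jet_belowZ|].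
  by apply: jet_belowE => //; lia.
rewrite -!addrA; move: H1 H2; move: (_ *+ q + z) (_ *+ q.-1 + z') => a1 a2 H1 H2.
rewrite dswD !dswDr (jet_below_ww H1 H2) ?addr0; last by lia.
rewrite [X in _ + X + _](_ : _ = 0) ?addr0; last first.
  rewrite dsw_suml big1// => k Pk; rewrite dswZ dswC (jet_below_w H2 Pk) ?oppr0 ?mulr0//.
  by lia.
rewrite [X in _ + X](_ : _ = 0) ?addr0; last first.
  by rewrite dsw_sumr big1// => k Pk; rewrite dswZr (jet_below_w H1 Pk) ?mulr0//; lia.
rewrite dsw_suml; apply: eq_bigr => k _; rewrite dswZ dsw_sumr mulr_sumr.
by apply: eq_bigr => l _; rewrite dswZr mulrA.
Qed.

(** In total order 2 q the second Leibniz term enters, and with it the first derivatives of the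
    coefficients, with factor q. Existence solves this relation as a differential equation;
    uniqueness reads constancy from it. *)
Lemma sublead_pairing (b c : X -> K) :
  w (lin b)^[q] (lin c)^[q] =
  \sum_(k | P k) \sum_(l | P l) (b k * c l * w (eta k)^[q] (eta l)^[q] +
    q%:R * (b k * D (c l) * w (eta k)^[q] (eta l)^[q.-1]
            + D (b k) * c l * w (eta k)^[q.-1] (eta l)^[q])).
Proof.
have [z Hz ->] := jet_leading b q; have [z' Hz' ->] := jet_leading c q.
rewrite -!scaler_nat.
have zw u : jet_below q.-1 u ->
    (forall l, P l -> w u (eta l)^[q] = 0) /\ (forall l, P l -> w u (eta l)^[q.-1] = 0).
  by move=> Hu; split=> l Pl; apply: (jet_below_w Hu Pl); lia.
have [z1 z2] := zw _ Hz; have [z'1 z'2] := zw _ Hz'.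
rewrite !dswD !dswDr !(dswZ, dswZr) (jet_below_ww Hz Hz'); last by lia.
have s0 (a : X -> K) y u : (forall l, P l -> w u (eta l)^[y] = 0) ->
    w u (\sum_(k | P k) a k *: (eta k)^[y]) = 0.
  by move=> H; rewrite dsw_sumr big1// => k Pk; rewrite dswZr H ?mulr0.
have s0' (a : X -> K) y u : (forall l, P l -> w u (eta l)^[y] = 0) ->
    w (\sum_(k | P k) a k *: (eta k)^[y]) u = 0.
  by move=> H; rewrite dswC s0 ?oppr0.
rewrite !(s0 _ _ z)// !(s0' _ _ z')// !(mulr0, addr0).
have ss (a a' : X -> K) x y : w (\sum_(k | P k) a k *: (eta k)^[x]) (\sum_(k | P k) a' k *: (eta k)^[y]) =
    \sum_(k | P k) \sum_(l | P l) a k * a' l * w (eta k)^[x] (eta l)^[y].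
  rewrite dsw_suml; apply: eq_bigr => k _; rewrite dswZ dsw_sumr mulr_sumr.
  by apply: eq_bigr => l _; rewrite dswZr mulrA.
rewrite !ss.
have -> : \sum_(k | P k) \sum_(l | P l) D (b k) * D (c l) * w (eta k)^[q.-1] (eta l)^[q.-1] = 0.
  by rewrite big1// => k Pk; rewrite big1// => l Pl; rewrite eta0 ?mulr0//; lia.
rewrite !mulr0 ?addr0 -addrA -mulrDr -big_split mulr_sumr -big_split; apply: eq_bigr => k _ /=.
rewrite -big_split mulr_sumr -big_split; apply: eq_bigr => l _ /=.
by [].
Qed.

End SymbolCalculus.

Section TableOfFrame.
Variables (K : comUnitRingType) (V : lmodType K) (S : diff_symplectic V).
Local Notation D := (dsK S).
Local Notation d := (dsV S).
Local Notation w := (dsw S).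
Local Notation "v ^[ k ]" := (iter k d v) (at level 2, format "v ^[ k ]").
Variables (T : finType) (p : T -> nat).
Hypothesis p0 : forall r, (0 < p r)%N.
Implicit Types (r l s : T) (x y z : nat) (v : V).

Record normal_frame (e f : T -> nat -> V) : Prop := NormalFrame {
  nf_darboux : darboux_pairings S p e f;
  nf_e : e_equations S p e f;
  nf_complete : complete_frame S p e f;
  nf_normal : normal_curvature S p f }.

Section OneFrame.
Variables (e f : T -> nat -> V).
Hypothesis nf : normal_frame e f.
Let ef := nf_darboux nf.
Let eqe := nf_e nf.
Let eps r := e r (p r).-1.

Lemma eps_jet r k : (k < p r)%N -> (eps r)^[k] = e r ((p r).-1 - k).
Proof.
elim: k => [|k IH] kp; first by rewrite subn0.
rewrite iterS IH ?(ltnW kp)// eqe; last by lia.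
by rewrite (_ : (p r).-1 - k = ((p r).-1 - k.+1).+1)%N//; lia.
Qed.

Lemma eps_jet_f r : (eps r)^[p r] = f r 0.
Proof.
rewrite -{1}(prednK (p0 r)) iterS eps_jet; last by have := p0 r; lia.
by rewrite subnn eqe.
Qed.

Let df := f_equation ef eqe (nf_complete nf).

Let curv_low r x l y : (x < p r)%N -> (y < p l)%N -> (p r < p l)%N ->
  (x + y + 1 < p l - p r)%N -> curvature S f r x l y = 0.
Proof.
move=> xr yl rl xy; rewrite (curvature_sym ef)//.
by have [_ _ H _] := nf_normal nf; apply: H => //; lia.
Qed.

(* The components of eps_j^(k) along the frame: the e_(i,y) component can be
   nonzero only from some time k on, and so does the f_(i,x) component. *)
Lemma jet_filtration (j : T) k :
  (forall i y, (y < p i)%N ->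
    ((p j <= p i)%N -> (k.+1 + y < p j)%N -> w (eps j)^[k] (f i y) = 0) /\
    ((p i < p j)%N -> (k + p i + y < 2 * p j)%N -> w (eps j)^[k] (f i y) = 0)) /\
  (forall i x, (x < p i)%N ->
    ((p j <= p i)%N -> (k < p j + x)%N -> w (eps j)^[k] (e i x) = 0) /\
    ((p i < p j)%N -> (k + p i < 2 * p j + x.+1)%N -> w (eps j)^[k] (e i x) = 0)).
Proof.
have pj := p0 j.
elim: k => [|k [IHf IHe]].
  split=> i y yi; have pj' : ((p j).-1 < p j)%N by lia.
    have [_ _ fe] := ef yi pj'; split=> h1 h2; rewrite /= dswC fe.
      by case: eqP => [ij|]; rewrite ?oppr0//; case: eqP => // yj; rewrite ?oppr0//; lia.
    by case: eqP => [ij|]; rewrite ?oppr0//; move: h1; rewrite ij ltnn.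
  by have [ee _ _] := ef pj' yi; split.
split=> i y yi; rewrite iterS.
  have H : w (eps j)^[k] (f i y) = 0 ->
      ((y.+1 < p i)%N -> w (eps j)^[k] (f i y.+1) = 0) ->
      (forall l z, (z < p l)%N -> curvature S f i y l z = 0 \/ w (eps j)^[k] (e l z) = 0) ->
      w (d (eps j)^[k]) (f i y) = 0.
    move=> h1 h2 h3; rewrite dsw_shift h1 raddf0 sub0r df// dswBr.
    rewrite [w _ (ecomb _ _ _)]dswC w_ecombl big1 ?oppr0 ?add0r.
      by case: ifP => [/h2->|_]; rewrite ?dsw0r ?oppr0.
    move=> l _; rewrite big1// => z _.
    by have [->|h] := h3 l z (ltn_ord z); rewrite ?mul0r// dswC h oppr0 mulr0.
  split=> h1 h2; apply: H.
  - by have [H _] := IHf i y yi; apply: H => //; lia.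
  - by move=> yi'; have [H _] := IHf i _ yi'; apply: H => //; lia.
  - move=> l z zl; right; have [H1 H2] := IHe l z zl.
    by have [jl|jl] := leqP (p j) (p l); [apply: H1|apply: H2] => //; lia.
  - by have [_ H] := IHf i y yi; apply: H => //; lia.
  - by move=> yi'; have [_ H] := IHf i _ yi'; apply: H => //; lia.
  - move=> l z zl; have [H1 H2] := IHe l z zl.
    have [jl|jl] := leqP (p j) (p l).
      have [kz|kz] := ltnP k (p j + z); first by right; apply: H1.
      by left; apply: curv_low => //; lia.
    have [kz|kz] := ltnP (k + p l) (2 * p j + z.+1); first by right; apply: H2.
    by left; apply: curv_low => //; lia.
have H : w (eps j)^[k] (e i y) = 0 ->
    w (eps j)^[k] (if y is y'.+1 then e i y' else f i 0) = 0 ->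
    w (d (eps j)^[k]) (e i y) = 0.
  by move=> h1 h2; rewrite dsw_shift h1 raddf0 sub0r eqe// h2 oppr0.
split=> h1 h2; apply: H.
- by have [H _] := IHe i y yi; apply: H => //; lia.
- case: y yi h2 => [|y] yi h2.
    by have [H _] := IHf i 0%N yi; apply: H => //; lia.
  by have [H _] := IHe i y (ltnW yi); apply: H => //; lia.
- by have [_ H] := IHe i y yi; apply: H => //; lia.
- case: y yi h2 => [|y] yi h2.
    by have [_ H] := IHf i 0%N yi; apply: H => //; lia.
  by have [_ H] := IHe i y (ltnW yi); apply: H => //; lia.
Qed.

(** For different lengths, [jet_filtration] at the last column of the shorter row gives vanishing up
    to order 2 p of the longer one. For equal lengths the Darboux relations give the three inputs of
    [pairing_table_eq]. *)
Lemma normal_table r l : pairing_table S p eps r l.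
Proof.
have lt r' l' : (p r' < p l')%N -> pairing_table S p eps r' l' /\ pairing_table S p eps l' r'.
  move=> rl; apply: pairing_table_lt => // k kl.
  have pr : ((p r').-1 < p r')%N by have := p0 r'; lia.
  have [_ H] := jet_filtration l' k; have [_ {}H] := H _ _ pr.
  by rewrite dswC H ?oppr0//; lia.
have [rl|rl|rl] := ltngtP (p r) (p l); [by have [] := lt _ _ rl|by have [] := lt _ _ rl|].
apply: pairing_table_eq => //.
- by move=> x k xr kr; rewrite !eps_jet -?rl//; have [] := @ef r ((p r).-1 - x)%N l ((p l).-1 - k)%N;
    rewrite ?rl//; lia.
- rewrite eps_jet_f eps_jet rl; last by have := p0 l; lia.
  by rewrite subnn; have [_ _ ->] := ef (p0 r) (p0 l); rewrite eqxx andbT.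
- by rewrite eps_jet_f rl eps_jet_f; have [] := ef (p0 r) (p0 l).
Qed.

Lemma e_eframe r x : (x < p r)%N -> e r x = eframe S p eps r x.
Proof. by move=> xr; rewrite /eframe eps_jet; [congr e; lia|lia]. Qed.

End OneFrame.

Definition const_orthogonal (u : T -> T -> K) : Prop :=
  [/\ forall r l, p r != p l -> u r l = 0,
      forall r s, \sum_l u r l * u s l = (r == s)%:R & forall r l, D (u r l) = 0].

Lemma orthogonal_tr (u : T -> T -> K) :
  (forall r s, \sum_l u r l * u s l = (r == s)%:R) ->
  forall r s, \sum_l u l r * u l s = (r == s)%:R.
Proof.
move=> H r s.
pose U : 'M[K]_#|T| := \matrix_(i, j) u (enum_val i) (enum_val j).
have reindex_T (F : T -> K) : \sum_l F l = \sum_(i < #|T|) F (enum_val i).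
  exact: (reindex _ (onW_bij _ (@enum_val_bij T))).
have UU : U *m U^T = 1%:M.
  apply/matrixP => i j; rewrite !mxE -(inj_eq enum_val_inj) -H reindex_T.
  by apply: eq_bigr => k _; rewrite !mxE.
have := congr1 (fun M : 'M[K]_#|T| => M (enum_rank r) (enum_rank s)) (mulmx1C UU).
rewrite !mxE -(inj_eq enum_val_inj) !enum_rankK => <-; rewrite reindex_T.
by apply: eq_bigr => k _; rewrite !mxE !enum_rankK.
Qed.

Lemma iter_const_comb (u : T -> K) (v : T -> V) k : (forall l, D (u l) = 0) ->
  (\sum_l u l *: v l)^[k] = \sum_l u l *: (v l)^[k].
Proof.
move=> Du; elim: k => [//|k IH]; rewrite iterS IH raddf_sum/=.
by apply: eq_bigr => l _; rewrite dsVZ Du scale0r add0r.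
Qed.

Section TwoFrames.
Variables (e f e' f' : T -> nat -> V).
Hypotheses (nf : normal_frame e f) (nf' : normal_frame e' f').
Hypothesis cross : forall r x l y, (x < p r)%N -> (y < p l)%N -> w (e' r x) (e l y) = 0.
Let ef := nf_darboux nf.
Let eqe := nf_e nf.
Let df := f_equation ef eqe (nf_complete nf).
Let eps r := e r (p r).-1.
Let eps' r := e' r (p r).-1.
Let tab : forall r l, pairing_table S p eps r l := normal_table nf.
Let tab' : forall r l, pairing_table S p eps' r l := normal_table nf'.

Let cross_jet r (s : nat) l y : (s < p r)%N -> (y < p l)%N -> w (eps' r)^[s] (e l y) = 0.
Proof. by move=> sr yl; rewrite (eps_jet nf')//; apply: cross => //; lia. Qed.

(** Since e' is orthogonal to e, derivatives can be exchanged between the entries without cost;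
    modulo e, [f l y.+1] is minus the derivative of [f l y], so each column consumes one of the
    first p r jets of eps' r. *)
Let cross_f r (s : nat) l y : (s + y.+1 < p r)%N -> (y < p l)%N -> w (eps' r)^[s] (f l y) = 0.
Proof.
have sh v v1 : w v v1 = 0 -> w (d v) v1 = 0 -> w v (d v1) = 0.
  by move=> h1 h2; have := dswd S v v1; rewrite h1 raddf0 h2 add0r.
elim: y s => [|y IH] s sr yl.
  by rewrite -(eqe yl) sh// ?cross_jet// -?iterS ?cross_jet//; lia.
have yl' := ltnW yl.
have := df yl'; rewrite yl => /(congr1 (w (eps' r)^[s])).
rewrite dswBr sh; [|by apply: IH => //; lia|by rewrite -iterS; apply: IH => //; lia].
rewrite [w _ (ecomb _ _ _)]dswC ecomb_vanish ?oppr0 ?sub0r => [/esym/eqP|l' z zl].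
  by rewrite oppr_eq0 => /eqP.
by rewrite dswC cross_jet ?oppr0//; lia.
Qed.

Let expand r : exists c, eps' r = ecomb p e c /\
  forall l y, (y < p l)%N -> (y < (p r).-1)%N -> c l y = 0.
Proof.
exists (fun l y => - w (eps' r) (f l y)); split; last first.
  by move=> l y yl yr; rewrite (cross_f (s := 0)) ?oppr0//; lia.
apply/eqP; rewrite -subr_eq0; apply/eqP; apply: (nf_complete nf) => l y yl.
rewrite !dswBl (ecomb_e ef)// (ecomb_f ef)// opprK subrr subr0; split => //.
by apply: (cross_jet (s := 0)) => //; exact: p0.
Qed.

Section NewRow.
Variables (u : T -> T -> K) (r : T).
Hypothesis uo : const_orthogonal u.
Hypothesis Hu : forall s, (p r < p s)%N -> eps' s = \sum_l u s l *: eps l.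

(** The longer eps l are recovered from the eps' s by the transpose of u, so the table of the second
    frame applies. *)
Let higher l k : (p r < p l)%N -> (k < 2 * p l)%N -> w (eps' r) (eps l)^[k] = 0.
Proof.
move=> rl kl; have [ub uu uc] := uo.
have -> : eps l = \sum_s u s l *: eps' s.
  transitivity (\sum_s u s l *: \sum_m u s m *: eps m).
    under eq_bigr do rewrite scaler_sumr.
    rewrite exchange_big/= (bigD1 l)//= [X in _ + X]big1 ?addr0.
      rewrite -[LHS]scale1r; under eq_bigr do rewrite scalerA.
      by rewrite -scaler_suml (orthogonal_tr uu) eqxx.
    move=> m ml; under eq_bigr do rewrite scalerA.
    by rewrite -scaler_suml (orthogonal_tr uu) eq_sym (negPf ml) scale0r.
  apply: eq_bigr => s _; have [e1|ne] := eqVneq (p s) (p l); first by rewrite Hu// e1.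
  by rewrite ub// !scale0r.
rewrite iter_const_comb// dsw_sumr big1// => s _; rewrite dswZr.
have [e1|ne] := eqVneq (p s) (p l); last by rewrite ub// mul0r.
have [H _ _] := tab' r s; rewrite (H _ 0%N k) ?mulr0//; lia.
Qed.

(** By [expand], eps' r involves only columns y >= p r - 1. This leaves the special vectors of rows
    of the same length, and entries of longer rows, which are killed by the orthogonality
    [higher]. *)
Lemma new_row : exists c : T -> K,
  (forall l, p r != p l -> c l = 0) /\ eps' r = \sum_(l | p l == p r) c l *: eps l.
Proof.
have [c [cE c0]] := expand r.
(* Pairing with the derivative of eps l of order p l + y isolates the coefficient of [e l y]:
   earlier columns vanish by induction and later ones have too low a total order. *)
have kill y l : (p r < p l)%N -> (y < p l)%N -> c l y = 0.
  elim/ltn_ind: y l => y IH l rl yl.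
  have [yr|yr] := ltnP y (p r).-1; first exact: c0.
  have /esym : w (eps' r) (eps l)^[p l + y] = 0 by apply: higher => //; lia.
  rewrite {1}cE w_ecombl.
  rewrite (_ : \sum_l' _ = (-1) ^+ (p l + ((p l).-1 - y)) * c l y) => [/esym e1|].
    by apply: (can_inj (signrMK (p l + ((p l).-1 - y)))); rewrite e1 mulr0.
  transitivity (\sum_m \sum_(z < p m) ((-1) ^+ (p l + ((p l).-1 - y)) * c m z) *
      ((m == l) && (z == y :> nat))%:R); last first.
    by rewrite (@sum_delta _ _ p (fun m z => (-1) ^+ (p l + ((p l).-1 - y)) * c m z)
                  (fun m z => ((m == l) && (z == y))%:R) l y).
  apply: eq_bigr => m _; apply: eq_bigr => -[z zm] _ /=.
  have [zr|zr] := ltnP z (p r).-1; first by rewrite c0// mulr0 !mul0r.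
  have [rm|rm] := ltnP (p r) (p m); last first.
    have e1 : p m = p r by have := p0 r; lia.
    rewrite (_ : w _ _ = 0).
      by rewrite mulr0 (_ : (m == l) = false) ?mulr0//; apply/eqP => ml; move: rl; rewrite -ml e1 ltnn.
    rewrite (_ : z = (p m).-1); last by lia.
    have [H _ _] := tab m l; apply: (H _ 0%N); first by lia.
    by lia.
  have [zy|yz] := ltnP z y; first by rewrite IH// mulr0 !mul0r.
  rewrite (e_eframe nf)// /eframe; have [H1 H2 H3] := tab m l.
  have [e1|ne] := eqVneq (p m) (p l); last first.
    rewrite H1 ?mulr0//; last by lia.
    by rewrite (_ : (m == l) = false) ?mulr0//; apply/eqP => ml; rewrite ml eqxx in ne.
  have [zy|zy] := eqVneq z y; last by rewrite andbF H2 ?mulr0//; lia.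
  rewrite H3 ?andbT; [|by []|by lia].
  by rewrite zy e1 mulrCA mulrA.
exists (fun l => if p l == p r then c l (p r).-1 else 0); split.
  by move=> l; rewrite eq_sym => /negPf ->.
rewrite cE /ecomb [RHS]big_mkcond; apply: eq_bigr => l _.
have [lr|lr|lr] := ltngtP (p l) (p r).
- by rewrite big1// => y _; rewrite c0 ?scale0r//; have := ltn_ord y; lia.
- by rewrite big1// => y _; rewrite kill ?scale0r//.
have pl : ((p r).-1 < p l)%N by have := p0 r; lia.
rewrite (bigD1 (Ordinal pl))//= big1 ?addr0; first by rewrite /eps -lr.
move=> y; rewrite -val_eqE/= => yr; rewrite c0 ?scale0r//.
by have := ltn_ord y; move: yr; lia.
Qed.

End NewRow.

(** The pairings of order 2 p - 1 of the second frame give the orthogonality of the coefficient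
    rows, and those of order 2 p the relation a . b' = a' . b. *)
Let rows_pairing (r s : T) (a b : T -> K) : p r = p s ->
  eps' r = \sum_(l | p l == p r) a l *: eps l ->
  eps' s = \sum_(l | p l == p r) b l *: eps l ->
  \sum_(l | p l == p r) a l * b l = (r == s)%:R /\
  \sum_(l | p l == p r) a l * D (b l) = \sum_(l | p l == p r) D (a l) * b l.
Proof.
move=> rs ra sb.
have eta0 k l x y : p k == p r -> p l == p r -> (x + y < (2 * p r).-1)%N ->
    w (eps k)^[x] (eps l)^[y] = 0.
  move=> /eqP kr /eqP lr xy; have [_ H _] := tab k l.
  by apply: H; rewrite ?kr ?lr//; lia.
have pq k l : p k == p r -> p l == p r -> w (eps k)^[p r] (eps l)^[(p r).-1] = (k == l)%:R.
  move=> /eqP kr /eqP lr; have [_ _ H] := tab k l; rewrite H ?kr ?lr//.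
    by rewrite addnn -signr_odd odd_double mul1r.
  by have := p0 r; lia.
have [_ H2' H3'] := tab' r s.
have dl (g : T -> T -> K) : \sum_(k | p k == p r) \sum_(l | p l == p r) g k l * (k == l)%:R =
    \sum_(k | p k == p r) g k k.
  apply: eq_bigr => k kr; rewrite (bigD1 k)//= eqxx mulr1 big1 ?addr0// => l /andP[_ lk].
  by rewrite eq_sym (negPf lk) mulr0.
split.
  rewrite -(dl (fun k l => a k * b l)); have := H3' rs (p r) (p r).-1.
  rewrite ra sb (lead_pairing (p0 r) eta0) => H.
  rewrite addnn -signr_odd odd_double mul1r in H; rewrite -H; last by have := p0 r; lia.
  by apply: eq_bigr => k kr; apply: eq_bigr => l lr; rewrite pq.
have := H2' rs (p r) (p r); rewrite ra sb (sublead_pairing (p0 r) eta0) => H.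
have {}H : (p r)%:R * (\sum_(k | p k == p r) a k * D (b k) - \sum_(k | p k == p r) D (a k) * b k) = 0.
  apply: etrans (H _ _); [|by lia|by lia].
  rewrite -sumrB -(dl (fun k l => a k * D (b l) - D (a k) * b l)) mulr_sumr.
  apply: eq_bigr => k kr; rewrite mulr_sumr; apply: eq_bigr => l lr.
  rewrite pq// [w (eps k)^[(p r).-1] _]dswC pq// (eq_sym l k).
  have -> : w (eps k)^[p r] (eps l)^[p r] = 0.
    by move/eqP: kr => kr; move/eqP: lr => lr; have [_ T2 _] := tab k l; apply: T2; rewrite ?kr ?lr//; lia.
  by rewrite mulr0 add0r mulrN -mulrBl.
apply/eqP; rewrite -subr_eq0; apply/eqP.
have pu : (p r)%:R \is a @GRing.unit K by rewrite -(prednK (p0 r)); exact: (dsN S).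
by apply: (can_inj (mulKr pu)); rewrite H mulr0.
Qed.

Lemma normal_rows : exists u, const_orthogonal u /\ forall r, eps' r = \sum_l u r l *: eps l.
Proof.
suff H n : exists u, const_orthogonal u /\
    forall r, (\max_s p s < p r + n)%N -> eps' r = \sum_l u r l *: eps l.
  have [u [uo Hu]] := H (\max_s p s).+1; exists u; split=> // r.
  by apply: Hu; lia.
elim: n => [|n [u [uo Hu]]].
  exists (fun r l => (r == l)%:R); split; last first.
    by move=> r; rewrite addn0 ltnNge (leq_bigmax r).
  split.
  - by move=> r l rl; rewrite (_ : (r == l) = false)//; apply/eqP => e1; rewrite e1 eqxx in rl.
  - move=> r s; rewrite (bigD1 r)//= eqxx mul1r big1 ?addr0 1?eq_sym// => l lr.
    by rewrite eq_sym (negPf lr) mul0r.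
  - by move=> r l; exact: dsK_nat.
pose N (r : T) := (p r + n)%N == \max_s p s.
have /choice[c Hc] (r : T) : exists c : T -> K, N r ->
    (forall l, p r != p l -> c l = 0) /\ eps' r = \sum_(l | p l == p r) c l *: eps l.
  have [Nr|] := boolP (N r); last by exists (fun=> 0).
  have [|c Hc] := @new_row u r uo; last by exists c.
  by move=> s rs; apply: Hu; move: Nr => /eqP <-; lia.
pose u' r := if N r then c r else u r.
have [ub uu uc] := uo.
have u'b r l : p r != p l -> u' r l = 0.
  by rewrite /u'; case: ifP => [Nr|_]; [have [H _] := Hc r Nr; exact: H|exact: ub].
have NN r s : p r = p s -> N r = N s by rewrite /N => ->.
have bsum (F : T -> K) r : (forall l, p l != p r -> F l = 0) -> \sum_l F l = \sum_(l | p l == p r) F l.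
  by move=> F0; rewrite [RHS]big_mkcond; apply: eq_bigr => l _; case: ifPn => // /F0.
have u'u r s : \sum_l u' r l * u' s l = (r == s)%:R.
  have [rs|rs] := eqVneq (p r) (p s); last first.
    rewrite (_ : (r == s) = false); last by apply/eqP => e1; rewrite e1 eqxx in rs.
    rewrite big1// => l _; have [rl|rl] := eqVneq (p r) (p l); last by rewrite u'b ?mul0r.
    by rewrite [u' s l]u'b ?mulr0// -rl eq_sym.
  have [Nr|Nr] := boolP (N r); last first.
    by rewrite /u' -(NN r s rs) (negPf Nr) uu.
  have Ns : N s by rewrite -(NN r s rs).
  rewrite (bsum _ r) => [|l lr]; last by rewrite u'b ?mul0r// eq_sym.
  rewrite /u' Nr Ns; have [_ h1] := Hc r Nr; have [_ h2] := Hc s Ns.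
  by rewrite -rs in h2; have [] := rows_pairing rs h1 h2.
have u'd r l : D (u' r l) = 0.
  have [Nr|Nr] := boolP (N r); last by rewrite /u' (negPf Nr).
  have [rl|rl] := eqVneq (p r) (p l); last by rewrite u'b ?raddf0.
  (* The relation a . b' = a' . b and the derivative of the constant a . b give 2 a . b' = 0.
     Orthogonality of u' then turns these vanishing products into D u' = 0. *)
  have key s : \sum_m u' s m * D (u' r m) = 0.
    have [rs|rs] := eqVneq (p r) (p s); last first.
      rewrite big1// => m _; have [rm|rm] := eqVneq (p r) (p m).
        by rewrite u'b ?mul0r// -rm eq_sym.
      by rewrite [u' r m]u'b ?raddf0 ?mulr0.
    have Ns : N s by rewrite -(NN r s rs).
    have h0 : \sum_(m | p m == p r) (u' s m * D (u' r m) + D (u' s m) * u' r m) = 0.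
      have := congr1 D (u'u s r); rewrite dsK_nat raddf_sum/= (bsum _ r) => [h|m mr].
        by apply: etrans h; apply: eq_bigr => m _; rewrite dsKM addrC.
      by rewrite [u' r m]u'b ?mulr0 ?raddf0// eq_sym.
    rewrite (bsum _ r) => [|m mr]; last by rewrite [u' r m]u'b ?raddf0 ?mulr0// eq_sym.
    have [_ h1] := Hc r Nr; have [_ h2] := Hc s Ns.
    have sr := esym rs; rewrite rs in h1.
    have [_ h3] := rows_pairing sr h2 h1.
    rewrite big_split/= in h0; apply: (eq_opp_0 S).
    move: h3; rewrite -rs /u' Nr Ns => h3; rewrite /u' Nr Ns in h0; rewrite -h3 in h0.
    by apply/eqP; rewrite -addr_eq0 h0.
  have := congr1 (fun F : T -> K => \sum_s u' s l * F s) (funext key).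
  under [RHS]eq_bigr do rewrite mulr0.
  rewrite big1_eq; under eq_bigr do rewrite mulr_sumr.
  rewrite exchange_big/= (bigD1 l)//= [X in _ + X]big1 => [|m ml]; last first.
    by under eq_bigr do rewrite mulrA; rewrite -mulr_suml (orthogonal_tr u'u) eq_sym (negPf ml) mul0r.
  by under eq_bigr do rewrite mulrA; rewrite -mulr_suml (orthogonal_tr u'u) eqxx mul1r addr0.
exists u'; split=> // r rn.
have [Nr|Nr] := boolP (N r); last first.
  by rewrite /u' (negPf Nr); apply: Hu; move: Nr; rewrite /N; lia.
have [_ ->] := Hc r Nr; rewrite [LHS]big_mkcond; apply: eq_bigr => l _.
by rewrite /u' Nr; case: ifPn => // lr; have [-> //] := Hc r Nr; rewrite ?scale0r// eq_sym.
Qed.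

End TwoFrames.
End TableOfFrame.

(** * Rigidity of the gauge and uniqueness *)

Section Uniqueness.
Variables (K : comUnitRingType) (V : lmodType K) (S : diff_symplectic V).
Local Notation D := (dsK S).
Local Notation d := (dsV S).
Local Notation w := (dsw S).
Variables (T : finType) (p : T -> nat).
Hypothesis p0 : forall r, (0 < p r)%N.
Implicit Types (r l s : T) (x y z : nat) (v : V).

Section Rigidity.
Variables (e f : T -> nat -> V) (G : T -> nat -> T -> nat -> K).
Hypotheses (ef : darboux_pairings S p e f) (eqe : e_equations S p e f).
Hypotheses (Gf : gauge_function p G).
Hypotheses (nf : normal_curvature S p f) (nG : normal_curvature S p (gauge p e f G)).

Let Q r x l y := D (G r x l y) + G r x.+1 l y + G r x l y.+1.

Let QE r x l y : (x < p r)%N -> (y < p l)%N ->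
  Q r x l y = curvature S (gauge p e f G) r x l y - curvature S f r x l y.
Proof.
by move=> xr yl; rewrite (gauge_curvature ef eqe Gf)// /Q; ring.
Qed.

Let Gs r x l y : G r x l y = G l y r x. Proof. by have [] := Gf. Qed.
Let G0 r l y : G r 0%N l y = 0. Proof. by have [] := Gf. Qed.
Let Gout r x l y : (p r <= x)%N || (p l <= y)%N -> G r x l y = 0.
Proof. by have [_ _ H] := Gf; case/orP => h; [exact: H|rewrite Gs; exact: H]. Qed.

(** Induction on x + y. The derivative of G belongs to the previous antidiagonal, so where both
    curvatures vanish G at (x + 1, y) is minus G at (x, y + 1); zeros then propagate from both ends.
    For equal lengths the middle entry is symmetric as a gauge and antisymmetric by the last clause
    of normality. *)
Lemma gauge_rigid r x l y : G r x l y = 0.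
Proof.
have [n] := ubnP (x + y)%N; elim: n => [//|n IH] in r x l y *.
move=> xyn; have [xy|xy] := ltnP (x + y)%N n; first exact: IH.
have {xyn xy} xy : (x + y = n)%N by lia.
have QG s a t b : (a + b).+1 = n -> (a < p s)%N -> (b < p t)%N -> Q s a t b = 0 ->
    G s a.+1 t b = - G s a t b.+1.
  move=> ab sa tb; rewrite /Q IH ?raddf0 ?add0r; last by lia.
  by move/eqP; rewrite addr_eq0 => /eqP.
have c1 s a t b : (a + b = n)%N -> (p t <= p s)%N -> (a < b)%N -> G s a t b = 0.
  elim: a b => [|a IHa] b ab ts lt; first exact: G0.
  have [sb|sb] := leqP (p t) b; first by apply: Gout; rewrite sb orbT.
  rewrite QG; [|by lia|by lia|by []|].
    by rewrite IHa ?oppr0//; lia.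
  rewrite QE//; last by lia.
  have [H _ _ _] := nf; have [H' _ _ _] := nG.
  by rewrite H ?H' ?subr0//; lia.
have c2 s b t a : (a + b = n)%N -> (p t < p s)%N -> (b <= a)%N -> G s a t b = 0.
  elim: b a => [|b IHb] a ab ts lt; first by rewrite Gs G0.
  have [/Gout //|] := boolP ((p s <= a)%N || (p t <= b.+1)%N); rewrite negb_or -!ltnNge => /andP[as_ bt].
  have e1 : G s a.+1 t b = - G s a t b.+1.
    apply: QG => //; try lia.
    rewrite QE//; last by lia.
    have [_ H _ _] := nf; have [_ H' _ _] := nG.
    by rewrite H ?H' ?subr0//; lia.
  by rewrite -[LHS]opprK -e1 IHb ?oppr0//; lia.
have [rl|rl|rl] := ltngtP (p r) (p l).
- rewrite Gs; have [yx|xy'] := ltnP y x; first by apply: c1 => //; lia.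
  by apply: c2 => //; lia.
- have [xy'|yx] := ltnP x y; first by apply: c1 => //; lia.
  by apply: c2 => //; lia.
have [xy'|xy'|xy'] := ltngtP x y.
- by apply: c1 => //; lia.
- by rewrite Gs; apply: c1 => //; lia.
case: x xy xy' => [|x] xy xy'; first exact: G0.
rewrite -xy'; have [|xr] := leqP (p r) x.+1; first by move=> h; apply: Gout; rewrite h.
have [_ _ _ H] := nf; have [_ _ _ H'] := nG.
have Qa : Q r x l x.+1 = - Q l x r x.+1.
  rewrite !QE -?rl//; try lia.
  by rewrite H// H'// opprB opprK addrC.
have D0 s t : G s x t x.+1 = 0 by apply: IH; lia.
have C0 s t : p s = p t -> G s x t x.+2 = 0 by move=> st; apply: c1 => //; lia.
move: Qa; rewrite /Q !D0 !raddf0 !add0r !C0// !addr0.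
by rewrite (Gs l) => /(eq_opp_0 S).
Qed.

End Rigidity.

Definition rotate (u : T -> T -> K) (g : T -> nat -> V) r x : V := \sum_l u r l *: g l x.

Section Rotation.
Variable u : T -> T -> K.
Hypothesis uo : const_orthogonal S p u.

Lemma rotate_w g h r x s y (c : T -> T -> K) :
  (forall m n, p m = p r -> p n = p s -> w (g m x) (h n y) = c m n) ->
  w (rotate u g r x) (rotate u h s y) = \sum_m \sum_n u r m * u s n * c m n.
Proof.
move=> H; have [ub _ _] := uo; rewrite /rotate dsw_suml; apply: eq_bigr => m _.
rewrite dswZ dsw_sumr mulr_sumr; apply: eq_bigr => n _; rewrite dswZr mulrA.
have [rm|rm] := eqVneq (p r) (p m); last by rewrite ub// !mul0r.
have [sn|sn] := eqVneq (p s) (p n); last by rewrite (ub s)// mulr0 !mul0r.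
by rewrite H.
Qed.

Lemma rotate_w_delta g h r x s y c :
  (forall m n, p m = p r -> p n = p s -> w (g m x) (h n y) = c * (m == n)%:R) ->
  w (rotate u g r x) (rotate u h s y) = c * (r == s)%:R.
Proof.
move=> H; rewrite (rotate_w (c := fun m n => c * (m == n)%:R))//.
have [_ <- _] := uo; rewrite mulr_sumr; apply: eq_bigr => m _.
rewrite (bigD1 m)//= eqxx mulr1 big1 ?addr0 1?mulrC// => n nm.
by rewrite eq_sym (negPf nm) !mulr0.
Qed.

Lemma rotate_d g r x : d (rotate u g r x) = \sum_l u r l *: d (g l x).
Proof.
have [_ _ uc] := uo; rewrite /rotate raddf_sum; apply: eq_bigr => l _ /=.
by rewrite dsVZ uc scale0r add0r.
Qed.

Lemma rotate_normal e f : normal_frame S p e f ->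
  normal_frame S p (rotate u e) (rotate u f).
Proof.
case=> ef eqe cf nf; have [ub uu uc] := uo; split.
- move=> r x l y xr yl; split.
  + rewrite (rotate_w_delta (c := 0)) ?mul0r// => m n mr nl; rewrite mul0r.
    by have [] := @ef m x n y; rewrite ?mr ?nl.
  + rewrite (rotate_w_delta (c := 0)) ?mul0r// => m n mr nl; rewrite mul0r.
    by have [] := @ef m x n y; rewrite ?mr ?nl.
  + transitivity ((x == y)%:R * (r == l)%:R : K); last by rewrite mulrC -natrM mulnb.
    apply: rotate_w_delta => m n mr nl.
    have [||_ _ ->] := @ef m x n y; rewrite ?mr ?nl//.
    by rewrite mulrC -natrM mulnb.
- move=> r x xr; rewrite rotate_d.
  case: x xr => [|x] xr; apply: eq_bigr => l _.
    have [rl|rl] := eqVneq (p r) (p l); last by rewrite ub// !scale0r.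
    by rewrite eqe// -rl.
  have [rl|rl] := eqVneq (p r) (p l); last by rewrite ub// !scale0r.
  by rewrite eqe// -rl.
- move=> v H; apply: cf => l x xl.
  (* The rotation is inverted by the transposed matrix, which stays within rows of the same
     length. *)
  have back g : (forall r, p r = p l -> w v (rotate u g r x) = 0) -> w v (g l x) = 0.
    move=> Hg; transitivity (\sum_r u r l * w v (rotate u g r x)); last first.
      rewrite big1// => r _; have [rl|rl] := eqVneq (p r) (p l); first by rewrite Hg// mulr0.
      by rewrite ub// mul0r.
    under eq_bigr do rewrite /rotate dsw_sumr mulr_sumr.
    rewrite exchange_big/= (bigD1 l)//= [X in _ + X]big1 ?addr0 => [|m ml].
      under eq_bigr do rewrite dswZr mulrA.
      by rewrite -mulr_suml (orthogonal_tr uu) eqxx mul1r.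
    under eq_bigr do rewrite dswZr mulrA.
    by rewrite -mulr_suml (orthogonal_tr uu) eq_sym (negPf ml) mul0r.
  by split; apply: back => r rl; have [] := H r x; rewrite ?rl.
have cE r x l y : curvature S (rotate u f) r x l y =
    \sum_m \sum_n u r m * u l n * curvature S f m x n y.
  rewrite /curvature rotate_d exchange_big/= dsw_suml; apply: eq_bigr => n _.
  rewrite dswZ dsw_sumr mulr_sumr; apply: eq_bigr => m _; rewrite dswZr.
  by rewrite mulrA (mulrC (u l n)).
have c0 r x l y : (forall m n, p m = p r -> p n = p l -> curvature S f m x n y = 0) ->
    curvature S (rotate u f) r x l y = 0.
  move=> H; rewrite cE big1// => m _; rewrite big1// => n _.
  have [rm|rm] := eqVneq (p r) (p m); last by rewrite ub// !mul0r.
  have [ln|ln] := eqVneq (p l) (p n); last by rewrite (ub l)// mulr0 mul0r.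
  by rewrite H ?mulr0.
have [H1 H2 H3 H4] := nf; split.
- by move=> r x l y xr yl lr xy; apply: c0 => m n mr nl; apply: H1; rewrite ?mr ?nl.
- by move=> r x l y xr yl lr xy yl'; apply: c0 => m n mr nl; apply: H2; rewrite ?mr ?nl.
- by move=> r x l y xr yl lr xy; apply: c0 => m n mr nl; apply: H3; rewrite ?mr ?nl.
move=> r l x rl xr; rewrite !cE exchange_big/= -sumrN; apply: eq_bigr => n _.
rewrite -sumrN; apply: eq_bigr => m _.
have [rm|rm] := eqVneq (p r) (p m); last by rewrite ub// mulr0 !mul0r oppr0.
have [ln|ln] := eqVneq (p l) (p n); last by rewrite (ub l)// mulr0 !mul0r oppr0.
have mn : p m = p n by rewrite -rm -ln.
have xm : (x.+1 < p m)%N by rewrite -rm.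
by rewrite (H4 m n x mn xm) mulrN (mulrC (u r m)).
Qed.

End Rotation.

Theorem normal_frame_unique e f e' f' :
  normal_frame S p e f -> normal_frame S p e' f' ->
  (forall r x l y, (x < p r)%N -> (y < p l)%N -> w (e' r x) (e l y) = 0) ->
  exists2 u, const_orthogonal S p u & forall r x, (x < p r)%N ->
    e' r x = rotate u e r x /\ f' r x = rotate u f r x.
Proof.
move=> nf nf' cross; have [u [uo Hu]] := normal_rows p0 nf nf' cross.
have [ub uu uc] := uo.
have nu := rotate_normal uo nf.
set eU := rotate u e in nu; set fU := rotate u f in nu.
have ee r x : (x < p r)%N -> e' r x = eU r x.
  move=> xr; rewrite (e_eframe nf')// /eframe Hu iter_const_comb//.
  apply: eq_bigr => l _; have [rl|rl] := eqVneq (p r) (p l); last by rewrite ub// !scale0r.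
  by rewrite [e l x](e_eframe nf) -?rl// /eframe rl.
have ff0 r : f' r 0%N = fU r 0%N.
  rewrite -(eps_jet_f p0 nf') Hu iter_const_comb//.
  apply: eq_bigr => l _; have [rl|rl] := eqVneq (p r) (p l); last by rewrite ub// !scale0r.
  by rewrite rl (eps_jet_f p0 nf).
have [ef' eqe' cf' nc'] := nf'; have [efU eqeU cfU ncU] := nu.
have ef1 : darboux_pairings S p e' fU.
  by move=> r x l y xr yl; rewrite !ee//; exact: efU.
have eqe1 : e_equations S p e' fU.
  by move=> r x xr; rewrite eqe'//; case: x xr => // xr; exact: ff0.
(* The rotated e is e', so the rotated f and f' are both dual to e' and differ by a combination of
   e'; pairing the two gives its coefficients. *)
pose G r x l y := if ((x < p r) && (y < p l))%N then w (fU r x) (f' l y) else 0.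
have fE r x : (x < p r)%N -> f' r x = gauge p e' fU G r x.
  move=> xr; rewrite /gauge; apply/eqP; rewrite -subr_eq0; apply/eqP; apply: cf' => l y yl.
  rewrite !(dswBl, dswD) (ecomb_e ef')// (ecomb_f ef')//.
  have [_ -> ->] := ef' r x l y xr yl; have [_ _ ->] := ef1 r x l y xr yl.
  by rewrite addr0 subrr sub0r /G xr yl addrN oppr0.
have Gf : gauge_function p G.
  split=> [r x l y|r l y|r x l y px]; last by rewrite /G ltnNge px.
    rewrite /G andbC; case: ifP => // /andP[yl xr].
    rewrite fE// /gauge dswDr; have [_ -> _] := efU r x l y xr yl.
    have wE c : w (fU r x) (ecomb p e' c) = c r x by rewrite dswC (ecomb_f ef1)// opprK.
    by rewrite add0r wE /G yl xr.
  by rewrite /G; case: ifP => // /andP[r0 yl]; rewrite -ff0; have [] := ef' r 0%N l y r0 yl.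
have ncG : normal_curvature S p (gauge p e' fU G).
  have cE r x l y : (x < p r)%N -> (y < p l)%N ->
      curvature S (gauge p e' fU G) r x l y = curvature S f' r x l y.
    by move=> xr yl; rewrite /curvature -!fE.
  have [H1 H2 H3 H4] := nc'; split.
  - by move=> r x l y xr yl lr xy; rewrite cE//; exact: H1.
  - by move=> r x l y xr yl lr xy yl'; rewrite cE//; exact: H2.
  - by move=> r x l y xr yl lr xy; rewrite cE//; exact: H3.
  - by move=> r l x rl xr; rewrite !cE ?(ltnW xr) -?rl ?(ltnW xr)//; exact: H4.
exists u => // r x xr; split; first exact: ee.
rewrite fE// /gauge /ecomb big1 ?addr0// => l _; rewrite big1// => y _.
by rewrite (gauge_rigid ef1 eqe1 Gf ncU ncG) scale0r.
Qed.

End Uniqueness.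

(** * Construction of the special vectors *)

Section RealForms.
Variable R : realType.

(** One vector at a time: the next is taken nonzero in the kernel of M B^T, which exists by
    dimension, and normalised by its positive square. *)
Lemma orthonormal_family (r k : nat) (M : 'M[R]_r) : M^T = M ->
  (forall c : 'rV[R]_r, c != 0 -> 0 < (c *m M *m c^T) 0 0) -> (k <= r)%N ->
  exists B : 'M[R]_(k, r), B *m M *m B^T = 1%:M.
Proof.
move=> Mt Mpos; elim: k => [|k IH] kr; first by exists 0; apply/matrixP => -[].
have [B BM] := IH (ltnW kr).
have [v v0 vB] : exists2 v : 'rV[R]_r, v != 0 & v *m (M *m B^T) = 0.
  exists (nz_row (kermx (M *m B^T))); last by apply/sub_kermxP; exact: nz_row_sub.
  rewrite nz_row_eq0 kermx_eq0 /row_free neq_ltn.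
  by rewrite (leq_ltn_trans (rank_leq_col _) kr).
have a0 := Mpos v v0; set a := _ 0 0 in a0.
pose v' := (Num.sqrt a)^-1 *: v.
have vv : v' *m M *m v'^T = 1%:M.
  rewrite [LHS]mx11_scalar /v' -!scalemxAl linearZ/= -scalemxAr scalerA mxE.
  by rewrite -invfM -expr2 sqr_sqrtr ?(ltW a0)// -/a mulVf ?gt_eqF.
have vB' : v' *m M *m B^T = 0 by rewrite /v' -!scalemxAl -mulmxA vB scaler0.
have Bv : B *m M *m v'^T = 0.
  by apply: trmx_inj; rewrite !trmx_mul trmxK Mt trmx0 mulmxA.
suff e : col_mx v' B *m M *m (col_mx v' B)^T = 1%:M by exists (col_mx v' B).
by rewrite mul_col_mx tr_col_mx mul_col_row vv vB' Bv BM (scalar_mx_block 1 k).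
Qed.

Lemma quadratic_ge0_linear0 (a b : R) : 0 <= a ->
  (forall x : R, 0 <= x * b + (x * b + x * (x * a))) -> b = 0.
Proof.
(* Close to the minimiser - b / a, with a + 1 in place of a to cover a = 0. *)
move=> a0 /(_ (- b / (a + 1))); have a1 : 0 < a + 1 by lra.
have -> : - b / (a + 1) * b + (- b / (a + 1) * b + - b / (a + 1) * (- b / (a + 1) * a)) =
    - (b ^+ 2) * (a + 2) / (a + 1) ^+ 2 by field; lra.
rewrite pmulr_lge0 ?invr_gt0 ?exprn_gt0// mulNr oppr_ge0 => h.
by apply/eqP; rewrite -sqrf_eq0; apply/eqP; have := sqr_ge0 b; nra.
Qed.

Lemma rank_col_mx_free k1 k2 n (A : 'M[R]_(k1, n)) (B : 'M[R]_(k2, n)) :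
  (forall c : 'rV[R]_k2, (c *m B <= A)%MS -> c = 0) ->
  \rank (col_mx A B) = (\rank A + k2)%N.
Proof.
move=> H; rewrite -addsmxE mxrank_disjoint_sum.
  congr (_ + _)%N; apply/eqP; rewrite -/(row_free B) -kermx_eq0.
  apply/rowV0P => c /sub_kermxP cB; apply: H; rewrite cB; exact: sub0mx.
apply/eqP; apply/rowV0P => v; rewrite sub_capmx => /andP[vA /submxP[c cE]].
by rewrite cE (H c) ?mul0mx// -cE.
Qed.

End RealForms.

Section SymplecticRows.
Variables (R : realType) (I : set R) (I_itv : is_interval I) (I_nd : I° !=set0).
Local Notation P := (itv_set I_itv I_nd).
Local Notation C := (smooth_fun P).
Local Notation "M ^@ t" := (map_mx (@sm_ev R P t) M) (at level 8).
Local Notation cst := (map_mx (@sm_cst R P)).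
Variables (n : nat) (Om : 'M[R]_n).
Hypothesis Om_skew : Om^T = - Om.

Definition row_form (u v : 'rV[C]_n) : C := (u *m cst Om *m v^T) 0 0.

Fact row_der_additive : zmod_morphism (map_mx (@sm_der R P) : 'rV[C]_n -> 'rV[C]_n).
Proof. by move=> u v; apply/matrixP => i j; rewrite !mxE raddfB. Qed.
HB.instance Definition _ := GRing.isZmodMorphism.Build 'rV[C]_n 'rV[C]_n
  (map_mx (@sm_der R P) : 'rV[C]_n -> 'rV[C]_n) row_der_additive.

Lemma row_form_skew u v : row_form u v = - row_form v u.
Proof.
have -> : row_form u v = (u *m cst Om *m v^T)^T 0 0 by rewrite mxE.
rewrite !trmx_mul trmxK map_trmx Om_skew map_mxN mulNmx mulmxN mxE.
by rewrite mulmxA.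
Qed.

Lemma row_form_der u v : sm_der (row_form u v) =
  row_form (map_mx (@sm_der R P) u) v + row_form u (map_mx (@sm_der R P) v).
Proof.
have -> : sm_der (row_form u v) = (map_mx (@sm_der R P) (u *m cst Om *m v^T)) 0 0.
  by rewrite mxE.
by rewrite !der_mulmx der_cst_mx mulmx0 addr0 der_trmx mxE.
Qed.

Lemma smooth_nat_unit k : (k.+1%:R : C) \is a GRing.unit.
Proof. by apply: sm_ev_unit => t _; rewrite rmorph_nat pnatr_eq0. Qed.

Definition row_symplectic : diff_symplectic 'rV[C]_n.
Proof.
apply: (@DiffSymplectic C 'rV[C]_n (@sm_der R P) (map_mx (@sm_der R P)) row_form).
- exact: sm_derM.
- by move=> a v; apply/matrixP => i j; rewrite !mxE; exact: sm_derM.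
- by move=> u v w; rewrite /row_form !mulmxDl mxE.
- by move=> a u v; rewrite /row_form -!scalemxAl mxE.
- exact: row_form_skew.
- exact: row_form_der.
- exact: smooth_nat_unit.
Defined.

End SymplecticRows.

Arguments row_symplectic : simpl never.

Section SpecialVectors.
Variables (R : realType) (I : set R) (I_itv : is_interval I) (I_nd : I° !=set0).
Local Notation P := (itv_set I_itv I_nd).
Local Notation C := (smooth_fun P).
Local Notation D := (@sm_der R P).
Local Notation ev t := (@sm_ev R P t).
Local Notation "M ^@ t" := (map_mx (ev t) M) (at level 8).
Local Notation cst := (map_mx (@sm_cst R P)).
Variables (n m : nat) (Om : 'M[R]_n).
Hypotheses (nE : n = (m + m)%N) (Om_skew : Om^T = - Om) (Om_unit : Om \in unitmx).
Local Notation S := (@row_symplectic R I I_itv I_nd n Om Om_skew).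
Local Notation d := (dsV S).
Local Notation w := (dsw S).
Local Notation "v ^[ k ]" := (iter k d v) (at level 2, format "v ^[ k ]").
Implicit Types (u v : 'rV[C]_n) (t : R).

Lemma ev_form t u v : ev t (w u v) = (u^@t *m Om *m (v^@t)^T) 0 0.
Proof.
by rewrite map_trmx -[in RHS](ev_cst_mx P Om t) -!map_mxM mxE.
Qed.

Definition fam_mx (F : finType) (g : F -> 'rV[C]_n) : 'M[C]_(#|F|, n) :=
  \matrix_i g (enum_val i).

Lemma row_fam_mx (F : finType) (g : F -> 'rV[C]_n) t i : row i ((fam_mx g)^@t) = (g (enum_val i))^@t.
Proof. by rewrite -map_row rowK. Qed.

Lemma fam_mx_orth (F : finType) (g : F -> 'rV[C]_n) t (x : 'rV[R]_n) :
  (forall y, (x *m Om *m ((g y)^@t)^T) 0 0 = 0) -> x *m Om *m ((fam_mx g)^@t)^T = 0.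
Proof.
move=> H; apply/rowP => i; rewrite [RHS]mxE -(H (enum_val i)) !mxE.
by apply: eq_bigr => k _; rewrite !mxE.
Qed.

Variable X : 'M[C]_(m, n).
Hypothesis X_free : forall t, I t -> row_free (X^@t).
Hypothesis X_iso : forall i j, w (row i X) (row j X) = 0.

(** A Lagrangian subspace is its own orthogonal, so membership becomes a linear equation over the
    ring. *)
Definition section v : Prop := forall i, w v (row i X) = 0.

Lemma section_sub v t : section v -> I t -> (v^@t <= X^@t)%MS.
Proof.
move=> sv It.
have kerE (y : 'rV[R]_n) : (forall i, (y *m Om *m ((row i X)^@t)^T) 0 0 = 0) ->
    (y <= kermx (Om *m (X^@t)^T))%MS.
  move=> H; apply/sub_kermxP; apply/rowP => i; rewrite [RHS]mxE -(H i) mulmxA !mxE.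
  by apply: eq_bigr => k _; rewrite !mxE.
have XK : (X^@t <= kermx (Om *m (X^@t)^T))%MS.
  apply/row_subP => i; apply: kerE => j.
  by rewrite -map_row -ev_form X_iso rmorph0.
have rX : \rank (X^@t) = m by apply/eqP; exact: X_free.
have rK : \rank (kermx (Om *m (X^@t)^T)) = m.
  rewrite mxrank_ker -mxrank_tr trmx_mul trmxK Om_skew mulmxN.
  rewrite eqmx_opp mxrankMfree ?rX; last by rewrite row_free_unit.
  by rewrite nE addnK.
have KX : (kermx (Om *m (X^@t)^T) <= X^@t)%MS.
  by have := mxrank_leqif_sup XK => /geq_leqif <-; rewrite rX rK.
by apply: submx_trans KX; apply: kerE => i; rewrite -ev_form sv rmorph0.
Qed.

Lemma section_iso u v : section u -> section v -> w u v = 0.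
Proof.
move=> su sv; apply: sm_ev_eq => t It; rewrite ev_form rmorph0.
have /submxP[c ->] := section_sub sv It.
rewrite trmx_mul mulmxA (_ : u^@t *m Om *m (X^@t)^T = 0) ?mul0mx ?mxE//.
apply/rowP => i; rewrite [RHS]mxE.
have := congr1 (ev t) (su i); rewrite rmorph0 ev_form => h; apply: etrans h.
by rewrite !mxE; apply: eq_bigr => k _; rewrite !mxE.
Qed.

(** Integration by parts turns a condition on the derivatives of v into linear equations on v
    itself, so the solutions form the kernel of a matrix and have a smooth frame once the rank is
    constant. *)
Lemma section_jets v q : (0 < q)%N ->
  (forall x, (x < q)%N -> section v^[x]) <->
  (forall i k, (k < q)%N -> w v (row i X)^[k] = 0).
Proof.
move=> q0; split=> [sv i k kq|H x xq i].
  apply: (@dsw_move_block _ _ S v (row i X) q 1 isT _ 0) => //; last by lia.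
  by move=> x [|//] xq _; exact: sv.
by apply: (@dsw_move_vanish _ _ S v (row i X) q (H i) x 0); lia.
Qed.

Variables (T : finType) (p : T -> nat).
Hypothesis p0 : forall r, (0 < p r)%N.

Definition jets (q : nat) (x : 'I_q.+1 * 'I_m) : 'rV[C]_n := (row x.2 X)^[x.1].

Hypothesis rank_jets : forall q t, I t ->
  (\rank ((fam_mx (@jets q))^@t) + \sum_r (p r - q))%N = n.
Hypothesis monotone : forall v, section v -> forall t, I t -> 0 <= ev t (w (d v) v).

Section Step.
Variables (q : nat) (eps : T -> 'rV[C]_n).
Hypothesis q0 : (0 < q)%N.
Hypothesis eps_table : forall r l, (q < p r)%N -> (q < p l)%N -> pairing_table S p eps r l.
Hypothesis eps_section : forall r k, (q < p r)%N -> (k < p r)%N -> section (eps r)^[k].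

Let dim (q' : nat) (r : T) := if (q < p r)%N then (p r - q')%N else 0%N.

(* The jets dual to eps r^(k), k < p r - q'; together with the q'-th jets of the
   sections they span a subspace whose dimension can be computed. *)
Definition dual_jets (q' : nat) (x : {r : T & 'I_(dim q' r)}) : 'rV[C]_n :=
  (eps (tag x))^[2 * p (tag x) - 1 - tagged x].

Lemma card_dual_jets q' : #|{: {r : T & 'I_(dim q' r)}}| = (\sum_r dim q' r)%N.
Proof.
rewrite card_tagged sumnE big_map big_enum/=; apply: eq_bigr => r _.
by rewrite card_ord.
Qed.

Let M q' := fam_mx (@jets q').
Let Z q' := fam_mx (@dual_jets q').

(** The vector eps l^(k) with k < p l - q' is orthogonal to the jets of order at most q' of the
    sections, and its pairings with the dual jets are triangular in k with diagonal entries 1 or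
    -1. *)
Lemma rank_dual_jets q' t : (q' <= q)%N -> I t ->
  \rank (col_mx (M q')^@t (Z q')^@t) = (\rank (M q')^@t + \sum_r dim q' r)%N.
Proof.
move=> qq It; rewrite -card_dual_jets; apply: rank_col_mx_free => c cM.
pose F := {r : T & 'I_(dim q' r)}.
pose b (y : F) := c 0 (enum_rank y).
suff b0 (y : F) : b y = 0.
  by apply/rowP => i; rewrite mxE -(b0 (enum_val i)) /b enum_valK.
have [k] := ubnP (tagged y : nat); elim: k => [//|k IH] in y *.
rewrite ltnS leq_eqVlt => /orP[/eqP yk|/IH//].
case: y yk => l kl /= yk.
have [ql lt_kl] : (q < p l)%N /\ (k < p l - q')%N.
  by have := ltn_ord kl; rewrite yk /dim; case: ifP.
pose y := (eps l)^[k].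
have yM : y^@t *m Om *m ((M q')^@t)^T = 0.
  apply: fam_mx_orth => -[j i]; rewrite -ev_form /jets/=.
  have/(section_jets _ (p0 l))/(_ i) H := fun x (h : (x < p l)%N) => eps_section ql h.
  rewrite /y (@dsw_move_vanish _ _ S _ _ _ H) ?rmorph0//.
  by have := ltn_ord j; lia.
have : (y^@t *m Om *m (c *m (Z q')^@t)^T) 0 0 = 0.
  have /submxP[a ->] := cM; by rewrite trmx_mul mulmxA yM mul0mx mxE.
rewrite trmx_mul mulmxA.
have zE (z : F) : (y^@t *m Om *m ((Z q')^@t)^T) 0 (enum_rank z) = ev t (w y (dual_jets z)).
  rewrite ev_form !mxE; apply: eq_bigr => j _; rewrite !mxE enum_rankK//.
rewrite mxE (reindex _ (onW_bij _ (@enum_rank_bij F)))/=.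
under eq_bigr => z _ do rewrite zE mxE -/(b z).
rewrite (bigD1 (Tagged _ kl))//= big1 ?addr0.
  rewrite /dual_jets/= /y; have [_ _ H] := eps_table ql ql.
  rewrite H// ?yk; last by lia.
  by rewrite eqxx mulr1 rmorph_sign => /(canRL (signrMK _)); rewrite mulr0.
move=> [s ks] /= ne; have qs : (q < p s)%N.
  by have : (0 < dim q' s)%N by [apply: leq_ltn_trans (ltn_ord ks)]; rewrite /dim; case: ifP.
have kss : (ks < p s - q')%N by apply: leq_trans (ltn_ord ks) _; rewrite /dim qs.
have [sk|sk] := ltnP ks k; first by rewrite (IH (Tagged _ ks))// mulr0.
rewrite /dual_jets/= /y; have [H1 H2 H3] := eps_table ql qs.
have [ls|ls] := eqVneq (p l) (p s); last by rewrite H1 ?rmorph0 ?mul0r//; lia.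
have [ks_k|ks_k] := eqVneq (ks : nat) k; last by rewrite H2 ?rmorph0 ?mul0r//; lia.
rewrite H3//; last by lia.
have [ls'|] := eqVneq l s; last by rewrite mulr0 rmorph0 mul0r.
case/eqP: ne; subst s; congr (Tagged _ _); apply: val_inj; rewrite /= ks_k.
by rewrite yk.
Qed.

Let r := #|[pred s | p s == q]|.

(** For jets of order q - 1 the codimension exceeds the number of dual jets by r, the number of rows
    of length q: this is the room for the new rows. For jets of order q there is no excess
    ([corank_at]), whence [full]. *)
Let corank_below : (\sum_s (p s - q.-1) = \sum_s dim q.-1 s + r)%N.
Proof.
rewrite /r -sum1_card [X in (_ + X)%N]big_mkcond -big_split; apply: eq_bigr => s _ /=.
by rewrite /dim inE; case: ltngtP => ?; lia.
Qed.

Let corank_at : (\sum_s (p s - q) = \sum_s dim q s)%N.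
Proof. by apply: eq_bigr => s _; rewrite /dim; case: ltnP => ?; lia. Qed.

Let full t (x : 'rV[R]_n) : I t ->
  (forall i k, (k <= q)%N -> (x *m Om *m ((row i X)^[k]^@t)^T) 0 0 = 0) ->
  (forall y : {s : T & 'I_(dim q s)}, (x *m Om *m ((dual_jets y)^@t)^T) 0 0 = 0) ->
  x = 0.
Proof.
move=> It HM HZ; have rk : row_free (col_mx (M q)^@t (Z q)^@t)^T.
  rewrite /row_free mxrank_tr rank_dual_jets//; apply/eqP.
  by rewrite -corank_at; exact: rank_jets.
have x0 : x *m Om *m (col_mx (M q)^@t (Z q)^@t)^T = 0.
  rewrite tr_col_mx mul_mx_row fam_mx_orth => [|[k i]]; last first.
    by apply: HM; rewrite -ltnS /=.
  by rewrite fam_mx_orth ?row_mx0.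
have {}x0 : x *m Om = 0 by apply: (row_free_inj rk); rewrite x0 mul0mx.
by apply: (can_inj (mulmxK Om_unit)); rewrite x0 mul0mx.
Qed.

Let fam_form (F : finType) (g : F -> 'rV[C]_n) k (H : 'M[C]_(k, n)) y i :
  (fam_mx g *m cst Om *m H^T) (enum_rank y) i = w (g y) (row i H).
Proof.
rewrite [RHS]mxE mxE; apply: eq_bigr => j _; rewrite !mxE; congr (_ * _).
by apply: eq_bigr => l _; rewrite !mxE enum_rankK.
Qed.

(** By [section_jets] the first equations say that the first q jets of each row of [H] are sections;
    the others impose part of the orthogonality to longer rows, the rest of which [comb_old]
    derives. *)
Let kernel_frame : exists H : 'M[C]_(r, n), [/\ forall t, I t -> row_free (H^@t),
  forall i j k, (k < q)%N -> w (row i H) (row j X)^[k] = 0 &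
  forall i (y : {s : T & 'I_(dim q.-1 s)}), w (row i H) (dual_jets y) = 0].
Proof.
have [t It|H [NH fH]] := @smooth_kernel R I I_itv I_nd _ n r
    (col_mx (M q.-1) (Z q.-1) *m cst Om).
  rewrite map_mxM ev_cst_mx mxrankMfree ?row_free_unit// map_col_mx rank_dual_jets//; last by lia.
  by rewrite addnC -addnA -corank_below; apply: rank_jets.
move: NH; rewrite mul_col_mx mul_col_mx -[RHS](col_mx0 _ _ _) => /eq_col_mx[MH ZH].
exists H; split=> // [i j k kq|i y]; rewrite dswC; apply/eqP; rewrite oppr_eq0; apply/eqP.
  have kq' : (k < q.-1.+1)%N by rewrite prednK.
  have := fam_form (@jets q.-1) H (Ordinal kq', j) i.
  by rewrite -/(M q.-1) MH mxE => /esym.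
by have := fam_form (@dual_jets q.-1) H y i; rewrite -/(Z q.-1) ZH mxE => /esym.
Qed.

Section Normalise.
Variable H : 'M[C]_(r, n).
Hypothesis H_free : forall t, I t -> row_free (H^@t).
Hypothesis H_X : forall i j k, (k < q)%N -> w (row i H) (row j X)^[k] = 0.
Hypothesis H_Z : forall i (y : {s : T & 'I_(dim q.-1 s)}), w (row i H) (dual_jets y) = 0.
Let eta i := row i H.
Let comb (b : 'I_r -> C) := \sum_i b i *: eta i.

Let comb_X b j k : (k < q)%N -> w (comb b) (row j X)^[k] = 0.
Proof. by move=> kq; rewrite dsw_suml big1// => i _; rewrite dswZ H_X ?mulr0. Qed.

Let comb_section b x : (x < q)%N -> section (comb b)^[x].
Proof. by move: x; apply/(section_jets _ q0) => j k; exact: comb_X. Qed.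

Let eta_section i x : (x < q)%N -> section (eta i)^[x].
Proof. by move: x; apply/(section_jets _ q0) => j k; exact: H_X. Qed.

Let jets_iso u v : (forall x, (x < q)%N -> section u^[x]) ->
  (forall x, (x < q)%N -> section v^[x]) ->
  forall x k, (x + k < (2 * q).-1)%N -> w u^[x] v^[k] = 0.
Proof.
move=> su sv; apply: dsw_move_vanish => k kq.
apply: (@dsw_move_block _ _ S u v q q q0 _ 0) => //; last by lia.
by move=> x k' xq kq'; apply: section_iso; [exact: su|exact: sv].
Qed.

(** For k < q + p s - 1 isotropy of sections suffices, spread by [dsw_move_block]; the remaining
    orders are those of the dual jets. *)
Let comb_old b s k : (q < p s)%N -> (k < 2 * p s)%N -> w (comb b) (eps s)^[k] = 0.
Proof.
move=> qs ks; rewrite dsw_suml big1// => i _; rewrite dswZ -/(eta i).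
suff -> : w (eta i) (eps s)^[k] = 0 by rewrite mulr0.
have [kq|kq] := ltnP k (q + p s - 1).
  apply: (@dsw_move_block _ _ S (eta i) (eps s) q (p s) (p0 s) _ 0) => // x k' xq kq'.
  by apply: section_iso; [exact: eta_section|exact: eps_section].
have ks' : (2 * p s - 1 - k < dim q.-1 s)%N by rewrite /dim qs; lia.
have := H_Z i (Tagged (fun s => 'I_(dim q.-1 s)) (Ordinal ks')).
by rewrite /dual_jets/= (_ : 2 * p s - 1 - (2 * p s - 1 - k) = k)%N//; lia.
Qed.

Let Sm : 'M[C]_r := \matrix_(i, j) w (eta i)^[q] (eta j)^[q.-1].
Let Qm : 'M[C]_r := \matrix_(i, j) w (eta i)^[q] (eta j)^[q].

Let Sm_sym : Sm^T = Sm.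
Proof.
have e k : (eta k)^[q] = d (eta k)^[q.-1] by rewrite -iterS prednK.
apply/matrixP => i j; rewrite !mxE e.
rewrite dsw_shift section_iso ?raddf0; [|apply: eta_section; lia|apply: eta_section; lia].
by rewrite sub0r -e -dswC.
Qed.

Let Qm_skew : Qm^T = - Qm.
Proof. by apply/matrixP => i j; rewrite !mxE dswC. Qed.

(** A null vector of a nonnegative form lies in its kernel. The form is tested on v + x X_j with x
    constant, so that the derivative of x does not enter. *)
Let cauchy_schwarz v t j : section v -> I t -> ev t (w (d v) v) = 0 ->
  ev t (w (d v) (row j X)) = 0.
Proof.
move=> sv It v0; pose a := ev t (w (d (row j X)) (row j X)).
pose b := ev t (w (d v) (row j X)).
have sX : section (row j X) by move=> i; exact: X_iso.
have a0 : 0 <= a by exact: monotone.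
have q_ge0 (x : R) : 0 <= x * b + (x * b + x * (x * a)).
  have sl : section (v + sm_cst P x *: row j X).
    by move=> i; rewrite dswD dswZ sv X_iso mulr0 addr0.
  have := monotone sl It.
  rewrite (raddfD d) dsVZ.
  have -> : dsK S (sm_cst P x) = 0 by exact: sm_der_cst.
  rewrite scale0r add0r !dswD !dswDr !dswZ !dswZr.
  have -> : w (d (row j X)) v = w (d v) (row j X).
    rewrite dsw_shift; have := section_iso sX sv => ->.
    by rewrite raddf0 sub0r -dswC.
  have evD (g h : C) : ev t (g + h) = ev t g + ev t h by exact: rmorphD.
  have evM (g h : C) : ev t (g * h) = ev t g * ev t h by exact: rmorphM.
  rewrite !evD !evM !sm_ev_cst v0 add0r.
  by rewrite -/b -/a.
exact: quadratic_ge0_linear0 a0 q_ge0.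
Qed.

(** Were the value 0, the kernel property would make the combination orthogonal at t to the q-th
    jets of the frame as well. Being already orthogonal to the lower jets and to the dual jets, it
    would vanish by [full], against the independence of the rows of [H]. *)
Let Sm_pos t (c : 'rV[R]_r) : I t -> c != 0 -> 0 < (c *m Sm^@t *m c^T) 0 0.
Proof.
(* The coefficients are constant functions, so derivatives pass through the combination. *)
move=> It c0; pose b i := sm_cst P (c 0 i).
have jet k : (comb b)^[k] = \sum_i b i *: (eta i)^[k].
  elim: k => [//|k IH]; rewrite iterS IH (raddf_sum d); apply: eq_bigr => i _.
  by rewrite dsVZ (_ : dsK S (b i) = 0) ?scale0r ?add0r//; exact: sm_der_cst.
pose l := (comb b)^[q.-1].
have sl : section l by apply: comb_section; lia.
have dl : d l = (comb b)^[q] by rewrite -iterS prednK.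
have cE : (c *m Sm^@t *m c^T) 0 0 = ev t (w (d l) l).
  rewrite dl /l !jet dsw_suml rmorph_sum/= mxE.
  transitivity (\sum_i \sum_j c 0 i * c 0 j * ev t (Sm i j)).
    rewrite exchange_big/=; apply: eq_bigr => j _; rewrite !mxE mulr_suml.
    by apply: eq_bigr => i _; rewrite !mxE mulrAC.
  apply: eq_bigr => i _; rewrite dswZ dsw_sumr mulr_sumr rmorph_sum/=.
  by apply: eq_bigr => j _; rewrite dswZr !rmorphM/= /b !sm_ev_cst mxE mulrA.
rewrite lt_neqAle cE monotone// andbT eq_sym; apply/negP => /eqP l0.
have hX j : ev t (w (comb b) (row j X)^[q]) = 0.
  have h := cauchy_schwarz j sl It l0.
  have := @dsw_move_const _ _ S (comb b) (row j X) q.-1 0 (raddf0 _) _ q 0.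
  rewrite prednK//= addn0 -dl => H1.
  have {}H1 : w (d l) (row j X) = (-1) ^+ q * w (comb b) (row j X)^[q].
    apply: H1 => // x k xk; rewrite mulr0.
    by apply: (@dsw_move_vanish _ _ S _ _ q) => [k' kq|]; [exact: comb_X|lia].
  by move: h; rewrite H1 rmorphM rmorph_sign/= => /(canRL (signrMK _)); rewrite mulr0.
have cb : (comb b)^@t = c *m H^@t.
  apply/rowP => k; rewrite !mxE summxE rmorph_sum; apply: eq_bigr => i _.
  by rewrite !mxE rmorphM/= /b sm_ev_cst.
have : (comb b)^@t = 0.
  apply: (full It) => [j k kq|y]; rewrite -ev_form.
    move: kq; rewrite leq_eqVlt => /orP[/eqP->//|kq].
    by rewrite comb_X ?rmorph0.
  rewrite /dual_jets comb_old ?rmorph0//.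
    by have : (0 < dim q (tag y))%N by [apply: leq_ltn_trans (ltn_ord (tagged y))]; rewrite /dim; case: ifP.
  by have := p0 (tag y); lia.
rewrite cb => cH; move/eqP: c0; apply.
by apply: (row_free_inj (H_free It)); rewrite cH mul0mx.
Qed.

Let Sm_unit : Sm \in unitmx.
Proof.
rewrite unitmxE; apply: sm_ev_unit => t It; rewrite -det_map_mx -unitfE -unitmxE.
rewrite -row_free_unit -kermx_eq0; apply/eqP/row_matrixP => i; rewrite row0.
apply/eqP/negPn/negP => c0; have := Sm_pos It c0.
by rewrite -row_mul mulmx_ker row0 mul0mx mxE ltxx.
Qed.

(** With B' = B Cm, the product B Sm B^T is constant iff the symmetric part of Cm Sm is - Sm' / 2,
    and the pairing of order 2 q vanishes if its antisymmetric part is Qm / (2 q). Since Sm is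
    symmetric and Qm antisymmetric, both can be prescribed at once. *)
Let Cm : 'M[C]_r := ((2 * q)%:R^-1 *: Qm - 2%:R^-1 *: map_mx D Sm) *m invmx Sm.

Let q_unit : (q%:R : C) \is a GRing.unit.
Proof. by rewrite -(prednK q0); exact: smooth_nat_unit. Qed.
Let two_unit : (2%:R : C) \is a GRing.unit.
Proof. exact: smooth_nat_unit. Qed.

Let CS : Cm *m Sm = (2 * q)%:R^-1 *: Qm - 2%:R^-1 *: map_mx D Sm.
Proof. by rewrite /Cm mulmxKV. Qed.

Let SCt : Sm *m Cm^T = - ((2 * q)%:R^-1 *: Qm) - 2%:R^-1 *: map_mx D Sm.
Proof.
rewrite -[in LHS]Sm_sym -trmx_mul CS linearB/= !linearZ/= Qm_skew -der_trmx Sm_sym.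
by rewrite scalerN.
Qed.

Let normalising_matrix : exists B : 'M[C]_r,
  B *m Sm *m B^T = 1%:M /\
  B *m Qm *m B^T + q%:R *: (B *m Sm *m (map_mx D B)^T - map_mx D B *m Sm *m B^T) = 0.
Proof.
have [t0 It0] := pdom_nonempty P.
have [U [_ dU U1]] := @fundamental_matrix R I I_itv I_nd r Cm^T t0 It0.
have Smt : (Sm^@t0)^T = Sm^@t0 by rewrite map_trmx Sm_sym.
have [B0 B0S] := orthonormal_family Smt (fun c => @Sm_pos t0 c It0) (leqnn r).
pose B := cst B0 *m U^T.
have dB : map_mx D B = B *m Cm.
  by rewrite der_mulmx der_cst_mx mul0mx add0r der_trmx dU trmx_mul trmxK mulmxA.
have dBt : (map_mx D B)^T = Cm^T *m B^T by rewrite dB trmx_mul.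
exists B; split; last first.
  rewrite dBt dB -(mulmxA B Cm) CS mulmxA -(mulmxA B Sm) SCt.
  rewrite -mulmxBl -mulmxBr opprB addrA subrK -opprD -scalerDl mulmxN mulNmx scalerN.
  rewrite -scalemxAr -scalemxAl scalerA.
  rewrite (_ : q%:R * _ = 1) ?scale1r ?addrN//.
  rewrite -mulr2n -[_ *+ 2]mulr_natl mulrA -natrM mulnC mulrV//.
  by rewrite -(prednK q0) mulnS; exact: smooth_nat_unit.
have key : Cm *m Sm + map_mx D Sm + Sm *m Cm^T = 0.
  have h : map_mx D Sm = 2%:R^-1 *: map_mx D Sm + 2%:R^-1 *: map_mx D Sm.
    by rewrite -scalerDl -mulr2n -[_ *+ 2]mulr_natl mulrV// scale1r.
  rewrite CS SCt {2}h; move: (_ *: Qm) (_ *: map_mx D Sm) => x y.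
  by apply/matrixP => i j; rewrite !mxE; ring.
rewrite (@der0_cst_mx R I I_itv I_nd r r (B *m Sm *m B^T) t0 It0).
  have B0E : B^@t0 = B0 by rewrite map_mxM ev_cst_mx -map_trmx U1 trmx1 mulmx1.
  have -> : (B *m Sm *m B^T)^@t0 = 1%:M by rewrite 2!map_mxM -map_trmx B0E.
  by rewrite map_mx1.
rewrite (der_mulmx (B *m Sm) B^T) (der_mulmx B Sm) (der_trmx B) dBt dB.
rewrite -(mulmxA B Cm) -mulmxDr mulmxA -mulmxDl -(mulmxA B Sm) -mulmxDr key.
by rewrite mulmx0 mul0mx.
Qed.

Lemma normalised_rows : exists eps' : T -> 'rV[C]_n,
  (forall s l, (q <= p s)%N -> (q <= p l)%N -> pairing_table S p eps' s l) /\
  (forall s k, (q <= p s)%N -> (k < p s)%N -> section (eps' s)^[k]).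
Proof.
have [B [B1 B2]] := normalising_matrix.
(* A sum with a single term for p s = q: the index of s among the rows of length q. *)
pose new s := \sum_(i < r | enum_val i == s) comb (B i).
pose eps' s := if p s == q then new s else eps s.
have newE s : p s = q -> exists2 i, enum_val i = s & eps' s = comb (B i).
  move=> sq; have sP : s \in [pred s | p s == q] by rewrite inE sq.
  exists (enum_rank_in sP s); first by rewrite enum_rankK_in.
  rewrite /eps' sq eqxx /new (bigD1 (enum_rank_in sP s))/= ?enum_rankK_in//.
  rewrite big1 ?addr0// => i /andP[/eqP is_ ne]; case/eqP: ne.
  by apply: enum_val_inj; rewrite enum_rankK_in.
have oldE s : (q < p s)%N -> eps' s = eps s by rewrite /eps' => ?; case: eqP => // ?; lia.
have lt s l : p s = q -> (q < p l)%N ->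
    pairing_table S p eps' s l /\ pairing_table S p eps' l s.
  move=> sq ql; apply: pairing_table_lt; first by rewrite sq.
  by move=> k kl; have [i _ ->] := newE s sq; rewrite oldE// comb_old.
have sect s k : (q <= p s)%N -> (k < p s)%N -> section (eps' s)^[k].
  rewrite leq_eqVlt => /orP[/eqP sq|qs] ks; last by rewrite oldE//; exact: eps_section.
  by have [i _ ->] := newE s (esym sq); apply: comb_section; rewrite sq.
exists eps'; split=> // s l qs ql.
have [sq|sq] := eqVneq (p s) q; have [lq|lq] := eqVneq (p l) q.
- apply: pairing_table_eq => //; first by rewrite sq lq.
    move=> x k xs ks; apply: section_iso; apply: sect => //.
    by rewrite lq -sq.
  + have [i is_ ->] := newE s sq; have [j jl ->] := newE l lq.
    rewrite sq /comb -(eq_bigl (fun=> true) _ (fun=> erefl)).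
    rewrite (lead_pairing q0) => [|k l' x y _ _ xy]; last first.
      by apply: jets_iso xy => x' xq; exact: eta_section.
    have := congr1 (fun A : 'M[C]_r => A i j) B1; rewrite !mxE -is_ -jl.
    rewrite (inj_eq enum_val_inj) => <-.
    rewrite exchange_big/=; apply: eq_bigr => k _; rewrite !mxE mulr_suml.
    by apply: eq_bigr => k' _; rewrite mxE mulrAC.
  + have [i is_ ->] := newE s sq; have [j jl ->] := newE l lq.
    rewrite sq /comb -(eq_bigl (fun=> true) _ (fun=> erefl)).
    rewrite (sublead_pairing q0) => [|k l' x y _ _ xy]; last first.
      by apply: jets_iso xy => x' xq; exact: eta_section.
    have := congr1 (fun A : 'M[C]_r => A i j) B2; rewrite [RHS]mxE => h; apply: etrans h.
    have e (F G : 'M[C]_r) (A : 'M[C]_r) : (F *m A *m G^T) i j =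
        \sum_k \sum_l F i k * G j l * A k l.
      rewrite mxE exchange_big/=; apply: eq_bigr => k _; rewrite !mxE mulr_suml.
      by apply: eq_bigr => k' _; rewrite mulrAC.
    rewrite mxE [X in _ + X]mxE [X in q%:R * X]mxE [X in q%:R * (_ + X)]mxE !e.
    rewrite -sumrB mulr_sumr -big_split; apply: eq_bigr => k _ /=.
    rewrite -sumrB mulr_sumr -big_split; apply: eq_bigr => k' _ /=.
    rewrite !mxE; congr (_ + _ * (_ + _)); rewrite -mulrN; congr (_ * _).
    by rewrite dswC; have := congr1 (fun A : 'M[C]_r => A k k') Sm_sym; rewrite !mxE => ->.
- have ql' : (q < p l)%N by lia.
  by have [] := lt s l sq ql'.
- have qs' : (q < p s)%N by lia.
  by have [] := lt l s lq qs'.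
rewrite /pairing_table (oldE s) ?(oldE l); [apply: eps_table; lia|lia|lia].
Qed.

End Normalise.

Lemma special_step : exists eps' : T -> 'rV[C]_n,
  (forall s l, (q <= p s)%N -> (q <= p l)%N -> pairing_table S p eps' s l) /\
  (forall s k, (q <= p s)%N -> (k < p s)%N -> section (eps' s)^[k]).
Proof. by have [H [H1 H2 H3]] := kernel_frame; exact: normalised_rows H1 H2 H3. Qed.

End Step.

Theorem special_vectors : exists eps : T -> 'rV[C]_n,
  (forall s l, pairing_table S p eps s l) /\
  (forall s k, (k < p s)%N -> section (eps s)^[k]).
Proof.
suff H N : exists eps : T -> 'rV[C]_n,
    (forall s l, (\max_r p r < p s + N)%N -> (\max_r p r < p l + N)%N ->
       pairing_table S p eps s l) /\
    (forall s k, (\max_r p r < p s + N)%N -> (k < p s)%N -> section (eps s)^[k]).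
  have [eps [H1 H2]] := H (\max_r p r).+1; exists eps.
  by split=> [s l|s k]; [apply: H1; lia|apply: H2; lia].
have pm s : (p s <= \max_r p r)%N := leq_bigmax s.
elim: N => [|N [eps [H1 H2]]].
  by exists (fun=> 0); split=> [s l|s k]; rewrite addn0 ltnNge pm.
have [NM|NM] := ltnP N (\max_r p r); last first.
  exists eps; split=> [s l _ _|s k _]; [apply: H1|apply: H2];
    by [have := p0 s; lia|have := p0 l; lia].
pose q := (\max_r p r - N)%N.
have [|||eps' [H1' H2']] := @special_step q eps.
- by rewrite /q; lia.
- by move=> r l qr ql; apply: H1; rewrite /q in qr ql; lia.
- by move=> r k qr kr; apply: H2 => //; rewrite /q in qr; lia.
exists eps'; split=> [s l h1 h2|s k h1].
  by apply: H1'; rewrite /q; lia.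
by apply: H2'; rewrite /q; lia.
Qed.

End SpecialVectors.

(** * Curves of vectors and of subspaces *)

Section RowCoordinates.
Variables (R : realType) (W : vectType R).
Local Notation n := (\dim {:W}).
Local Notation b := (vbasis (fullv : {vspace W})).

Definition row_of (v : W) : 'rV[R]_n := \row_i coord b i v.
Definition vec_of (x : 'rV[R]_n) : W := \sum_i x 0 i *: b`_i.

Lemma row_ofK : cancel row_of vec_of.
Proof.
move=> v; rewrite [RHS](coord_vbasis (memvf v)); apply: eq_bigr => i _.
by rewrite mxE.
Qed.

Lemma vec_ofK : cancel vec_of row_of.
Proof.
move=> x; apply/rowP => i; rewrite mxE; apply: coord_sum_free.
exact: basis_free (vbasisP _).
Qed.

Fact row_of_linear : linear row_of.
Proof. by move=> a u v; apply/rowP => i; rewrite !mxE linearP. Qed.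
HB.instance Definition _ := GRing.isLinear.Build R W 'rV[R]_n *:%R row_of row_of_linear.

Fact vec_of_linear : linear vec_of.
Proof.
move=> a u v; rewrite /vec_of scaler_sumr -big_split; apply: eq_bigr => i _.
by rewrite !mxE scalerDl scalerA.
Qed.
HB.instance Definition _ := GRing.isLinear.Build R 'rV[R]_n W *:%R vec_of vec_of_linear.

Lemma mem_span_rows k (M : 'M[R]_(k, n)) v :
  (v \in <<[seq vec_of (row i M) | i : 'I_k]>>%VS) = (row_of v <= M)%MS.
Proof.
apply/idP/idP => [vM|/submxP[c cE]].
  have := vM; rewrite -[[seq _ | i : _]]in_tupleE => /coord_span ->.
  rewrite linear_sum/=; apply: summx_sub => i _; rewrite linearZ/=; apply: scalemx_sub.
  have /mapP[j _ ->] : [seq vec_of (row i M) | i : 'I_k]`_i \in [seq vec_of (row i M) | i : 'I_k].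
    by rewrite mem_nth.
  by rewrite vec_ofK row_sub.
rewrite -[v]row_ofK cE mulmx_sum_row linear_sum/=; apply: memv_suml => i _.
rewrite linearZ/=; apply: memvZ; apply: memv_span.
by apply/mapP; exists i; rewrite ?mem_enum.
Qed.

Lemma dim_span_rows k (M : 'M[R]_(k, n)) :
  \dim <<[seq vec_of (row i M) | i : 'I_k]>> = \rank M.
Proof.
have -> : (<<[seq vec_of (row i M) | i : 'I_k]>> =
    <<[seq vec_of (row i (row_base M)) | i : 'I_(\rank M)]>>)%VS.
  by apply/vspaceP => v; rewrite !mem_span_rows eq_row_base.
suff : free [seq vec_of (row i (row_base M)) | i : 'I_(\rank M)].
  by rewrite /free size_map -cardE card_ord => /eqP.
rewrite -[[seq _ | i : _]]in_tupleE; apply/freeP => c c0 i.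
have sz : size [seq vec_of (row i (row_base M)) | i : 'I_(\rank M)] = \rank M.
  by rewrite size_map -cardE card_ord.
pose c' : 'rV[R]_(\rank M) := \row_j c (cast_ord (esym sz) j).
suff : c' = 0.
  move/rowP/(_ (cast_ord sz i)); rewrite !mxE => <-; congr c.
  by apply: val_inj.
apply: (row_free_inj (row_base_free M)); rewrite mul0mx mulmx_sum_row.
apply: (can_inj vec_ofK); rewrite linear0 linear_sum/= -[RHS]c0.
rewrite (reindex (cast_ord sz)); last first.
  by exists (cast_ord (esym sz)) => j _; apply: val_inj.
apply: eq_bigr => j _; rewrite linearZ/= mxE cast_ordK; congr (_ *: _).
have jr : (j < \rank M)%N by exact: ltn_ord (cast_ord sz j).
rewrite /= (nth_map (cast_ord sz j)) ?size_enum_ord//; congr (vec_of (row _ _)).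
by apply: val_inj; rewrite /= nth_enum_ord.
Qed.

Variable P : perfect_dom R.
Local Notation A := (pdom P).
Local Notation C := (smooth_fun P).
Local Notation "M ^@ t" := (map_mx (@sm_ev R P t) M) (at level 8).
Let pA : perfect A := @pdom_perfect R P.

Lemma diff_quotE (f : R -> W) i t : diff_quot f i t = quot (fun s => coord b i (f s)) t.
Proof. by apply/funext => s; rewrite /diff_quot /quot linearB. Qed.

Lemma derivable_withinP (f : R -> W) t : derivable_within A f t <->
  forall i, exists l, has_der A (fun s => coord b i (f s)) t l.
Proof.
by split=> H i; have := H i; rewrite diff_quotE => /cvg_ex.
Qed.

Lemma coord_derive_within (f : R -> W) t i : A t ->
  coord b i (derive_within A f t) = der A (fun s => coord b i (f s)) t.
Proof.
move=> At; rewrite /derive_within coord_sum_free; last exact: basis_free (vbasisP _).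
by rewrite /der diff_quotE; case: asboolP.
Qed.

Lemma coord_derive_withinn (f : R -> W) k t i : A t ->
  coord b i (derive_withinn A k f t) = iter k (der A) (fun s => coord b i (f s)) t.
Proof.
elim: k t => [//|k IH] t At; rewrite iterS coord_derive_within//.
by congr (_ t); apply: der_ext => s As; exact: IH.
Qed.

Lemma smooth_on_iter (g : R -> R) :
  smooth_on A g <-> forall k, diff_on A (iter k (der A) g).
Proof.
split=> [sg k|H k].
  elim: k g sg => [|k IH] g sg; first exact: Cn_diff (sg 0).
  by rewrite iterSr; apply: IH; exact: smooth_on_der.
elim: k g H => [|k IH] g H; split=> //; try exact: (H 0).
by apply: IH => j; have := H j.+1; rewrite iterSr.
Qed.

Lemma smoothP (f : R -> W) :
  smooth A f <-> forall i, smooth_on A (fun s => coord b i (f s)).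
Proof.
split=> [sf i|sf k t At].
  apply/smooth_on_iter => k t At; have /derivable_withinP/(_ i)[l Hl] := sf k t At.
  exists l; apply: has_der_ext Hl => // s As; exact: coord_derive_withinn.
apply/derivable_withinP => i; have /smooth_on_iter/(_ k t At)[l Hl] := sf i.
by exists l; apply: has_der_ext Hl => // s As; rewrite coord_derive_withinn.
Qed.

Lemma smooth_derive (f : R -> W) : smooth A f -> smooth A (derive_within A f).
Proof. by move=> sf k t At; have := sf k.+1 t At; rewrite /derive_withinn iterSr. Qed.

(** The value 0 at a coordinate that is not smooth makes the lift total; every use is for smooth
    curves. *)
Definition lift_row (f : R -> W) : 'rV[C]_n :=
  \row_i if pselect (smooth_on A (fun s => coord b i (f s))) is left h
         then mk_smooth h else 0.

Lemma lift_rowE f t : smooth A f -> A t -> (lift_row f)^@t = row_of (f t).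
Proof.
move=> /smoothP sf At; apply/rowP => i; rewrite !mxE; case: pselect => // h.
by rewrite sm_evE// mk_smoothE.
Qed.

Lemma lift_row_ext (f g : R -> W) : (forall t, A t -> f t = g t) -> smooth A f -> smooth A g ->
  lift_row f = lift_row g.
Proof. by move=> fg sf sg; apply: ev_mx_eq => t At; rewrite !lift_rowE// fg. Qed.

Lemma lift_row_der (f : R -> W) : smooth A f ->
  map_mx (@sm_der R P) (lift_row f) = lift_row (derive_within A f).
Proof.
move=> sf; apply: ev_mx_eq => t At; rewrite (lift_rowE (smooth_derive sf) At).
apply/rowP => i; rewrite !mxE; case: pselect => [h|]; last by have /smoothP := sf.
rewrite sm_evE// coord_derive_within//; congr (_ t); apply: der_ext => s As.
by rewrite mk_smoothE.
Qed.

Lemma lift_row_dern (f : R -> W) k : smooth A f ->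
  iter k (map_mx (@sm_der R P)) (lift_row f) = lift_row (derive_withinn A k f).
Proof.
move=> sf; have sk j : smooth A (derive_withinn A j f).
  by elim: j => [//|j IH]; exact: smooth_derive.
by elim: k => [//|k IH]; rewrite !iterS IH lift_row_der.
Qed.

Lemma smooth_dern (f : R -> W) k : smooth A f -> smooth A (derive_withinn A k f).
Proof. by move=> sf; elim: k => [//|k IH]; exact: smooth_derive. Qed.

Definition curve_of (x : 'rV[C]_n) (t : R) : W := vec_of (x^@t).

Lemma smooth_curve_of x : smooth A (curve_of x).
Proof.
apply/smoothP => i k; apply: Cn_ext (smooth_smfun (x 0 i) k) => t At.
have -> : coord b i (curve_of x t) = row_of (curve_of x t) 0 i by rewrite mxE.
by rewrite vec_ofK mxE sm_evE.
Qed.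

Lemma curve_ofK x : lift_row (curve_of x) = x.
Proof.
by apply: ev_mx_eq => t At; rewrite lift_rowE ?vec_ofK//; exact: smooth_curve_of.
Qed.

End RowCoordinates.

Section FormMatrix.
Variables (R : realType) (W : vectType R) (omega : {skew_symmetric W}).
Hypothesis omega_symplectic : is_psymplectic omega.
Local Notation n := (\dim {:W}).
Local Notation b := (vbasis (fullv : {vspace W})).

Definition form_mx : 'M[R]_n := \matrix_(i, j) omega b`_i b`_j.

Lemma form_skew u v : omega u v = - omega v u.
Proof. by rewrite hermC /= expr1 mulN1r. Qed.

Lemma form_mxE u v : omega u v = (row_of u *m form_mx *m (row_of v)^T) 0 0.
Proof.
rewrite {1}(coord_vbasis (memvf u)) {1}(coord_vbasis (memvf v)) mxE.
rewrite linear_sumr; rewrite /=; apply: eq_bigr => j _; rewrite linear_sumlz !mxE mulr_suml /=.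
by apply: eq_bigr => i _; rewrite linearZlr/= !mxE -mulrA; congr (_ * _); rewrite mulrC.
Qed.

Lemma form_mx_skew : form_mx^T = - form_mx.
Proof. by apply/matrixP => i j; rewrite !mxE [LHS]form_skew. Qed.

Lemma form_mx_unit : form_mx \in unitmx.
Proof.
rewrite -row_free_unit -kermx_eq0; apply/eqP/row_matrixP => i; rewrite row0.
have [/eqP nd _ _] := omega_symplectic.
have : vec_of (row i (kermx form_mx)) \in orthov omega fullv.
  apply/mem_orthovP => v _; rewrite form_mxE vec_ofK -row_mul mulmx_ker row0.
  by rewrite mul0mx mxE.
by rewrite nd memv0 => /eqP e; apply: (can_inj (@vec_ofK _ _)); rewrite e linear0.
Qed.

End FormMatrix.

Section CurveFrame.
Variables (R : realType) (W : vectType R) (m : nat) (dimW : \dim {:W} = m.*2).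
Variables (omega : {skew_symmetric W}) (omega_symplectic : is_psymplectic omega).
Variables (I : set R) (I_itv : is_interval I) (I_nd : I° !=set0).
Variables (Lam : R -> {vspace W}) (Lam_curve : lagrangian_curve omega I m Lam).
Local Notation n := (\dim {:W}).
Local Notation P := (itv_set I_itv I_nd).
Local Notation C := (smooth_fun P).
Local Notation ev t := (@sm_ev R P t).
Local Notation "M ^@ t" := (map_mx (ev t) M) (at level 8).
Local Notation Om := (form_mx omega).
Local Notation S := (@row_symplectic R I I_itv I_nd n Om (form_mx_skew omega)).
Local Notation d := (dsV S).
Local Notation w := (dsw S).
Local Notation "v ^[ k ]" := (iter k d v) (at level 2, format "v ^[ k ]").
Local Notation lift := (@lift_row R W P).
Let pI : perfect I := itv_perfect I_itv I_nd.

Lemma nE : n = (m + m)%N. Proof. by rewrite dimW addnn. Qed.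

Definition spans_fiber t k (Q : 'M[R]_(k, n)) : Prop :=
  forall x : 'rV[R]_n, (x <= Q)%MS <-> vec_of x \in Lam t.

Let orth_proj t (Q : 'M[R]_n) : Prop := [/\ Q^T = Q, Q *m Q = Q & spans_fiber t Q].

Let orth_proj_unique t Q Q' : orth_proj t Q -> orth_proj t Q' -> Q = Q'.
Proof.
move=> [Qt QQ QL] [Qt' QQ' QL']; apply: sym_idem_unique => //.
by apply/eqmxP/andP; split; apply/rV_subP => x; [move/QL/QL'|move/QL'/QL].
Qed.

Let local_proj t0 : I t0 -> exists J : set R, [/\ open J, J t0 &
  exists (pJ : perfect (I `&` J)) (QJ : 'M[R -> R]_n),
   (forall i j, smooth_on (I `&` J) (QJ i j)) /\
   forall t, (I `&` J) t -> orth_proj t (\matrix_(i, j) QJ i j t)].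
Proof.
move=> It0; have [sm lag] := Lam_curve.
have [J [oJ Jt0 [k [X [sX bX]]]]] := sm t0 It0; exists J; split => //.
have pJ := perfect_setI pI oJ; exists pJ.
have neJ : I `&` J !=set0 by exists t0.
pose PJ := PerfectDom neJ pJ.
pose XJ := \matrix_i (lift_row PJ (X i)) : 'M[smooth_fun PJ]_(k, n).
have rowX t i : (I `&` J) t -> row i (map_mx (@sm_ev R PJ t) XJ) = row_of (X i t).
  by move=> At; rewrite -map_row rowK (@lift_rowE _ _ PJ _ t (sX i) At).
have seqX t : (I `&` J) t -> [seq X i t | i : 'I_k] =
    [seq vec_of (row i (map_mx (@sm_ev R PJ t) XJ)) | i : 'I_k].
  by move=> At; apply: eq_map => i; rewrite rowX// row_ofK.
have spanX t : (I `&` J) t -> spans_fiber t (map_mx (@sm_ev R PJ t) XJ).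
  move=> At x; rewrite -[X in (X <= _)%MS]vec_ofK -mem_span_rows -seqX//.
  by rewrite (span_basis (bX t At)).
have rX t : pdom PJ t -> \rank (map_mx (@sm_ev R PJ t) XJ) = m.
  move=> At; have [It _] := At; have [<- _] := lag t It.
  by rewrite -dim_span_rows -seqX// (span_basis (bX t At)).
have [Q [Qt QQ XQ [B QB]]] := constant_rank_projector rX.
exists (\matrix_(i, j) (Q i j : R -> R)); split.
  by move=> i j; rewrite mxE; exact: smooth_smfun.
move=> t At; have -> : \matrix_(i, j) (\matrix_(i, j) (Q i j : R -> R)) i j t =
    map_mx (@sm_ev R PJ t) Q.
  by apply/matrixP => i j; rewrite !mxE sm_evE.
split; [by rewrite map_trmx Qt|by rewrite -map_mxM QQ|].
move=> x; rewrite -(spanX t At); split=> h.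
  by apply: submx_trans h _; rewrite QB map_mxM submxMl.
by apply: submx_trans h _; rewrite -[X in (map_mx _ X <= _)%MS]XQ map_mxM submxMl.
Qed.

(** Local bases need not agree on overlaps, but their orthogonal projectors do, since each depends
    on the fibre alone; so the projectors glue to a smooth global one. *)
Lemma smooth_projector : exists Q : 'M[C]_n, Q *m Q = Q /\
  forall t, I t -> spans_fiber t (Q^@t).
Proof.
have /choice[Q0 HQ] (t : R) : exists Q, I t -> orth_proj t Q.
  have [It|] := pselect (I t); last by exists 0.
  have [J [oJ Jt [pJ [QJ [_ HJ]]]]] := local_proj It.
  by exists (\matrix_(i, j) QJ i j t) => _; exact: HJ.
have sQ i j : smooth_on I (fun t => Q0 t i j).
  move=> k; apply: Cn_local pI => t It.
  have [J [oJ Jt [pJ [QJ [sJ HJ]]]]] := local_proj It.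
  exists J; split=> //; apply: Cn_ext (sJ i j k) => s [Is Js].
  by rewrite (orth_proj_unique (HQ s Is) (HJ s (conj Is Js))) mxE.
pose Q : 'M[C]_n := \matrix_(i, j) mk_smooth (sQ i j : smooth_on (pdom P) _).
have QE t : I t -> Q^@t = Q0 t.
  by move=> It; apply/matrixP => i j; rewrite !mxE sm_evE// mk_smoothE.
exists Q; split; last by move=> t It; rewrite QE//; have [] := HQ t It.
by apply: ev_mx_eq => t It; rewrite map_mxM QE//; have [] := HQ t It.
Qed.

Lemma fiber_rank t k (Q : 'M[R]_(k, n)) : I t -> spans_fiber t Q -> \rank Q = m.
Proof.
move=> It HQ; have [_ /(_ t It) [<- _]] := Lam_curve.
rewrite -dim_span_rows; congr (\dim _); apply/vspaceP => v.
by rewrite mem_span_rows; apply/idP/idP => [/HQ|h]; [rewrite row_ofK|apply/HQ; rewrite row_ofK].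
Qed.

Lemma curve_frame : exists X : 'M[C]_(m, n), forall t, I t ->
  row_free (X^@t) /\ spans_fiber t (X^@t).
Proof.
have [Q [QQ HQ]] := smooth_projector.
have [|X HX] := @smooth_frame _ _ I_itv I_nd n m Q QQ.
  by move=> t It; exact: fiber_rank (HQ t It).
exists X => t It; have [fX XQ] := HX t It; split=> // x.
by rewrite XQ; exact: HQ.
Qed.

Section WithFrame.
Variable X : 'M[C]_(m, n).
Hypothesis HX : forall t, I t -> row_free (X^@t) /\ spans_fiber t (X^@t).

Lemma form_lift f g t : smooth I f -> smooth I g -> I t ->
  ev t (w (lift f) (lift g)) = omega (f t) (g t).
Proof. by move=> sf sg It; rewrite ev_form form_mxE !(@lift_rowE _ _ P). Qed.

Lemma ev_w_vec u v t : ev t (w u v) = omega (vec_of (u^@t)) (vec_of (v^@t)).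
Proof. by rewrite ev_form form_mxE !vec_ofK. Qed.

Lemma frame_iso i j : w (row i X) (row j X) = 0.
Proof.
apply: sm_ev_eq => t It; rewrite ev_w_vec rmorph0.
have [_ /(_ t It) [_ lag]] := Lam_curve; have [_ sX] := HX It.
by apply: lag; apply/sX; rewrite map_row row_sub.
Qed.

Local Notation sect := (@section R I I_itv I_nd n m Om (form_mx_skew omega) X).

Lemma sectP v : sect v <-> forall t, I t -> vec_of (v^@t) \in Lam t.
Proof.
split=> [sv t It|H i].
  have [fX sX] := HX It; apply/sX.
  apply: (section_sub (nE) (form_mx_unit omega_symplectic) _ frame_iso sv It).
  by move=> s Is; have [] := HX Is.
apply: sm_ev_eq => t It; rewrite ev_w_vec rmorph0.
have [_ /(_ t It) [_ lag]] := Lam_curve; have [_ sX] := HX It.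
by apply: lag; [exact: H|apply/sX; rewrite map_row row_sub].
Qed.

Lemma sect_lift f : smooth I f -> sect (lift f) <-> forall t, I t -> f t \in Lam t.
Proof.
move=> sf; rewrite sectP; split=> H t It; have := H t It;
  by rewrite (@lift_rowE _ _ P)// row_ofK.
Qed.

Lemma sections_lift f : sections I Lam f <-> smooth I f /\ sect (lift f).
Proof. by split=> [[sf H]|[sf /(sect_lift sf) H]]; split => //; exact/(sect_lift sf). Qed.

Lemma d_lift f : smooth I f -> d (lift f) = lift (derive_within I f).
Proof. exact: (@lift_row_der _ _ P). Qed.

Lemma dn_lift f k : smooth I f -> (lift f)^[k] = lift (derive_withinn I k f).
Proof. exact: (@lift_row_dern _ _ P). Qed.

Let comb_jets (c : 'rV[C]_m) k : exists g : nat -> 'rV[C]_m,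
  (c *m X)^[k] = \sum_(j < k.+1) \sum_i g j 0 i *: (row i X)^[j].
Proof.
elim: k => [|k [g IH]].
  by exists (fun=> c); rewrite big_ord1 /= mulmx_sum_row.
exists (fun j => (if (j < k.+1)%N then map_mx (@sm_der R P) (g j) else 0) +
                 (if j is j'.+1 then g j' else 0)).
rewrite iterS IH (raddf_sum d).
under eq_bigr => j _ do rewrite (raddf_sum d).
under [RHS]eq_bigr => j _.
  under eq_bigr => i _ do rewrite mxE scalerDl.
  rewrite big_split/=; over.
rewrite big_split/= [X in _ = X + _]big_ord_recr/= ltnn [X in _ + X + _](_ : _ = 0) ?addr0; last first.
  by rewrite big1// => i _; rewrite mxE scale0r.
rewrite [X in _ + X]big_ord_recl/= [X in _ + (X + _)](_ : _ = 0) ?add0r; last first.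
  by rewrite big1// => i _; rewrite mxE scale0r.
rewrite -big_split; apply: eq_bigr => j _ /=; rewrite -big_split; apply: eq_bigr => i _ /=.
by rewrite ltn_ord mxE; exact: (dsVZ S).
Qed.

Let jet_index q : finType := (ordinal q.+1 * ordinal m)%type.
Let jet_mx q : 'M[C]_(#|jet_index q|, n) := fam_mx (@jets R I I_itv I_nd n m Om (form_mx_skew omega) X q).

(** Every section l is c X with smooth coefficients c = l X^T (X X^T)^-1, so by the Leibniz formula
    the jets of the rows of [X] span the extension. *)
Lemma extension_span q t : I t -> extension I Lam q t =
  <<[seq vec_of (row i ((jet_mx q)^@t)) | i : 'I_#|jet_index q|]>>%VS.
Proof.
move=> It; have [XX Xs] := HX It.
have [H1 H2] := vspanP [set v | exists2 l, sections I Lam l &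
                 exists2 j, (j <= q)%N & v = derive_withinn I j l t].
have jetE (j : 'I_q.+1) i : row (enum_rank (j, i)) ((jet_mx q)^@t) = ((row i X)^[j])^@t.
  by rewrite row_fam_mx enum_rankK.
apply/eqP; rewrite eqEsubv; apply/andP; split.
  apply: H2 => v [l Hl [k kq ->]].
  have [sl /sectP ls] := (sections_lift l).1 Hl.
  have GX : X *m X^T \in unitmx.
    rewrite unitmxE; apply: sm_ev_unit => s Is; rewrite -det_map_mx map_mxM -map_trmx.
    by rewrite -unitfE -unitmxE gram_unit//; have [] := HX Is.
  have cE : lift l = (lift l *m X^T *m invmx (X *m X^T)) *m X.
    apply: ev_mx_eq => s Is; have [fs sX] := HX Is.
    have /submxP[c cE] : ((lift l)^@s <= X^@s)%MS by apply/sX; exact: ls.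
    have h := congr1 (map_mx (ev s)) (mulmxV GX); rewrite !map_mxM map_mx1 in h.
    by rewrite !map_mxM/= cE -!mulmxA (mulmxA (X^@s)) (mulmxA (X^@s *m _)) h mul1mx.
  rewrite mem_span_rows.
  have <- : ((lift l)^[k])^@t = row_of (derive_withinn I k l t).
    by rewrite dn_lift// (@lift_rowE _ _ P)//; exact: (@smooth_dern _ _ P).
  rewrite cE; set c := (lift l *m _ *m _); have [g ->] := comb_jets c k.
  rewrite map_mx_sum; apply: summx_sub => j _.
  rewrite map_mx_sum; apply: summx_sub => i _.
  rewrite map_mxZ; apply: scalemx_sub.
  have jq : (j < q.+1)%N by apply: leq_trans (ltn_ord j) _.
  by rewrite -(jetE (Ordinal jq) i) row_sub.
apply/span_subvP => v /mapP[y _ ->].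
rewrite -[y]enum_valK; case: (enum_val y) => j i; rewrite jetE.
apply: H1; exists (curve_of (row i X)).
  apply/sections_lift; split; first exact: (@smooth_curve_of _ _ P).
  by rewrite curve_ofK => j'; exact: frame_iso.
exists j; first by rewrite -ltnS.
have sc := @smooth_curve_of _ _ P (row i X).
have := dn_lift j sc; rewrite curve_ofK => ->.
by rewrite (@lift_rowE _ _ P) ?row_ofK//; exact: (@smooth_dern _ _ P).
Qed.

Lemma dim_extension q t : I t -> \dim (extension I Lam q t) = \rank ((jet_mx q)^@t).
Proof. by move=> It; rewrite extension_span// dim_span_rows. Qed.

End WithFrame.
End CurveFrame.

(** * Young diagrams and superboxes *)

Section PairTuple.
Local Open Scope nat_scope.

Lemma size_pair_tuple q p : 0 < p -> size (pair_tuple q p) = p.*2 - 1 + (q - p).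
Proof. by move=> p0; rewrite size_cat !size_map !size_iota. Qed.

Lemma nth_pair_tuple q p k : 0 < p -> k < p.*2 - 1 + (q - p) ->
  nth (0, 0) (pair_tuple q p) k =
    if k < p.*2 - 1 then (k./2, uphalf k) else (k.+1 - p, p.-1).
Proof.
move=> p0 kq; rewrite nth_cat size_map size_iota; case: ifP => kp.
  by rewrite (nth_map 0) ?size_iota// nth_iota.
rewrite (nth_map 0) ?size_iota ?nth_iota; try by lia.
by congr (_, _); lia.
Qed.

Lemma mem_pair_tuple q p x y : 0 < p ->
  ((x, y) \in pair_tuple q p) =
  ((y == x) || (y == x.+1)) && (y < p) || (y == p.-1) && (p <= x < q).
Proof.
move=> p0; apply/idP/idP.
  move=> /(nthP (0, 0))[k]; rewrite size_pair_tuple// => kq.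
  by rewrite nth_pair_tuple//; case: ifP => kp [<- <-]; lia.
move=> H; have [k [kq ke]] : exists k, k < p.*2 - 1 + (q - p) /\
    (if k < p.*2 - 1 then (k./2, uphalf k) else (k.+1 - p, p.-1)) = (x, y).
  (* The coordinates of the pair in position k sum to k. *)
  by exists (x + y); split; [lia|case: ifP => h; congr (_, _); lia].
by apply/(nthP (0, 0)); exists k; rewrite ?size_pair_tuple// nth_pair_tuple.
Qed.

(** The position of a pair in the tuple is its coordinate sum, so an initial segment of the tuple is
    cut out by a bound on x + y. *)
Lemma mem_take_pair_tuple q p x y : 0 < p -> x + y < q - p - 1 ->
  (x, y) \in pair_tuple q p -> (x, y) \in take (q - p - 1) (pair_tuple q p).
Proof.
move=> p0 xyq /(nthP (0, 0))[k]; rewrite size_pair_tuple// => kq ke.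
have kxy : k = x + y by move: ke; rewrite nth_pair_tuple//; case: ifP => kp [<- <-]; lia.
apply/(nthP (0, 0)); exists k; last by rewrite nth_take ?ke// kxy.
by rewrite size_take size_pair_tuple//; case: ifP; lia.
Qed.

Lemma take_pair_tuple_lt q p x y : 0 < p ->
  (x, y) \in take (q - p - 1) (pair_tuple q p) -> x + y < q - p - 1.
Proof.
move=> p0 /(nthP (0, 0))[k]; rewrite size_take size_pair_tuple// => kq.
have {}kq : k < q - p - 1 by move: kq; case: ifP; lia.
by rewrite nth_take// nth_pair_tuple//; [case: ifP => kp [<- <-]; lia|lia].
Qed.

End PairTuple.

Lemma big_tagged (A : Type) (idx : A) (op : Monoid.com_law idx) (J : finType)
    (K : J -> finType) (G : {i : J & K i} -> A) :
  \big[op/idx]_r G r = \big[op/idx]_(i : J) \big[op/idx]_(k : K i) G (Tagged K k).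
Proof. by rewrite (sig_big_dep _ _ (fun (i : J) (k : K i) => G (Tagged K k))); apply: eq_bigr => -[]. Qed.

Lemma sum_min_column (D : seq nat) q :
  (\sum_(x <- D) minn x q.+1 = \sum_(x <- D) minn x q + column D q.+1)%N.
Proof.
rewrite /column -sum1_count [X in _ = (_ + X)%N]big_mkcond/= -big_split; apply: eq_bigr => x _ /=.
by case: ifP; lia.
Qed.

Section YoungRows.
Variables (D : seq nat) (D_young : is_young D).
Implicit Types (i j : 'I_(depth D)).

Lemma width_mem i : width i \in D.
Proof. by rewrite -mem_undup mem_nth. Qed.

Lemma width_gt0 i : (0 < width i)%N.
Proof.
have /andP[_ D0] := D_young; rewrite lt0n; apply: contra D0 => /eqP <-.
exact: width_mem.
Qed.

Lemma width_inj : injective (@width D).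
Proof.
move=> i j /eqP; rewrite /width nth_uniq ?undup_uniq ?(ltn_ord i) ?(ltn_ord j)//.
by move/eqP/val_inj.
Qed.

Lemma width_le i j : (width j <= width i)%N = (i <= j)%N.
Proof.
have /andP[Ds _] := D_young.
have Us : sorted geq (undup D).
  by apply: subseq_sorted Ds; [move=> x y z /= ? h; exact: leq_trans h _|exact: undup_subseq].
have le i' j' : (i' <= j')%N -> (width j' <= width i')%N.
  move=> ij; apply: (sorted_leq_nth (leT := geq) _ _ _ Us) => //; rewrite ?inE ?ltn_ord//.
    by move=> x y z /= h1 h2; exact: leq_trans h2 h1.
  by move=> x /=.
apply/idP/idP => [|/le//]; apply: contraTT; rewrite -!ltnNge => ji.
rewrite ltn_neqAle le ?(ltnW ji)// andbT; apply/eqP => /width_inj e.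
by move: ji; rewrite e ltnn.
Qed.

Lemma width_lt i j : (width j < width i)%N = (i < j)%N.
Proof. by rewrite !ltnNge width_le. Qed.

(** A row of the whole diagram, given as a rectangle and a row in it. The algebra indexes boxes by
    row and column, with rows instead of superboxes, which replaces the matrix blocks by scalar
    entries. *)
Definition young_row : finType := {i : 'I_(depth D) & 'I_(height i)}.
Implicit Types r l : young_row.
Definition row_width r : nat := width (tag r).

Lemma row_width_gt0 r : (0 < row_width r)%N.
Proof. exact: width_gt0. Qed.

Lemma sum_young_rows (F : nat -> nat) :
  (\sum_(r : young_row) F (row_width r) = \sum_(x <- D) F x)%N.
Proof.
rewrite big_tagged.
under eq_bigr => i _ do rewrite /row_width/= sum_nat_const card_ord.
rewrite -[RHS]big_undup_iterop_count [RHS](big_nth 0%N) big_mkord; apply: eq_bigr => i _.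
by rewrite Monoid.iteropE iter_addn_0 mulnC.
Qed.

Definition box_row (z : box D) : young_row :=
  Tagged (fun i => 'I_(height i)) (tagged z : 'I_(height (level (tag z)))).
Definition box_col (z : box D) : nat := sbcol (tag z).

Definition row_box r (c : 'I_(row_width r)) : box D := bx (a := sbox c) (tagged r).

Lemma row_boxK r (c : 'I_(row_width r)) : box_row (row_box c) = r.
Proof. by case: r c. Qed.

Lemma box_col_lt z : (box_col z < row_width (box_row z))%N.
Proof. exact: ltn_ord. Qed.

Lemma box_rowcol_ind (Q : young_row -> nat -> Prop) :
  (forall z, Q (box_row z) (box_col z)) -> forall r x, (x < row_width r)%N -> Q r x.
Proof. by move=> H r x xr; have := H (row_box (Ordinal xr)); rewrite row_boxK. Qed.

Lemma box_rowcolE z z' :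
  ((box_row z == box_row z') && (box_col z == box_col z')) = (z == z').
Proof.
apply/andP/eqP => [[/eqP h /eqP]|->//].
case: z z' h => [[i c] k] [[j c'] k'] /= h; have ij := congr1 tag h; move: ij => /= ij.
subst j => /= e; rewrite /box_col/= in e; have {}e : c = c' by exact: val_inj.
subst c'; congr (existT _ _ _); have /eqP := h.
by rewrite eq_Tagged => /eqP.
Qed.

Lemma sum_rows_boxes (A : nmodType) (F : young_row -> nat -> A) :
  \sum_r \sum_(y < row_width r) F r y =
  \sum_(b : superbox D) \sum_(k < ssize b) F (box_row (bx k)) (sbcol b).
Proof.
by rewrite !big_tagged; apply: eq_bigr => i _; rewrite /row_width /= [LHS]exchange_big.
Qed.

Lemma card_box : #|{: box D}| = (\sum_(x <- D) x)%N.
Proof.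
rewrite -(sum_young_rows id).
transitivity (\sum_(r : young_row) \sum_(y < row_width r) 1)%N; last first.
  by apply: eq_bigr => r _; rewrite sum_nat_const card_ord muln1.
rewrite [RHS](@sum_rows_boxes nat (fun _ _ => 1%N)) card_tagged sumnE big_map big_enum/=.
by apply: eq_bigr => b _; rewrite -sum1_card.
Qed.

End YoungRows.

Section Families.
Variables (R : fieldType) (W : vectType R).

Lemma free_family (F : finType) (g : F -> W) :
  (forall c : F -> R, \sum_z c z *: g z = 0 -> forall z, c z = 0) ->
  free [seq g z | z : F].
Proof.
move=> H; rewrite -[[seq _ | z : _]]in_tupleE; apply/freeP => c c0 i.
have sz : size [seq g z | z : F] = #|F| by rewrite size_map -cardE.
have := H (fun z => c (cast_ord (esym sz) (enum_rank z))).
rewrite (reindex (fun j : 'I_(size [seq g z | z : F]) => enum_val (cast_ord sz j))); last first.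
  exists (fun z => cast_ord (esym sz) (enum_rank z)) => j _.
    by rewrite enum_valK cast_ordK.
  by rewrite cast_ordKV enum_rankK.
move=> /(_ _ (enum_val (cast_ord sz i))); rewrite enum_valK cast_ordK; apply.
rewrite -[RHS]c0; apply: eq_bigr => j _; rewrite enum_valK cast_ordK; congr (_ *: _).
have jr : (j < size (enum F))%N by rewrite -cardE -sz.
rewrite /= (nth_map (enum_val (cast_ord sz j)))//; congr g.
exact: enum_val_nth.
Qed.

Lemma free_cat_family (F G : finType) (g : F -> W) (h : G -> W) :
  (forall (c : F -> R) (c' : G -> R), \sum_z c z *: g z + \sum_z c' z *: h z = 0 ->
     (forall z, c z = 0) /\ (forall z, c' z = 0)) ->
  free ([seq g z | z : F] ++ [seq h z | z : G]).
Proof.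
move=> H; pose gh (z : F + G) := match z with inl x => g x | inr y => h y end.
have -> : [seq g z | z : F] ++ [seq h z | z : G] = [seq gh z | z : F + G].
  have e : enum (@predT (F + G)%type) = map inl (enum F) ++ map inr (enum G).
    by rewrite !enumT [in LHS]unlock.
  by rewrite /image_mem e map_cat -!map_comp.
apply: free_family => c; rewrite big_sumType /= => /H[H1 H2].
by case=> z; [exact: H1|exact: H2].
Qed.

End Families.

Section FrameRows.
Variables (R : realType) (W : vectType R) (P : perfect_dom R) (D : seq nat).
Hypothesis D_young : is_young D.
Local Notation A := (pdom P).
Local Notation C := (smooth_fun P).
Local Notation n := (\dim {:W}).
Local Notation lift := (@lift_row R W P).
Local Notation T := (young_row D).
Local Notation p := (@row_width D).
Implicit Types (e f : box D -> R -> W).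

Definition frame_row e (r : T) (x : nat) : 'rV[C]_n :=
  if insub x is Some c then lift (e (row_box (r := r) c)) else 0.

Lemma frame_row_box e z : frame_row e (box_row z) (box_col z) = lift (e z).
Proof.
case: z => [[i c] k]; rewrite /frame_row /box_row /box_col /sbcol /=.
by rewrite /row_width/= valK.
Qed.

Lemma frame_row_curve_of (E : T -> nat -> 'rV[C]_n) r x : (x < p r)%N ->
  frame_row (fun z => curve_of (E (box_row z) (box_col z))) r x = E r x.
Proof.
move: r x; apply: box_rowcol_ind => z.
by rewrite frame_row_box curve_ofK.
Qed.

Lemma lift_eqP (g h : R -> W) : smooth A g -> smooth A h ->
  (forall t, A t -> g t = h t) <-> lift g = lift h.
Proof.
move=> sg sh; split=> [gh|gh t At]; first exact: lift_row_ext.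
by apply: (can_inj (@row_ofK R W)); rewrite -!(lift_rowE _ At)// gh.
Qed.

End FrameRows.

Section Superboxes.
Variables (D : seq nat) (D_young : is_young D).
Implicit Types a b : superbox D.

Lemma superbox_eq a b : level a = level b -> sbcol a = sbcol b -> a = b.
Proof.
case: a b => [i c] [j c']; rewrite /level /sbcol /= => ij; subst j => cc.
by congr (existT _ _ _); exact: val_inj.
Qed.

Lemma sbcol_lt a : (sbcol a < width (level a))%N.
Proof. exact: ltn_ord. Qed.

Lemma sbcol_sleft a : ~~ in_first_column a -> sbcol (sleft a) = (sbcol a).-1.
Proof.
rewrite /in_first_column -lt0n => a0; have := sbcol_lt a.
have -> : sbcol (sleft a) = ((sbcol a + width (level a)).-1 %% width (level a))%N by [].
move=> aw; rewrite (_ : (_ + _).-1 = (sbcol a).-1 + width (level a))%N; last by lia.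
by rewrite modnDr modn_small//; lia.
Qed.

Lemma sbcol_sright a : ~~ special a -> sbcol (sright a) = (sbcol a).+1.
Proof.
rewrite /special => aw; rewrite {1}/sbcol /sright /= modn_small//.
by rewrite ltn_neqAle aw sbcol_lt.
Qed.

Lemma nonspecial_lt a : ~~ special a = ((sbcol a).+1 < width (level a))%N.
Proof. by rewrite /special ltn_neqAle sbcol_lt andbT. Qed.

End Superboxes.

(** * Normal mappings as conditions on the curvature *)

Section NormalMappings.
Variables (R : realType) (P : perfect_dom R) (D : seq nat).
Hypothesis D_young : is_young D.
Local Notation C := (smooth_fun P).
Local Notation ev t := (@sm_ev R P t).
Local Notation T := (young_row D).
Local Notation p := (@row_width D).
Variables (V : lmodType C) (S : diff_symplectic V) (f : T -> nat -> V).
Local Notation c := (curvature S f).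
Variable M : R -> compatible_mapping D R.
Hypothesis M_c : forall t (a b : superbox D) j k, pdom P t ->
  M t a b j k = ev t (c (box_row (bx k)) (sbcol a) (box_row (bx j)) (sbcol b)).

Let c0 (a b : superbox D) j k : (forall t, pdom P t -> M t a b = 0) ->
  c (box_row (bx (a := a) k)) (sbcol a) (box_row (bx (a := b) j)) (sbcol b) = 0.
Proof.
by move=> H; apply: sm_ev_eq => t Pt; rewrite -M_c// H// mxE rmorph0.
Qed.

(** [quasi_normal] lists what may be nonzero and [normal_curvature] what must vanish;
    [mem_pair_tuple] matches the two, with levels compared through their widths. *)
Lemma normal_mapping_curvature : (forall t, pdom P t -> normal_mapping (M t)) ->
  normal_curvature S p f.
Proof.
move=> nM.
have zero (a b : superbox D) t : pdom P t -> (level a <= level b)%N ->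
    b <> a -> ~ (~~ special a /\ b = sright a) -> ~ (~~ special b /\ a = sright b) ->
    ~ ((level a < level b)%N /\ (sbcol a, sbcol b) \in pairs_of a b) -> M t a b = 0.
  move=> Pt ab h1 h2 h3 h4; have [[_ q _] _] := nM t Pt.
  by apply/eqP/negPn/negP => /(q _ _ ab) [].
have lev (a b : superbox D) : (width (level b) < width (level a))%N ->
    [/\ b <> a, ~ (~~ special a /\ b = sright a) & ~ (~~ special b /\ a = sright b)].
  move=> ba; split=> [e|[_ e]|[_ e]]; by rewrite e /= ltnn in ba.
split.
- move=> r x l y xr; move: l y; apply: box_rowcol_ind => -[b j].
  move: r x xr; apply: box_rowcol_ind => -[a k] ba xy.
  rewrite /box_col/= in xy *; apply: c0 => t Pt; apply: zero => //.
  + by rewrite -width_le.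
  + by move=> e; move: xy; rewrite e ltnNge leqnSn.
  + by move=> [sa e]; move: xy; rewrite e sbcol_sright// ltnn.
  + by move=> [sb e]; move: xy; rewrite e sbcol_sright// ltnNge !leqW.
  + move=> [ab]; rewrite /pairs_of mem_pair_tuple ?width_gt0//.
    move: xy; rewrite /box_row/= => xy; lia.
- move=> r x l y xr; move: l y; apply: box_rowcol_ind => -[b j].
  move: r x xr; apply: box_rowcol_ind => -[a k] ba yx yb.
  rewrite /box_col/= in yx *; have [h1 h2 h3] := lev _ _ ba.
  apply: c0 => t Pt; apply: zero => //; first by rewrite ltnW// -width_lt.
  move=> [ab]; rewrite /pairs_of mem_pair_tuple ?width_gt0//.
  by move: yb; rewrite /box_col /row_width /box_row/= => yb; lia.
- move=> r x l y xr; move: l y; apply: box_rowcol_ind => -[b j].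
  move: r x xr; apply: box_rowcol_ind => -[a k] ba xyN.
  rewrite /box_col/= in xyN *; have [h1 h2 h3] := lev _ _ ba.
  have ab : (level a < level b)%N by rewrite -width_lt.
  apply: c0 => t Pt.
  have [inab|ninab] := boolP ((sbcol a, sbcol b) \in pairs_of a b); last first.
    by apply: zero => //; [exact: ltnW|move=> [_ h]; rewrite h in ninab].
  have [_ nm] := nM t Pt; apply: nm => //; apply: mem_take_pair_tuple => //.
    exact: width_gt0.
  by move: xyN; rewrite /row_width /box_row/=; lia.
- move=> r l x rl xr; have xr' := ltnW xr; move: r x xr' l rl xr.
  apply: box_rowcol_ind => -[a k] [i j] /width_inj/= e; rewrite -e in j *.
  rewrite /row_width /box_row /box_col /= => ar.
  have sa : ~~ special a by rewrite nonspecial_lt.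
  rewrite -(sbcol_sright sa); apply: sm_ev_eq => t Pt.
  have [[_ _ as_] _] := nM t Pt; have := as_ a sa.
  move=> /(congr1 (fun B : 'M[R]_(ssize a, ssize a) => B k j)); rewrite !mxE.
  have E1 := @M_c t a (sright a) j k Pt; have E2 := @M_c t a (sright a) k j Pt.
  by rewrite E1 E2 rmorphN.
Qed.

Hypothesis c_sym : forall r x l y, (x < p r)%N -> (y < p l)%N -> c r x l y = c l y r x.

(** The vanishing clauses are stated for one order of the columns; on a common level the other order
    follows from the symmetry of the curvature. *)
Lemma curvature_normal_mapping : normal_curvature S p f ->
  forall t, pdom P t -> normal_mapping (M t).
Proof.
move=> [nc1 nc2 nc3 nc4] t Pt.
have lt (a : superbox D) (k : 'I_(ssize a)) : (sbcol a < p (box_row (bx k)))%N.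
  exact: sbcol_lt.
have nz (a b : superbox D) : M t a b != 0 -> exists j k,
    c (box_row (bx (a := a) k)) (sbcol a) (box_row (bx (a := b) j)) (sbcol b) <> 0.
  move=> M0; have [] := pselect (exists j k,
    c (box_row (bx (a := a) k)) (sbcol a) (box_row (bx (a := b) j)) (sbcol b) <> 0) => //.
  move=> H; case/negP: M0; apply/eqP/matrixP => j k; rewrite M_c// mxE.
  by have /forallNP/(_ j)/forallNP/(_ k)/contrapT -> := H; rewrite rmorph0.
split; last first.
  move=> a b ab /take_pair_tuple_lt xy; apply/matrixP => j k; rewrite M_c// mxE.
  rewrite nc3 ?rmorph0//; first by rewrite /row_width/= width_lt.
  by have := xy (width_gt0 D_young _); rewrite /row_width/=; lia.
split.
- by move=> a b; apply/matrixP => j k; rewrite mxE !M_c// c_sym.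
- move=> a b; rewrite leq_eqVlt => /orP[/eqP/val_inj ab|ab] /nz[j [k cn]].
    have [xy|xy|xy] := ltngtP (sbcol a) (sbcol b); last first.
    + by constructor 1; apply: superbox_eq.
    + have e : sbcol a = (sbcol b).+1.
        apply/eqP; rewrite eqn_leq xy andbT leqNgt; apply/negP => xy'; apply: cn.
        by rewrite c_sym// nc1// /row_width /= /ssize ab.
      have sb : ~~ special b by rewrite nonspecial_lt -e -ab sbcol_lt.
      constructor 3; split=> //; apply: superbox_eq; first exact: ab.
      by rewrite sbcol_sright.
    have e : sbcol b = (sbcol a).+1.
      apply/eqP; rewrite eqn_leq xy andbT leqNgt; apply/negP => xy'; apply: cn.
      by rewrite nc1// /row_width /= ab.
    have sa : ~~ special a by rewrite nonspecial_lt -e ab sbcol_lt.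
    constructor 2; split=> //; apply: superbox_eq; first exact: (esym ab).
    by rewrite sbcol_sright.
  constructor 4; split=> //; rewrite /pairs_of mem_pair_tuple ?width_gt0//.
  have ww : (width (level b) < width (level a))%N by rewrite width_lt.
  have h1 : ~ ((sbcol a).+1 < sbcol b)%N.
    by move=> xy; apply: cn; rewrite nc1// /row_width/= ltnW.
  have h2 : ~ ((sbcol b < sbcol a)%N /\ ((sbcol b).+1 < width (level b))%N).
    by move=> [xy xy']; apply: cn; rewrite nc2.
  by have := sbcol_lt a; have := sbcol_lt b; lia.
- move=> a sa; apply/matrixP => j k; rewrite !mxE !M_c// sbcol_sright//.
  rewrite nc4 ?rmorphN//; by rewrite /row_width/= -nonspecial_lt.
Qed.

End NormalMappings.

(** * Normal moving frames *)

Section DarbouxFrames.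
Variables (R : realType) (W : vectType R) (omega : {skew_symmetric W}).
Variables (D : seq nat) (e f : box D -> R -> W) (t : R).

Let w0r u : omega u 0 = 0. Proof. exact: linear0r. Qed.
Let w_comb u (c : box D -> R) (g : box D -> R -> W) :
  omega u (\sum_z c z *: g z t) = \sum_z c z * omega u (g z t).
Proof. by rewrite linear_sumr /=; apply: eq_bigr => z _; rewrite linearZr_LR. Qed.

Let pick (c : box D -> R) z0 : \sum_z c z * (z0 == z)%:R = c z0.
Proof.
rewrite (bigD1 z0)//= eqxx mulr1 big1 ?addr0// => z /negPf z0z.
by rewrite eq_sym z0z mulr0.
Qed.

Lemma darboux_free : darboux omega e f t ->
  free ([seq e z t | z : box D] ++ [seq f z t | z : box D]).
Proof.
move=> ef; apply: free_cat_family => c c' H; split=> z0.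
  have := congr1 (omega (f z0 t)) H; rewrite w0r linearDr /= !w_comb.
  rewrite [X in _ + X]big1 ?addr0 => [|z _]; last by have [_ -> _] := ef z0 z; rewrite mulr0.
  move=> h; rewrite -[LHS]pick; apply: etrans h.
  by apply: eq_bigr => z _; have [_ _ ->] := ef z0 z.
have := congr1 (omega (e z0 t)) H; rewrite w0r linearDr /= !w_comb.
rewrite big1 ?add0r => [|z _]; last by have [-> _ _] := ef z0 z; rewrite mulr0.
move=> h; apply: oppr_inj; rewrite oppr0 -[X in - X]pick -sumrN; apply: etrans h.
apply: eq_bigr => z _; have [_ _ fe] := ef z z0.
by rewrite form_skew fe mulrN eq_sym.
Qed.

Lemma frame_nondegenerate v : is_psymplectic omega -> is_frame e f t ->
  (forall z, omega v (e z t) = 0) -> (forall z, omega v (f z t) = 0) -> v = 0.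
Proof.
move=> [/eqP nd _ _] /span_basis fr ve vf.
suff : v \in orthov omega fullv by rewrite nd memv0 => /eqP.
apply/mem_orthovP => u; rewrite -fr span_cat => /memv_addP[u1 u1e [u2 u2f ->]].
have w0 g u' : (forall z, omega v (g z t) = 0) ->
    u' \in <<[seq g z t | z : box D]>>%VS -> omega v u' = 0.
  move=> gv; rewrite -[[seq _ | z : _]]in_tupleE => /coord_span ->.
  rewrite linear_sumr/= big1// => i _; rewrite linearZr_LR /=.
  have /mapP[z _ ->] : [seq g z t | z : box D]`_i \in [seq g z t | z : box D].
    by rewrite mem_nth.
  by rewrite gv mulr0.
by rewrite linearDr /= (w0 _ _ ve u1e) (w0 _ _ vf u2f) addr0.
Qed.

Variable m : nat.
Hypotheses (dimW : \dim {:W} = m.*2) (sumD : (\sum_(x <- D) x = m)%N).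

Lemma darboux_is_frame : darboux omega e f t -> is_frame e f t.
Proof.
move=> ef; rewrite /is_frame basisEfree darboux_free// subvf/= size_cat !size_image.
by rewrite card_box sumD dimW addnn.
Qed.

Lemma darboux_lagrangian_span (L : {vspace W}) : darboux omega e f t -> \dim L = m ->
  (forall z, e z t \in L) -> L = <<[seq e z t | z : box D]>>%VS.
Proof.
move=> ef dL eL; apply/esym/eqP; rewrite eqEdim dL.
have /catl_free := darboux_free ef; rewrite /free => /eqP ->.
rewrite size_image card_box sumD leqnn andbT.
by apply/span_subvP => v /mapP[z _ ->].
Qed.

End DarbouxFrames.

Section NormalMovingFrames.
Variables (R : realType) (W : vectType R) (m : nat) (dimW : \dim {:W} = m.*2).
Variables (omega : {skew_symmetric W}) (omega_symplectic : is_psymplectic omega).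
Variables (I : set R) (I_itv : is_interval I) (I_nd : I° !=set0).
Variables (Lam : R -> {vspace W}) (Lam_curve : lagrangian_curve omega I m Lam).
Variables (D : seq nat) (D_young : is_young D) (sumD : (\sum_(x <- D) x = m)%N).
Local Notation n := (\dim {:W}).
Local Notation P := (itv_set I_itv I_nd).
Local Notation C := (smooth_fun P).
Local Notation ev t := (@sm_ev R P t).
Local Notation "M ^@ t" := (map_mx (ev t) M) (at level 8).
Local Notation Om := (form_mx omega).
Local Notation S := (@row_symplectic R I I_itv I_nd n Om (form_mx_skew omega)).
Local Notation d := (dsV S).
Local Notation w := (dsw S).
Local Notation lift := (@lift_row R W P).
Local Notation T := (young_row D).
Local Notation p := (@row_width D).
Local Notation fr := (@frame_row R W P D).
Variables (e f : box D -> R -> W).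
Hypotheses (se : forall z, smooth I (e z)) (sf : forall z, smooth I (f z)).

Lemma darboux_pairings_rows : (forall t, I t -> darboux omega e f t) <->
  darboux_pairings S p (fr e) (fr f).
Proof.
split=> [ef r x l y xr|ef t It z z'].
  move: l y; apply: box_rowcol_ind => z'; move: r x xr; apply: box_rowcol_ind => z.
  rewrite !frame_row_box box_rowcolE.
  split; apply: sm_ev_eq => t It; have [E1 E2 E3] := ef t It z z'; rewrite form_lift//.
  - by rewrite E1 rmorph0.
  - by rewrite E2 rmorph0.
  - by rewrite E3 rmorph_nat.
have := ef _ _ _ _ (box_col_lt z) (box_col_lt z'); rewrite !frame_row_box box_rowcolE.
move=> [E1 E2 E3]; rewrite -!(form_lift omega I_itv I_nd _ _ It)// E1 E2 E3.
by rewrite !rmorph0 rmorph_nat.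
Qed.

Lemma e_equations_rows : e_equations S p (fr e) (fr f) <-> forall t, I t -> forall (a : superbox D) k,
  (~~ in_first_column a -> derive_within I (e (bx (a := a) k)) t = row_at e (sleft a) t k) /\
  (in_first_column a -> derive_within I (e (bx (a := a) k)) t = row_at f a t k).
Proof.
have L (a : superbox D) k : ~~ in_first_column a -> lift (e (bx (a := sleft a) k)) =
    fr e (box_row (bx (a := a) k)) (sbcol a).-1.
  by move=> ha; rewrite -frame_row_box /box_col -sbcol_sleft.
split=> [eqe t It a k|H].
  have := eqe _ _ (box_col_lt (bx (a := a) k)); rewrite !frame_row_box d_lift//.
  have sde := @smooth_derive _ _ P _ (@se (bx (a := a) k)).
  move=> E; split=> ha.
    have : lift (derive_within I (e (bx k))) = lift (e (bx (a := sleft a) k)).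
      rewrite E L//; move: ha; rewrite /in_first_column /box_col/=.
      by case: (sbcol a).
    by move/(lift_eqP sde (@se _)) => ->.
  have : lift (derive_within I (e (bx k))) = lift (f (bx (a := a) k)).
    rewrite E -(frame_row_box P f); move: ha; rewrite /in_first_column /box_col/=.
    by move=> /eqP ->.
  by move/(lift_eqP sde (@sf _)) => ->.
apply: box_rowcol_ind => -[a k]; rewrite frame_row_box d_lift//.
have sde := @smooth_derive _ _ P _ (@se (bx (a := a) k)).
have [ha|ha] := boolP (in_first_column a).
  rewrite [box_col _](eqP ha) -[X in fr f _ X](eqP ha) -/(bx k) -[sbcol a]/(box_col (bx k)).
  rewrite frame_row_box; apply/(lift_eqP sde (@sf _)) => t It.
  by have [_ h] := H t It a k; exact: h.
have -> : (if box_col (bx k) is x'.+1 then fr e (box_row (bx k)) x' else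
     fr f (box_row (bx k)) 0) = lift (e (bx (a := sleft a) k)).
  by rewrite L//; move: ha; rewrite /in_first_column /box_col/=; case: (sbcol a).
apply/(lift_eqP sde (@se _)) => t It.
by have [h _] := H t It a k; exact: h.
Qed.

Lemma complete_rows : (forall t, I t -> is_frame e f t) -> complete_frame S p (fr e) (fr f).
Proof.
move=> H v Hv; apply: ev_mx_eq => t It; rewrite map_mx0.
apply: (can_inj (@vec_ofK R W)); rewrite linear0.
have E z := Hv _ _ (box_col_lt z).
apply: (frame_nondegenerate omega_symplectic (H t It)) => z; have := E z;
  rewrite !frame_row_box => -[E1 E2].
  by rewrite -[e z t]row_ofK -(@lift_rowE _ _ P _ _ (@se z) It) -ev_w_vec E1 rmorph0.
by rewrite -[f z t]row_ofK -(@lift_rowE _ _ P _ _ (@sf z) It) -ev_w_vec E2 rmorph0.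
Qed.

Lemma ev_curvature z z' t : I t ->
  ev t (curvature S (fr f) (box_row z) (box_col z) (box_row z') (box_col z')) =
  omega (f z' t) (derive_within I (f z) t).
Proof.
move=> It; rewrite /curvature !frame_row_box d_lift// form_lift//.
exact: (@smooth_derive _ _ P).
Qed.

Lemma ecomb_rows (c : T -> nat -> C) t : I t ->
  vec_of ((ecomb p (fr e) c)^@t) =
  \sum_(b : superbox D) \sum_(j < ssize b) ev t (c (box_row (bx j)) (sbcol b)) *: e (bx j) t.
Proof.
move=> It; rewrite /ecomb (sum_rows_boxes (fun l y => c l y *: fr e l y)) map_mx_sum linear_sum /=.
apply: eq_bigr => b _; rewrite map_mx_sum linear_sum /=; apply: eq_bigr => j _.
rewrite map_mxZ linearZ /=; congr (_ *: _).
by rewrite (frame_row_box P e (bx j)) (@lift_rowE _ _ P)// row_ofK.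
Qed.

Lemma f_equation_rows t (a : superbox D) k : normal_frame S p (fr e) (fr f) -> I t ->
  derive_within I (f (bx k)) t =
  \sum_(b : superbox D) \sum_(j < ssize b)
     ev t (curvature S (fr f) (box_row (bx (a := a) k)) (sbcol a) (box_row (bx j)) (sbcol b)) *: e (bx j) t
  - (if special a then 0 else f (bx (a := sright a) k) t).
Proof.
move=> [ef eqe cf _] It; rewrite -(ecomb_rows _ It).
have := f_equation ef eqe cf (box_col_lt (bx (a := a) k)).
rewrite [in d _]frame_row_box d_lift// => /(congr1 (fun v => vec_of (v^@t))).
rewrite (@lift_rowE _ _ P)//; last exact: (@smooth_derive _ _ P).
rewrite row_ofK => ->; rewrite map_mxB linearB /=; congr (_ - _).
rewrite /box_col /row_width /= -nonspecial_lt; case: ifP => sa.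
  rewrite -[X in _ = X]row_ofK (_ : special a = false) ?(negbTE sa)//.
  rewrite -(@lift_rowE _ _ P _ _ (@sf _) It) -(frame_row_box P f) /box_col /= sbcol_sright//.
by rewrite map_mx0 linear0 (negbFE sa).
Qed.

(** The dictionary between moving frames and normal frames over the ring, with the curvature as the
    family of mappings. The span condition is reduced to membership in [Lam t]; the converse
    direction regains it by dimension. *)
Theorem normal_moving_frame_rows : normal_moving_frame omega I Lam e f <->
  normal_frame S p (fr e) (fr f) /\ forall t, I t -> forall z, e z t \in Lam t.
Proof.
split=> [[[_ _ isf] ef LamE [M HM]]|[nf eLam]].
  split; last first.
    move=> t It z; rewrite LamE// memv_span//; apply/mapP; exists z => //.
    by rewrite mem_enum.
  split.
  - exact/darboux_pairings_rows.
  - apply/e_equations_rows => t It a k; have [_ /(_ a k)[h1 h2 _ _]] := HM t It.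
    by split.
  - exact: complete_rows.
  - apply: (normal_mapping_curvature D_young (M := M)); last first.
      by move=> t It; have [] := HM t It.
    move=> t a b j k It; have [_ se_] := HM t It.
    have := @ev_curvature (bx k) (bx j) t It; rewrite /box_col/= => ->.
    have efj z := ef t It (bx (a := b) j) z.
    (* Pairing the structure equation with [f (bx j) t] extracts one matrix entry, by duality. *)
    have lin : omega (f (bx j) t) (\sum_b vrow_mul (row_at e b t) (M t a b) k) = M t a b j k.
      rewrite linear_sumr /= (bigD1 b)//= [X in _ + X]big1 ?addr0 => [|b' bb'].
        rewrite /vrow_mul linear_sumr /= (bigD1 j)//= [X in _ + X]big1 ?addr0 => [|j' jj'].
          by rewrite linearZr_LR /= /row_at; have [_ _ ->] := efj (bx j); rewrite eqxx mulr1.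
        rewrite linearZr_LR /= /row_at; have [_ _ ->] := efj (bx j').
        by rewrite eq_Tagged /= eq_sym (negPf jj') mulr0.
      rewrite /vrow_mul linear_sumr /= big1// => j' _.
      rewrite linearZr_LR /= /row_at; have [_ _ ->] := efj (bx j').
      case: eqP => [/(congr1 tag)/= h|]; last by rewrite mulr0.
      by rewrite h eqxx in bb'.
    have [_ _ h3 h4] := se_ a k.
    have [sa|sa] := boolP (special a); first by rewrite h4.
    rewrite h3// linearBr /= lin /row_at.
    by have [_ -> _] := efj (bx (a := sright a) k); rewrite subr0.
have [ef eqe cf nc] := nf.
have ef' := darboux_pairings_rows.2 ef.
have isf t : I t -> is_frame e f t by move=> It; exact: (darboux_is_frame dimW sumD (ef' t It)).
have [_ lag] := Lam_curve.
split => //.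
  by move=> t It; apply: (darboux_lagrangian_span sumD (ef' t It) _ (eLam t It)); have [] := lag t It.
pose M t : compatible_mapping D R := fun a b => \matrix_(j, k)
  ev t (curvature S (fr f) (box_row (bx k)) (sbcol a) (box_row (bx j)) (sbcol b)).
exists M => t It; split.
  apply: (curvature_normal_mapping D_young _ _ nc It) => [s a b j k _|r x l y xr yl].
    by rewrite mxE.
  exact: curvature_sym ef _ _ _ _ xr yl.
move=> a k; have [h1 h2] := (e_equations_rows.1 eqe) t It a k.
have := f_equation_rows k nf It.
have -> : \sum_(b : superbox D) \sum_(j < ssize b)
     ev t (curvature S (fr f) (box_row (bx (a := a) k)) (sbcol a) (box_row (bx j)) (sbcol b)) *: e (bx j) t =
     \sum_b vrow_mul (row_at e b t) (M t a b) k.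
  by apply: eq_bigr => b _; apply: eq_bigr => j _; rewrite mxE.
by move=> E; split => // sa; rewrite E ?(negPf sa) ?sa ?subr0.
Qed.

End NormalMovingFrames.

Section FrameCongruence.
Variables (K : comUnitRingType) (V : lmodType K) (S : diff_symplectic V).
Variables (T : finType) (p : T -> nat).
Variables (e f e' f' : T -> nat -> V).
Hypothesis efE : forall r x, (x < p r)%N -> e r x = e' r x /\ f r x = f' r x.

Lemma eq_darboux_pairings : darboux_pairings S p e f -> darboux_pairings S p e' f'.
Proof.
move=> H r x l y xr yl; have [<- <-] := efE xr; have [<- <-] := efE yl.
exact: H.
Qed.

Lemma eq_e_equations : e_equations S p e f -> e_equations S p e' f'.
Proof.
move=> H r x xr; have [<- _] := efE xr; rewrite H//.
case: x xr => [|x] xr; first by have [_ <-] := efE xr.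
by have [<- _] := efE (ltnW xr).
Qed.

Lemma eq_complete_frame : complete_frame S p e f -> complete_frame S p e' f'.
Proof.
by move=> H v Hv; apply: H => r x xr; have [-> ->] := efE xr; exact: Hv.
Qed.

Lemma eq_normal_curvature : normal_curvature S p f -> normal_curvature S p f'.
Proof.
have cE r x l y : (x < p r)%N -> (y < p l)%N -> curvature S f' r x l y = curvature S f r x l y.
  by move=> xr yl; rewrite /curvature; have [_ ->] := efE xr; have [_ ->] := efE yl.
move=> [H1 H2 H3 H4]; split.
- by move=> r x l y xr yl *; rewrite cE//; exact: H1.
- by move=> r x l y xr yl *; rewrite cE//; exact: H2.
- by move=> r x l y xr yl *; rewrite cE//; exact: H3.
- move=> r l x rl xr; have xr' := ltnW xr.
  by rewrite !cE -?rl//; exact: H4.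
Qed.

Lemma eq_normal_frame : normal_frame S p e f -> normal_frame S p e' f'.
Proof.
case=> h1 h2 h3 h4; split; [exact: eq_darboux_pairings h1|exact: eq_e_equations h2| |].
  exact: eq_complete_frame h3.
exact: eq_normal_curvature h4.
Qed.

End FrameCongruence.

Section Dimensions.
Variables (R : realType) (W : vectType R) (m : nat) (dimW : \dim {:W} = m.*2).
Variables (omega : {skew_symmetric W}) (omega_symplectic : is_psymplectic omega).
Variables (I : set R) (I_itv : is_interval I) (I_nd : I° !=set0).
Variables (Lam : R -> {vspace W}) (Lam_curve : lagrangian_curve omega I m Lam).
Variables (D : seq nat) (Lam_D : curve_diagram I Lam D).

Lemma dim_extension0 t : I t -> \dim (extension I Lam 0 t) = m.
Proof.
move=> It; have [X HX] := curve_frame I_itv I_nd Lam_curve.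
rewrite (dim_extension dimW omega_symplectic Lam_curve HX)//.
have [/eqP rX _] := HX t It; rewrite -[RHS]rX; apply: eqmx_rank; apply/andP; split.
  apply/row_subP => i; rewrite row_fam_mx; case: (enum_val i) => -[[|//] j0] j.
  by rewrite /jets /= map_row row_sub.
apply/row_subP => i.
have := row_fam_mx (@jets R I I_itv I_nd _ m _ (form_mx_skew omega) X 0) t (enum_rank (ord0, i)).
by rewrite enum_rankK /jets /= map_row => <-; exact: row_sub.
Qed.

Lemma dim_extension_minn q t : I t ->
  \dim (extension I Lam q t) = (m + \sum_(x <- D) minn x q)%N.
Proof.
move=> It; elim: q => [|q IH].
  by rewrite dim_extension0// big1 ?addn0// => x _; rewrite minn0.
by rewrite Lam_D// IH sum_min_column addnA.
Qed.

(** Once the q-th extension is everything, column q + 1 is empty, so no row is longer than q and the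
    truncated row lengths sum to the number of boxes, which the dimension 2 m then determines. *)
Lemma sum_diagram : eventually_full I Lam -> (\sum_(x <- D) x = m)%N.
Proof.
move=> [q full]; have [t0 /interior_subset It0] := I_nd.
have dq := dim_extension_minn q It0; rewrite full// dimW in dq.
have dq1 := dim_extension_minn q.+1 It0.
have : (\dim (extension I Lam q.+1 t0) <= m.*2)%N by rewrite -dimW dimvS ?subvf.
rewrite dq1 sum_min_column => cq.
have {cq} c0 : column D q.+1 = 0%N by lia.
suff -> : (\sum_(x <- D) x = \sum_(x <- D) minn x q)%N by lia.
rewrite !big_seq; apply: eq_bigr => x xD; apply/esym/minn_idPl.
rewrite leqNgt; apply/negP => qx; move: c0; rewrite /column => /eqP.
by rewrite eqn0Ngt -has_count => /hasPn/(_ x xD); rewrite qx.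
Qed.

End Dimensions.

Section Rotations.
Variables (R : realType) (W : vectType R).
Variables (I : set R) (I_itv : is_interval I) (I_nd : I° !=set0).
Variables (D : seq nat) (D_young : is_young D).
Local Notation n := (\dim {:W}).
Local Notation P := (itv_set I_itv I_nd).
Local Notation C := (smooth_fun P).
Local Notation ev t := (@sm_ev R P t).
Local Notation cst := (@sm_cst R P).
Local Notation "M ^@ t" := (map_mx (ev t) M) (at level 8).
Local Notation T := (young_row D).
Local Notation tg := (Tagged (fun i : 'I_(depth D) => 'I_(height i))).
Local Notation p := (@row_width D).
Local Notation fr := (@frame_row R W P D).

Lemma ev_rotate (u : T -> T -> C) (g : box D -> R -> W) t (a : superbox D) k :
  (forall z, smooth I (g z)) -> I t -> (forall r l, p r != p l -> u r l = 0) ->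
  vec_of ((rotate u (fr g) (box_row (bx (a := a) k)) (sbcol a))^@t) =
  \sum_(k' < ssize a) ev t (u (box_row (bx (a := a) k)) (box_row (bx (a := a) k'))) *: g (bx k') t.
Proof.
move=> sg It u0; rewrite /rotate big_tagged (bigD1 (level a))//= [X in _ + X]big1 ?addr0.
  rewrite map_mx_sum linear_sum /=; apply: eq_bigr => k' _.
  rewrite map_mxZ linearZ /=; congr (_ *: _).
  by rewrite (frame_row_box P g (bx (a := a) k')) (@lift_rowE _ _ P)// row_ofK.
move=> i ia; rewrite big1// => k' _; rewrite u0 ?scale0r//.
by apply: contra ia => /eqP/width_inj/= e; rewrite -e.
Qed.

Section Rotation.
Variable U : forall i : 'I_(depth D), 'M[R]_(height i).

(** Block diagonal with blocks the transposes of the [U i]. The sum has at most one term; it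
    replaces a cast from the rows of the rectangle of l to those of r. *)
Definition row_rotation (r l : T) : C :=
  \sum_(k' : 'I_(height (tag r)) | tg k' == l)
    cst (U (tag r) k' (tagged r)).

Lemma row_rotationE i (k k' : 'I_(height i)) :
  row_rotation (tg k) (tg k') =
  cst (U i k' k).
Proof. by rewrite /row_rotation (big_pred1 k')// => j; rewrite eq_Tagged. Qed.

Lemma row_rotation0 r l : tag r != tag l -> row_rotation r l = 0.
Proof.
move=> rl; rewrite /row_rotation big_pred0// => k'; apply/negP => /eqP e.
by rewrite -e eqxx in rl.
Qed.

Lemma row_rotation_orthogonal (S : diff_symplectic 'rV[C]_n) : dsK S =1 @sm_der R P ->
  (forall i, (U i)^T *m U i = 1%:M) -> const_orthogonal S p row_rotation.
Proof.
move=> SD UU; split.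
- by move=> r l rl; apply: row_rotation0; apply: contra rl => /eqP e; rewrite /row_width e.
- move=> [i k] [j k2]; rewrite big_tagged (bigD1 i)//= [X in _ + X]big1 ?addr0; last first.
    move=> i' ii'; rewrite big1// => k' _.
    by rewrite (@row_rotation0 (tg k)) ?mul0r//= eq_sym.
  have [ij|ij] := eqVneq i j; last first.
    rewrite big1 => [|k' _]; last by rewrite (@row_rotation0 (tg k2)) ?mulr0//= eq_sym.
    by case: eqP => // /(congr1 tag)/= e; rewrite e eqxx in ij.
  subst j; rewrite -[existT _ i k]/(tg k).
  rewrite -[existT _ i k2]/(tg k2) eq_Tagged.
  have := congr1 (fun B : 'M[R]_(height i) => B k k2) (UU i); rewrite !mxE => e.
  under eq_bigr do rewrite !row_rotationE -rmorphM.
  rewrite -rmorph_sum -[RHS](rmorph_nat cst) -e; congr (cst _).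
  by apply: eq_bigr => k' _; rewrite mxE.
- move=> r l; rewrite SD /row_rotation raddf_sum big1// => k' _; exact: sm_der_cst.
Qed.

End Rotation.
End Rotations.

Section NormalFrameExistence.
Variables (R : realType) (W : vectType R) (m : nat) (dimW : \dim {:W} = m.*2).
Variables (omega : {skew_symmetric W}) (omega_symplectic : is_psymplectic omega).
Variables (I : set R) (I_itv : is_interval I) (I_nd : I° !=set0).
Variables (Lam : R -> {vspace W}) (Lam_curve : lagrangian_curve omega I m Lam).
Variables (D : seq nat) (D_young : is_young D) (Lam_D : curve_diagram I Lam D).
Hypotheses (Lam_full : eventually_full I Lam).
Local Notation n := (\dim {:W}).
Local Notation P := (itv_set I_itv I_nd).
Local Notation C := (smooth_fun P).
Local Notation ev t := (@sm_ev R P t).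
Local Notation "M ^@ t" := (map_mx (ev t) M) (at level 8).
Local Notation Om := (form_mx omega).
Local Notation S := (@row_symplectic R I I_itv I_nd n Om (form_mx_skew omega)).
Local Notation T := (young_row D).
Local Notation tg := (Tagged (fun i : 'I_(depth D) => 'I_(height i))).
Local Notation p := (@row_width D).
Local Notation fr := (@frame_row R W P D).
Local Notation lift := (@lift_row R W P).

Let sumD : (\sum_(x <- D) x = m)%N :=
  sum_diagram dimW omega_symplectic I_itv I_nd Lam_curve Lam_D Lam_full.
Let p0 : forall r, (0 < p r)%N := row_width_gt0 D_young.

Theorem normal_moving_frame_exists : nondecreasing_curve omega I Lam ->
  exists e f : box D -> R -> W, normal_moving_frame omega I Lam e f.
Proof.
move=> mono; have [X HX] := curve_frame I_itv I_nd Lam_curve.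
have X_free t : I t -> row_free (X^@t) by move=> It; have [] := HX t It.
have [||eps [tab sect_eps]] := special_vectors (nE dimW) (form_mx_unit omega_symplectic)
    X_free (frame_iso Lam_curve HX) p0.
- move=> q t It; rewrite -(dim_extension dimW omega_symplectic Lam_curve HX q It).
  rewrite (dim_extension_minn dimW omega_symplectic I_itv I_nd Lam_curve Lam_D q It).
  rewrite (sum_young_rows D (fun x => x - q)%N) -addnA -big_split /= dimW -addnn.
  (* Here minn x q + (x - q) = x for each row, so the rank and the truncated rows add up to 2 m. *)
  by congr (m + _)%N; rewrite -sumD; apply: eq_bigr => x _; lia.
- move=> v sv t It; have sc := @smooth_curve_of R W P v.
  have := mono (curve_of v) t _ It; rewrite /velocity.
  rewrite -(form_lift omega I_itv I_nd (@smooth_derive _ _ P _ sc) sc It).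
  rewrite -(d_lift omega I_itv I_nd sc) curve_ofK; apply.
  by apply/(sections_lift dimW omega_symplectic Lam_curve HX); rewrite curve_ofK.
have [f [ef eqe nc]] := frame_of_table p0 tab.
pose e0 := eframe S p eps; rewrite -/e0 in ef eqe.
pose ee (z : box D) := curve_of (e0 (box_row z) (box_col z)).
pose ff (z : box D) := curve_of (f (box_row z) (box_col z)).
have se z : smooth I (ee z) by exact: (@smooth_curve_of R W P).
have sf z : smooth I (ff z) by exact: (@smooth_curve_of R W P).
have E r x : (x < p r)%N -> e0 r x = fr ee r x /\ f r x = fr ff r x.
  by move=> xr; rewrite !frame_row_curve_of.
exists ee, ff.
apply/(normal_moving_frame_rows dimW omega_symplectic I_itv I_nd Lam_curve D_young sumD se sf).
have dar := eq_darboux_pairings E ef.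
split; last first.
  move=> t It z; move: t It.
  apply/(sectP dimW omega_symplectic Lam_curve HX); apply: sect_eps.
  by have := box_col_lt z; lia.
split => //; [exact: eq_e_equations E eqe| |exact: eq_normal_curvature E nc].
apply: (complete_rows omega_symplectic se sf) => t It.
apply: (darboux_is_frame dimW sumD).
exact: ((darboux_pairings_rows omega I_itv I_nd se sf).2 dar t It).
Qed.

Theorem normal_moving_frame_unique (e f e' f' : box D -> R -> W) :
  normal_moving_frame omega I Lam e f -> moving_frame I e' f' ->
  (normal_moving_frame omega I Lam e' f' <->
   forall i : 'I_(depth D), exists U : 'M[R]_(height i),
     U^T *m U = 1%:M /\
     forall (t : R) (c : 'I_(width i)), I t ->
       row_at e' (sbox c) t = vrow_mul (row_at e (sbox c) t) U /\
       row_at f' (sbox c) t = vrow_mul (row_at f (sbox c) t) U).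
Proof.
move=> nef [se' sf' _]; have [[se sf _] _ _ _] := nef.
have NR g h := normal_moving_frame_rows dimW omega_symplectic I_itv I_nd Lam_curve D_young sumD
  (e := g) (f := h).
have [nf eLam] := (NR _ _ se sf).1 nef.
have [t0 /interior_subset It0] := I_nd; have [_ lag] := Lam_curve.
have fr_ev g t (a : superbox D) k : (forall z, smooth I (g z)) -> I t ->
    g (bx (a := a) k) t = vec_of ((fr g (box_row (bx (a := a) k)) (sbcol a))^@t).
  move=> sg It; rewrite (frame_row_box P g (bx (a := a) k)) (@lift_rowE _ _ P)//.
  by rewrite row_ofK.
split=> [/(NR _ _ se' sf')[nf' eLam']|H].
  have [|u [u0 uu uc] uE] := normal_frame_unique p0 nf nf'.
    (* Both families e and e' lie in the same Lagrangian subspace at each t. *)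
    move=> r x l y xr; move: l y; apply: box_rowcol_ind => z'; move: r x xr.
    apply: box_rowcol_ind => z; rewrite !frame_row_box.
    apply: sm_ev_eq => t It; rewrite form_lift// rmorph0.
    by have [_ H] := lag t It; apply: H; [exact: eLam'|exact: eLam].
  (* Transposed, as [rotate] sums over the second index of u and [vrow_mul] over the first index of
     U. Evaluation at t0 loses nothing, the entries of u being constant. *)
  move=> i; pose U : 'M[R]_(height i) := \matrix_(k', k)
    ev t0 (u (tg k) (tg k')).
  have evu t r l : I t -> ev t (u r l) = ev t0 (u r l).
    by move=> It; rewrite {1}(der0_cst It0 (uc r l)) sm_ev_cst.
  exists U; split.
    apply/matrixP => k k2; rewrite !mxE.
    have := congr1 (ev t0) (uu (tg k)
      (tg k2)).
    rewrite rmorph_nat eq_Tagged /= => <-; rewrite big_tagged (bigD1 i)//=.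
    rewrite [X in _ + X]big1 ?addr0.
      by rewrite rmorph_sum; apply: eq_bigr => k' _; rewrite !mxE rmorphM.
    move=> j ji; rewrite big1// => k' _; rewrite u0 ?mul0r//.
    by apply: contra ji => /eqP/width_inj/= ->.
  move=> t c It; split; apply/funext => k; rewrite /row_at fr_ev//.
    have [-> _] := uE _ _ (box_col_lt (bx (a := sbox c) k)).
    rewrite ev_rotate//; apply: eq_bigr => k' _.
    by rewrite evu// mxE.
  have [_ ->] := uE _ _ (box_col_lt (bx (a := sbox c) k)).
  rewrite ev_rotate//; apply: eq_bigr => k' _.
  by rewrite evu// mxE.
have [U HU] : exists U : forall i : 'I_(depth D), 'M[R]_(height i), forall i,
    (U i)^T *m U i = 1%:M /\ forall (t : R) (c : 'I_(width i)), I t ->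
       row_at e' (sbox c) t = vrow_mul (row_at e (sbox c) t) (U i) /\
       row_at f' (sbox c) t = vrow_mul (row_at f (sbox c) t) (U i).
  by exists (fun i => projT1 (cid (H i))) => i; exact: projT2 (cid (H i)).
have UU i : (U i)^T *m U i = 1%:M by have [] := HU i.
have e'E t (a : superbox D) k : I t ->
    e' (bx (a := a) k) t = \sum_(k' < ssize a) U (level a) k' k *: e (bx k') t /\
    f' (bx (a := a) k) t = \sum_(k' < ssize a) U (level a) k' k *: f (bx k') t.
  case: a k => i c k It; have [_ /(_ t c It)[h1 h2]] := HU i.
  by split; [exact: (congr1 (fun g => g k) h1)|exact: (congr1 (fun g => g k) h2)].
pose u := row_rotation I_itv I_nd U.
have uo : const_orthogonal S p u by exact: row_rotation_orthogonal.
have nfu := rotate_normal p0 uo nf.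
have [u0 _ _] := uo.
have rot (g g' : box D -> R -> W) : (forall z, smooth I (g z)) -> (forall z, smooth I (g' z)) ->
    (forall t (a : superbox D) k, I t ->
      g' (bx (a := a) k) t = \sum_(k' < ssize a) U (level a) k' k *: g (bx k') t) ->
    forall r x, (x < p r)%N -> rotate u (fr g) r x = fr g' r x.
  move=> sg sg' gE; apply: box_rowcol_ind => -[a k].
  rewrite [RHS]frame_row_box; apply: ev_mx_eq => t It; apply: (can_inj (@vec_ofK R W)).
  rewrite (@lift_rowE _ _ P)// row_ofK [RHS]gE//.
  rewrite [LHS](ev_rotate (a := a) k sg It u0); apply: eq_bigr => k' _; congr (_ *: _).
  by rewrite [u _ _](@row_rotationE _ _ I_itv I_nd D U (level a) k k') sm_ev_cst.
apply/(NR _ _ se' sf'); split.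
  apply: eq_normal_frame nfu => r x xr; split; apply: rot => // t a k It.
    by have [] := e'E t a k It.
  by have [] := e'E t a k It.
move=> t It [a k]; have [-> _] := e'E t a k It.
by apply: memv_suml => k' _; apply: memvZ; exact: eLam.
Qed.

End NormalFrameExistence.

Theorem theorem1 (R : realType) (W : vectType R) (m : nat)
    (dimW : \dim {:W} = m.*2)
    (omega : {skew_symmetric W}) (omega_symplectic : is_psymplectic omega)
    (I : set R) (I_interval : is_interval I) (I_nondegenerate : I° !=set0)
    (Lam : R -> {vspace W}) (Lam_curve : lagrangian_curve omega I m Lam)
    (Lam_dim : constant_dimensions I Lam) (Lam_full : eventually_full I Lam)
    (Lam_monotone : nondecreasing_curve omega I Lam)
    (D : seq nat) (D_young : is_young D) (Lam_D : curve_diagram I Lam D) :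
  (exists e f : box D -> R -> W, normal_moving_frame omega I Lam e f) /\
  (forall e f : box D -> R -> W, normal_moving_frame omega I Lam e f ->
   forall e' f' : box D -> R -> W, moving_frame I e' f' ->
     (normal_moving_frame omega I Lam e' f' <->
      forall i : 'I_(depth D), exists U : 'M[R]_(height i),
        U^T *m U = 1%:M /\
        forall (t : R) (c : 'I_(width i)), I t ->
          row_at e' (sbox c) t = vrow_mul (row_at e (sbox c) t) U /\
          row_at f' (sbox c) t = vrow_mul (row_at f (sbox c) t) U)).
Proof.
split=> [|e f nef e' f' mef'].
  exact: (normal_moving_frame_exists dimW omega_symplectic I_interval I_nondegenerate
    Lam_curve D_young Lam_D Lam_full Lam_monotone).
exact: (normal_moving_frame_unique dimW omega_symplectic I_interval I_nondegenerate
  Lam_curve D_young Lam_D Lam_full nef mef').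
Qed.
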